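(* Let $0<\sigma<1$ and let $f\in\operatorname{Dom}(L^\sigma)$. A solution $u$ of the extension problem $$u(x,0)=f(x)\ \text{ on }\Omega,\qquad -L_xu+\frac{1-2\sigma}{y}\,u_y+u_{yy}=0\ \text{ in }\Omega\times(0,\infty),$$ is given by $$u(x,y)=\frac{1}{\Gamma(\sigma)}\int_0^\infty e^{-tL}(L^\sigma f)(x)\,e^{-\frac{y^2}{4t}}\,\frac{dt}{t^{1-\sigma}},$$ and $$\lim_{y\to0^+}\frac{u(x,y)-u(x,0)}{y^{2\sigma}}=\frac{\Gamma(-\sigma)}{4^\sigma\Gamma(\sigma)}L^\sigma f(x)=\frac{1}{2\sigma}\lim_{y\to0^+}y^{1-2\sigma}u_y(x,y).$$ Moreover, the following Poisson formula for $u$ holds: $$u(x,y)=\frac{y^{2\sigma}}{4^\sigma\Gamma(\sigma)}\int_0^\infty e^{-tL}f(x)\,e^{-\frac{y^2}{4t}}\,\frac{dt}{t^{1+\sigma}}=\frac{1}{\Gamma(\sigma)}\int_0^\infty e^{-\frac{y^2}{4r}L}f(x)\,e^{-r}\,\frac{dr}{r^{1-\sigma}}.$$ All identities are understood in $L^2(\Omega,d\eta)$.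
   Context: Setting: $\Omega\subset\mathbb{R}^n$ ($n\ge1$) is open, $d\eta$ is a positive measure on $\Omega$, and $L$ is a linear second order partial differential operator which is nonnegative, densely defined and self-adjoint in $L^2(\Omega)=L^2(\Omega,d\eta)$. $L_x$ means that $L$ acts in the variable $x$. Let $E$ be the unique resolution of the identity of $L$, supported on the spectrum of $L$ (a subset of $[0,\infty)$), so that $L=\int_0^\infty\lambda\,dE(\lambda)$. For a real measurable function $\phi$ on $[0,\infty)$, $\phi(L)=\int_0^\infty\phi(\lambda)\,dE(\lambda)$ is the operator with domain $\{f\in L^2(\Omega):\int_0^\infty|\phi(\lambda)|^2dE_{f,f}(\lambda)<\infty\}$ defined by $\langle\phi(L)f,g\rangle_{L^2(\Omega)}=\int_0^\infty\phi(\lambda)\,dE_{f,g}(\lambda)$ for $g\in L^2(\Omega)$. In this way $e^{-tL}$ ($t\ge0$) and $L^\sigma$ ($0<\sigma<1$) are defined. $\Gamma$ is the Gamma function and $\Gamma(-\sigma):=\Gamma(1-\sigma)/(-\sigma)<0$. Integrals of $L^2(\Omega)$-valued functions, and limits and derivatives in $y$, are understood through pairings with arbitrary $g\in L^2(\Omega)$; e.g. the first formula for $u$ means $\langle u(\cdot,y),g\rangle_{L^2(\Omega)}=\frac1{\Gamma(\sigma)}\int_0^\infty\langle e^{-tL}L^\sigma f,g\rangle_{L^2(\Omega)}e^{-y^2/(4t)}\frac{dt}{t^{1-\sigma}}$.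
   Formalization: The first formula for u (with e^{-tL}L^σ f) is claimed only when f is orthogonal to the kernel of L, since it fails otherwise (for f in ker L it gives u=0); the extension problem, both limits and both Poisson formulas are proved for every f in Dom(L^σ). *)

(* Defs.v *)
From HB Require Import structures.
From mathcomp Require Import all_boot all_order all_algebra.
From mathcomp Require Import all_classical all_reals all_analysis.
From mathcomp Require Import complex.

Set Implicit Arguments.
Unset Strict Implicit.
Unset Printing Implicit Defensive.

Import Order.TTheory GRing.Theory Num.Theory.
Import numFieldNormedType.Exports.

Local Open Scope classical_set_scope.
Local Open Scope ring_scope.
Local Open Scope complex_scope.

(* R^n with its Borel sigma-algebra (convertible to 'rV[R]_n). *)
Definition borelRn (R : realType) (n : nat) :=
  g_sigma_algebraType (@open ('rV[R]_n)).

Section Gamma.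
Context {R : realType}.

Definition Gamma (s : R) : R :=
  \int[@lebesgue_measure R]_(t in `]0, +oo[) (t `^ (s - 1) * expR (- t)).

(* The value Gamma(-s), for 0 < s < 1. *)
Definition Gamma_opp (s : R) : R := Gamma (1 - s) / - s.

End Gamma.

(* Integrals of a real function with respect to a signed, resp. complex,
   measure, given as a plain set function: through the upper and lower
   variations (Jordan decomposition), resp. the real and imaginary parts. *)
Section signed_measure.
Context {d : measure_display} {S : measurableType d} {R : realType}.

Definition upper_variation (nu : set S -> R) (A : set S) : \bar R :=
  ereal_sup [set (nu B)%:E | B in [set B | measurable B /\ B `<=` A]].

Definition lower_variation (nu : set S -> R) : set S -> \bar R :=
  upper_variation (fun A => - nu A).

Definition signed_integral (nu : set S -> R) (D : set S) (phi : S -> R) : R :=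
  fine (\int[upper_variation nu]_(x in D) (phi x)%:E)%E -
  fine (\int[lower_variation nu]_(x in D) (phi x)%:E)%E.

Definition complex_integral (nu : set S -> R[i]) (D : set S) (phi : S -> R)
    : R[i] :=
  signed_integral (fun A => complex.Re (nu A)) D phi +i*
  signed_integral (fun A => complex.Im (nu A)) D phi.

End signed_measure.

(* An everywhere defined function together with the domain on which it is
   meaningful. *)
Record unbounded_operator (X : Type) := UnboundedOperator {
  opdom : set X ;
  opfun :> X -> X }.

(* Complex L^2(Omega, eta).  Its elements are represented by functions, and
   equality in L^2 is equality eta-a.e. on Omega.  A measure on Omega is
   a measure on the whole space, used only through Omega. *)
Section L2.
Context {d : measure_display} {T : measurableType d} {R : realType}.
Variables (eta : {measure set T -> \bar R}) (Omega : set T).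
Implicit Types (f g h : T -> R[i]).

Definition L2norm2 f : \bar R :=
  (\int[eta]_(x in Omega)
     ((complex.Re (f x)) ^+ 2 + (complex.Im (f x)) ^+ 2)%:E)%E.

Definition L2 : set (T -> R[i]) := [set f |
  [/\ measurable_fun Omega (fun x => complex.Re (f x)),
      measurable_fun Omega (fun x => complex.Im (f x)) &
      (L2norm2 f < +oo)%E]].

Definition inner f g : R[i] :=
  (\int[eta]_(x in Omega) complex.Re (f x * (g x)^*)) +i*
  (\int[eta]_(x in Omega) complex.Im (f x * (g x)^*)).

Definition is_operator (L : unbounded_operator (T -> R[i])) : Prop :=
  [/\ opdom L (fun=> 0) /\
        (forall f, opdom L f -> L2 f /\ L2 (L f)),
      forall f g, opdom L f -> L2 g -> f = g %[ae eta in Omega] ->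
        opdom L g /\ L f = L g %[ae eta in Omega] &
      forall (a : R[i]) f g, opdom L f -> opdom L g ->
        opdom L (fun x => a * f x + g x) /\
        L (fun x => a * f x + g x) = (fun x => a * L f x + L g x)
          %[ae eta in Omega]].

Definition densely_defined (L : unbounded_operator (T -> R[i])) : Prop :=
  forall f (e : R), L2 f -> 0 < e ->
    exists2 g, opdom L g & (L2norm2 (fun x => (f x - g x)%R) < e%:E)%E.

(* (g, h) belongs to the graph of the adjoint of L. *)
Definition adjoint_graph (L : unbounded_operator (T -> R[i])) g h : Prop :=
  [/\ L2 g, L2 h & forall f, opdom L f -> inner (L f) g = inner f h].

Definition self_adjoint (L : unbounded_operator (T -> R[i])) : Prop :=
  forall g h, adjoint_graph L g h <->
    [/\ opdom L g, L2 h & L g = h %[ae eta in Omega]].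

Definition nonnegative_operator (L : unbounded_operator (T -> R[i])) : Prop :=
  forall f, opdom L f -> 0 <= inner (L f) f.

Definition in_resolvent_set (L : unbounded_operator (T -> R[i])) (z : R[i])
    : Prop :=
  exists (B : (T -> R[i]) -> (T -> R[i])) (M : R),
    (forall g, L2 g ->
       [/\ opdom L (B g),
           (fun x => L (B g) x - z * B g x) = g %[ae eta in Omega] &
           (L2norm2 (B g) <= M%:E * L2norm2 g)%E]) /\
    (forall f, opdom L f ->
       B (fun x => L f x - z * f x) = f %[ae eta in Omega]).

Definition spectrum (L : unbounded_operator (T -> R[i])) : set R[i] :=
  [set z | ~ in_resolvent_set L z].

Definition orthogonal_projection (P : (T -> R[i]) -> (T -> R[i])) : Prop :=
  [/\ is_operator (UnboundedOperator L2 P),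
      forall f, L2 f -> P (P f) = P f %[ae eta in Omega] &
      forall f g, L2 f -> L2 g -> inner (P f) g = inner f (P g)].

(* Projection-valued measures on the Borel sets of R. *)
Definition resolution_of_identity (E : set R -> (T -> R[i]) -> (T -> R[i]))
    : Prop :=
  [/\ forall A : set R, measurable A -> orthogonal_projection (E A),
      forall f, L2 f -> E set0 f = (fun=> 0) %[ae eta in Omega],
      forall f, L2 f -> E setT f = f %[ae eta in Omega],
      forall (A B : set R) f, measurable A -> measurable B -> L2 f ->
        E (A `&` B) f = E A (E B f) %[ae eta in Omega] &
      forall (A : nat -> set R) f g, (forall k, measurable (A k)) ->
        trivIset setT A -> L2 f -> L2 g ->
        series (fun k => complex.Re (inner (E (A k) f) g)) @ \oo -->
          complex.Re (inner (E (\bigcup_k A k) f) g) /\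
        series (fun k => complex.Im (inner (E (A k) f) g)) @ \oo -->
          complex.Im (inner (E (\bigcup_k A k) f) g)].

Section functional_calculus.
Variable E : set R -> (T -> R[i]) -> (T -> R[i]).

(* E_{f,g} *)
Definition spectral_measure f g (A : set R) : R[i] := inner (E A f) g.

Definition calculus_dom (phi : R -> R) : set (T -> R[i]) := [set f |
  L2 f /\
  (\int[fun A => (complex.Re (spectral_measure f f A))%:E]_(l in `[0%R, +oo[)
     (`|phi l| ^+ 2)%:E < +oo)%E].

(* h = phi(L) f *)
Definition calculus_graph (phi : R -> R) f h : Prop :=
  [/\ calculus_dom phi f, L2 h &
      forall g, L2 g ->
        inner h g =
          complex_integral (spectral_measure f g) `[0, +oo[%classic phi].

Definition calculus (phi : R -> R) f : T -> R[i] :=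
  xget (fun=> 0) [set h | calculus_graph phi f h].

(* e^{-tL} *)
Definition heat (t : R) := calculus (fun l => expR (- (t * l))).

(* L^s *)
Definition fracpow (s : R) := calculus (fun l => l `^ s).

End functional_calculus.

(* E is concentrated on the spectrum of L, which lies in [0, +oo[, and
   L = \int_0^oo l dE(l), with equality of domains. *)
Definition spectral_resolution (L : unbounded_operator (T -> R[i]))
    (E : set R -> (T -> R[i]) -> (T -> R[i])) : Prop :=
  [/\ resolution_of_identity E,
      forall f, L2 f -> E `[0, +oo[%classic f = f %[ae eta in Omega],
      forall (A : set R) f, measurable A ->
        (forall l, A l -> ~ spectrum L l%:C) -> L2 f ->
        E A f = (fun=> 0) %[ae eta in Omega] &
      forall f h, calculus_graph E id f h <->
        [/\ opdom L f, L2 h & L f = h %[ae eta in Omega]]].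

(* On the kernel of L one has L^sigma f = 0, so that the integral of
   e^{-tL} L^sigma f only recovers the part of f orthogonal to the kernel. *)
Definition orthogonal_to_kernel (L : unbounded_operator (T -> R[i])) f
    : Prop :=
  forall h, opdom L h -> L h = (fun=> 0) %[ae eta in Omega] -> inner f h = 0.

(* h = c \int_0^oo F(t) k(t) dt, tested against arbitrary g in L^2; the scalar
   integrals are required to converge absolutely. *)
Definition weak_integral (c : R) (k : R -> R) (F : R -> T -> R[i]) h : Prop :=
  L2 h /\ forall g, L2 g ->
  let D : set R := `]0, +oo[%classic in
  let re := fun t => complex.Re (inner (F t) g) * k t in
  let im := fun t => complex.Im (inner (F t) g) * k t in
  [/\ (@lebesgue_measure R).-integrable D (EFin \o re),
      (@lebesgue_measure R).-integrable D (EFin \o im) &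
      inner h g = c%:C * ((\int[@lebesgue_measure R]_(t in D) re t) +i*
                          (\int[@lebesgue_measure R]_(t in D) im t))].

(* lim_{y -> 0+} v(y) = h *)
Definition weak_limit0 (v : R -> T -> R[i]) h : Prop :=
  L2 h /\ forall g, L2 g ->
    complex.Re (inner (v y) g) @[y --> 0^'+] --> complex.Re (inner h g) /\
    complex.Im (inner (v y) g) @[y --> 0^'+] --> complex.Im (inner h g).

(* h = v'(y) *)
Definition weak_derivative (v : R -> T -> R[i]) (y : R) h : Prop :=
  L2 h /\ forall g, L2 g ->
    is_derive y 1 (fun z => complex.Re (inner (v z) g))
                  (complex.Re (inner h g)) /\
    is_derive y 1 (fun z => complex.Im (inner (v z) g))
                  (complex.Im (inner h g)).

(* u solves the extension problem with boundary value f, and uy, uyy are its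
   derivatives in y; the boundary value is also attained as a limit. *)
Definition extension_solution (L : unbounded_operator (T -> R[i])) (sigma : R)
    f (u uy uyy : R -> T -> R[i]) : Prop :=
  [/\ u 0 = f %[ae eta in Omega], weak_limit0 u f &
      forall y, 0 < y ->
        [/\ opdom L (u y), weak_derivative u y (uy y),
            weak_derivative uy y (uyy y) &
            (fun x => - L (u y) x + ((1 - 2 * sigma) / y)%:C * uy y x
                      + uyy y x) = (fun=> 0) %[ae eta in Omega]]].

End L2.

Section differential_operator.
Context {R : realType} {n : nat}.

Definition partial (i : 'I_n) (h : 'rV[R]_n -> R) : 'rV[R]_n -> R :=
  fun x => 'D_(delta_mx 0 i) h x.

Definition cpartial (i : 'I_n) (f : 'rV[R]_n -> R[i]) : 'rV[R]_n -> R[i] :=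
  fun x => partial i (fun z => complex.Re (f z)) x +i*
           partial i (fun z => complex.Im (f z)) x.

Definition C2_on (Omega : set 'rV[R]_n) (h : 'rV[R]_n -> R) : Prop :=
  forall x, Omega x -> {for x, continuous h} /\
  forall i j : 'I_n,
    [/\ derivable h x (delta_mx 0 i),
        derivable (partial i h) x (delta_mx 0 j),
        {for x, continuous (partial i h)} &
        {for x, continuous (partial j (partial i h))}].

(* L acts on the twice continuously differentiable functions of its domain as
   sum_ij a_ij d_i d_j + sum_i b_i d_i + c, where (a_ij) is symmetric and not
   a.e. zero, so that the order is exactly two. *)
Definition second_order_pdo (eta : {measure set (borelRn R n) -> \bar R})
    (Omega : set (borelRn R n))
    (L : unbounded_operator (borelRn R n -> R[i])) : Prop :=
  exists (a : 'I_n -> 'I_n -> borelRn R n -> R[i])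
         (b : 'I_n -> borelRn R n -> R[i]) (c : borelRn R n -> R[i]),
  [/\ forall i j, a i j = a j i,
      ~ (forall i j, a i j = (fun=> 0) %[ae eta in Omega]) &
      forall f, opdom L f ->
        C2_on Omega (fun x => complex.Re (f x)) ->
        C2_on Omega (fun x => complex.Im (f x)) ->
        L f = (fun x => \sum_i \sum_j a i j x * cpartial i (cpartial j f) x
                        + \sum_i b i x * cpartial i f x + c x * f x)
          %[ae eta in Omega]].

End differential_operator.

(* Main.v *)
(* Everything is read off the spectral measures E_{f,g}.  The solution is
   u(y) = p_y(L) f with p_y(l) = K(y^2 l / 4) / Gamma(sigma), where
   K(z) = int_0^oo r^(sigma-1) e^(-r-z/r) dr, so that K(0) = Gamma(sigma).  The
   derivative K_sigma'(z) = - z^(sigma-1) K_(1-sigma)(z) (inversion r -> z/r)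
   turns the extension equation into an ordinary differential equation in y for
   each fixed l, and Cauchy's mean value theorem applied to K and z^sigma gives
   both limits at 0, dominated by a multiple of l^sigma.  As E_{f,g} is a
   difference of two finite measures whose squares are bounded by
   E_{f,f} E_{g,g}, functions that are square integrable for E_{f,f} are
   integrable for both, and dominated convergence, differentiation under the
   integral and Tonelli carry the scalar facts over to L.  The substitutions
   r = l t and r = y^2/(4t) in K give the three integral formulas; the first
   needs E_{f,f}{0} = 0, which is the orthogonality to the kernel of L. *)

Require Import Defs.
From HB Require Import structures.
From mathcomp Require Import all_boot all_order all_algebra.
From mathcomp Require Import all_classical all_reals all_analysis.
From mathcomp Require Import complex.
From mathcomp Require Import measurable_realfun ring lra.

Set Implicit Arguments.
Unset Strict Implicit.
Unset Printing Implicit Defensive.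

Import Order.TTheory GRing.Theory Num.Theory.
Import numFieldNormedType.Exports.
Import HBNNSimple.

Local Open Scope classical_set_scope.
Local Open Scope ring_scope.
Local Open Scope complex_scope.

(** * A modified Bessel function on the half-line *)

(** [calculus] selects some h in the graph and falls back to 0 when there is none, so phi(L) f has
    to be shown to exist. Step functions of E applied to f give summable increments, by the isometry
    with L2(E_{f,f}), and completeness of L2 is proved on representatives. Existence and composition
    are established for nonnegative phi only: then the spectral measures of phi(L) f come from
    densities that are themselves measures. Every kernel fed to the calculus is therefore
    nonnegative; kernels with signs, those of u_y, u_yy and the difference quotient, are assembled
    afterwards by linearity of the pairings. Complex pairings reduce to real ones, since the
    imaginary part of <h, g> is the real part of <h, i g>. Finally, l K(y^2 l / 4) is bounded in l
    for each y > 0; this puts u(y) in the domain of L although f is only in that of L^sigma. *)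

Section halfline.
Context {R : realType}.
Notation mu := (@lebesgue_measure R).
Implicit Types (c s t x y z : R) (G : R -> R).

Local Notation hl := (`]0%R, +oo[%classic : set R).
(** Centred at c, so that both x -> c x and x -> c / x carry the exhaustion centred at 1 onto this
    one. *)
Let hl_itv c (n : nat) : set R := `[c / n.+1%:R, c * n.+1%:R]%classic.

Lemma halfline_bigcup c : 0 < c -> hl = \bigcup_n hl_itv c n.
Proof.
move=> c0; apply/seteqP; split => x /=.
  rewrite in_itv/= andbT => x0.
  have [n [nx nc]] : exists n, x / c <= n.+1%:R /\ c / x <= n.+1%:R.
    exists (Num.bound (x / c) + Num.bound (c / x))%N; split.
      apply/ltW/(lt_le_trans (archi_boundP _)); first by rewrite divr_ge0 ?ltW.
      by rewrite ler_nat -addnS leq_addr.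
    apply/ltW/(lt_le_trans (archi_boundP _)); first by rewrite divr_ge0 ?ltW.
    by rewrite ler_nat -addSn leq_addl.
  exists n => //=; rewrite /hl_itv/= in_itv/=; apply/andP; split.
    by rewrite ler_pdivrMr ?ltr0n// mulrC -ler_pdivrMr.
  by rewrite mulrC -ler_pdivrMr.
move=> [n _]; rewrite /hl_itv/= !in_itv/= andbT => /andP[+ _].
by apply: lt_le_trans; rewrite divr_gt0// ltr0n.
Qed.

Lemma halfline_itv_sub c n : 0 < c -> hl_itv c n `<=` hl.
Proof. by move=> c0 x hx; rewrite (halfline_bigcup c0); exists n. Qed.

Lemma halfline_itv_nd c : 0 < c -> nondecreasing_seq (hl_itv c).
Proof.
move=> c0; apply/nondecreasing_seqP => n; rewrite subsetEset /hl_itv.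
apply: subset_itvSoo || apply: subset_itv; rewrite bnd_simp.
  by rewrite ler_pM2l// lef_pV2 ?posrE ?ltr0n// ler_nat.
by rewrite ler_pM2l// ler_nat.
Qed.

Lemma cvg_integral_halfline c (f : R -> \bar R) : 0 < c ->
  measurable_fun hl f -> (forall x, 0 < x -> (0 <= f x)%E) ->
  (\int[mu]_(x in (`[(c / n.+1%:R)%R, (c * n.+1%:R)%R]%classic : set R)) f x)%E @[n --> \oo] -->
  (\int[mu]_(x in hl) f x)%E.
Proof.
move=> c0 mf f0; rewrite (halfline_bigcup c0).
apply: ge0_nondecreasing_set_cvg_integral.
- exact: halfline_itv_nd.
- by move=> n; exact: measurable_itv.
- by move=> n; apply: measurable_funS mf => //; exact: halfline_itv_sub.
- move=> n x /(halfline_itv_sub c0); rewrite /= in_itv/= andbT; exact: f0.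
Qed.

Lemma continuous_halfline_measurable G :
  (forall x, 0 < x -> {for x, continuous G}) -> measurable_fun hl G.
Proof.
move=> cG; apply: open_continuous_measurable_fun; first exact: interval_open.
by move=> x; rewrite inE/= in_itv/= andbT => /cG.
Qed.

Lemma continuous_within_halfline G a b : 0 < a ->
  (forall x, 0 < x -> {for x, continuous G}) -> {within `[a, b], continuous G}.
Proof.
move=> a0 cG; apply: continuous_in_subspaceT => x.
by rewrite inE/= in_itv/= => /andP[ax _]; apply: cG; exact: lt_le_trans ax.
Qed.

(** The substitution is made on the compact intervals of the exhaustion, and both sides pass to the
    limit by monotonicity; no integrability is required. *)
Lemma integral_halfline_scale c G : 0 < c ->
  (forall x, 0 < x -> {for x, continuous G}) -> (forall x, 0 < x -> 0 <= G x) ->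
  (\int[mu]_(x in hl) (G x)%:E =
   \int[mu]_(x in hl) (G (c * x) * c)%:E)%E.
Proof.
move=> c0 cG G0.
have cGc x : 0 < x -> {for x, continuous (fun x => G (c * x) * c)}.
  move=> x0; apply: cvgM; last exact: cvg_cst.
  apply: (@continuous_comp _ _ _ (fun x => c * x) G).
    by apply: cvgM; [exact: cvg_cst|exact: cvg_id].
  by apply: cG; rewrite mulr_gt0.
have mE (F : R -> R) : (forall x, 0 < x -> {for x, continuous F}) ->
    measurable_fun hl (EFin \o F).
  by move=> cF; apply/measurable_EFinP; exact: continuous_halfline_measurable.
have G0E x : 0 < x -> (0 <= (EFin \o G) x)%E by move=> x0; rewrite lee_fin G0.
have G0cE x : 0 < x -> (0 <= (EFin \o (fun x => (G (c * x) * c)%R)) x)%E.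
  by move=> x0; rewrite lee_fin mulr_ge0 ?G0 ?mulr_gt0// ltW.
have C2 := cvg_integral_halfline ltr01 (mE _ cGc) G0cE.
have C1 := cvg_integral_halfline c0 (mE _ cG) G0E.
move: C1; rewrite (_ : (fun n => _) = (fun n => \int[mu]_(x in
    (`[(1 / n.+1%:R)%R, (1 * n.+1%:R)%R]%classic : set R))
    (EFin \o (fun x => (G (c * x) * c)%R)) x)%E).
  by move=> C1; exact: (cvg_unique (@ereal_hausdorff R) C1 C2).
apply/funext => n.
pose F (x : R) : R := c * x.
have dF (x : R) : is_derive x 1 F c.
  by apply: is_derive_eq; rewrite /GRing.scale/= mulr1.
have dFE : derive1 F =1 (fun=> c).
  by move=> x; rewrite derive1E; apply: derive_val.
have {}dFE := funext dFE.
have -> : c / n.+1%:R = F (1 / n.+1%:R) by rewrite /F mul1r.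
have -> : c * n.+1%:R = F (1 * n.+1%:R) by rewrite /F mul1r.
rewrite (@integration_by_substitution_increasing _ F).
- by apply: eq_integral => x _; rewrite dFE.
- by rewrite mul1r mul1r (le_trans (y := 1))// ?invf_le1 ?ler1n ?ltr0n.
- by move=> x y _ _ xy; rewrite ltr_pM2l.
- by rewrite dFE => x _; exact: cvg_cst.
- by rewrite dFE; apply/cvg_ex; exists c; exact: cvg_cst.
- by rewrite dFE; apply/cvg_ex; exists c; exact: cvg_cst.
- split.
  + by move=> x _; exact: ex_derive.
  + by apply: cvg_at_right_filter; apply: cvgM; [exact: cvg_cst|exact: cvg_id].
  + by apply: cvg_at_left_filter; apply: cvgM; [exact: cvg_cst|exact: cvg_id].
- by apply: continuous_within_halfline => //; rewrite /F mulr_gt0// divr_gt0// ltr0n.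
Qed.

Lemma integral_halfline_inv c G : 0 < c ->
  (forall x, 0 < x -> {for x, continuous G}) -> (forall x, 0 < x -> 0 <= G x) ->
  (\int[mu]_(x in hl) (G x)%:E =
   \int[mu]_(x in hl) (G (c / x) * (c / x ^+ 2))%:E)%E.
Proof.
move=> c0 cG G0.
have cV x : 0 < x -> {for x, continuous (fun x : R => c / x)}.
  move=> x0; apply: cvgM; first exact: cvg_cst.
  by apply: inv_continuous; rewrite gt_eqF.
have cD x : 0 < x -> {for x, continuous (fun x : R => c / x ^+ 2)}.
  move=> x0; apply: cvgM; first exact: cvg_cst.
  apply: (@continuous_comp _ _ _ (fun x => x ^+ 2) (@GRing.inv R)).
    exact: exprn_continuous.
  by apply: inv_continuous; rewrite gt_eqF ?exprn_gt0.
have cGc x : 0 < x -> {for x, continuous (fun x => G (c / x) * (c / x ^+ 2))}.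
  move=> x0; apply: cvgM; last exact: cD.
  apply: (@continuous_comp _ _ _ (fun x => c / x) G); first exact: cV.
  by apply: cG; rewrite divr_gt0.
have mE (F : R -> R) : (forall x, 0 < x -> {for x, continuous F}) ->
    measurable_fun hl (EFin \o F).
  by move=> cF; apply/measurable_EFinP; exact: continuous_halfline_measurable.
have G0E x : 0 < x -> (0 <= (EFin \o G) x)%E by move=> x0; rewrite lee_fin G0.
have G0cE x : 0 < x -> (0 <= (EFin \o (fun x => (G (c / x) * (c / x ^+ 2))%R)) x)%E.
  by move=> x0; rewrite lee_fin mulr_ge0 ?G0 ?divr_ge0 ?divr_gt0 ?sqr_ge0// ltW.
have C2 := cvg_integral_halfline ltr01 (mE _ cGc) G0cE.
have C1 := cvg_integral_halfline c0 (mE _ cG) G0E.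
move: C1; rewrite (_ : (fun n => _) = (fun n => \int[mu]_(x in
    (`[(1 / n.+1%:R)%R, (1 * n.+1%:R)%R]%classic : set R))
    (EFin \o (fun x => (G (c / x) * (c / x ^+ 2))%R)) x)%E).
  by move=> C1; exact: (cvg_unique (@ereal_hausdorff R) C1 C2).
apply/funext => n.
have dF (x : R) : 0 < x -> is_derive x 1 (fun x => c / x) (- (c / x ^+ 2)).
  move=> x0; have xn0 : x != 0 by rewrite gt_eqF.
  have dV : is_derive x 1 (fun y : R => y^-1) (- x ^- 2 *: 1).
    exact: (is_deriveV xn0 (is_derive_id x 1)).
  have dM := is_deriveM (is_derive_cst c x (1 : R)) dV.
  rewrite (_ : - (c / x ^+ 2) = cst c x *: (- x ^- 2 *: 1) + x^-1 *: 0); first exact: dM.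
  by rewrite scaler0 addr0 /GRing.scale/= mulr1 mulrN.
have dFE (x : R) : 0 < x -> derive1 (fun x => c / x) x = - (c / x ^+ 2).
  by move=> x0; rewrite derive1E; have := dF _ x0 => ?; apply: derive_val.
have n0 : 0 < 1 / n.+1%:R :> R by rewrite divr_gt0.
(* The map is decreasing: the left endpoint is the image of the right one, and conversely. *)
have -> : c / n.+1%:R = c / (1 * n.+1%:R) by rewrite mul1r.
have -> : c * n.+1%:R = c / (1 / n.+1%:R) by rewrite mul1r invrK.
have cdF x : 0 < x -> {for x, continuous (derive1 (fun x => c / x))}.
  move=> x0.
  have : {near x, (fun x => - (c / x ^+ 2)) =1 derive1 (fun x => c / x)}.
    by near=> z; rewrite dFE//; near: z; exact: lt_nbhsr.
  move=> /near_eq_cvg h; apply: cvg_trans h _; rewrite (dFE _ x0).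
  by apply: cvgN; exact: cD.
rewrite (@integration_by_substitution_decreasing _ (fun x => c / x)).
- apply: eq_integral => x; rewrite inE/= in_itv/= => /andP[nx _].
  by rewrite !fctE dFE ?opprK// (lt_le_trans n0).
- by rewrite mul1r mul1r (le_trans (y := 1))// ?invf_le1 ?ler1n ?ltr0n.
- move=> x y; rewrite !in_itv/= => /andP[nx _] /andP[ny _] xy.
  by rewrite ltr_pM2l// ltf_pV2// ?posrE (lt_le_trans n0).
- by move=> x; rewrite in_itv/= => /andP[nx _]; apply: cdF; exact: lt_trans nx.
- by apply/cvg_ex; eexists; apply: cvg_at_right_filter; apply: cdF.
- by apply/cvg_ex; eexists; apply: cvg_at_left_filter; apply: cdF; rewrite mul1r.
- split.
  + move=> x; rewrite in_itv/= => /andP[nx _]; have := dF _ (lt_trans n0 nx) => ?.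
    exact: ex_derive.
  + by apply: cvg_at_right_filter; exact: cV.
  + by apply: cvg_at_left_filter; apply: cV; rewrite mul1r.
- by apply: continuous_within_halfline; rewrite // divr_gt0// mul1r.
Unshelve. all: by end_near. Qed.

End halfline.

(** * The integral K_s(z): bounds, reflection of the index, derivative *)

Section bessel_integral.
Context {R : realType}.
Notation mu := (@lebesgue_measure R).
Implicit Types (c s t r x y z l : R).
Local Notation hl := (`]0%R, +oo[%classic : set R).

Definition bess_kern s z r := r `^ (s - 1) * expR (- r) * expR (- (`|z| / r)).

(* For z > 0 this is 2 z^(s/2) K_s(2 sqrt z), K_s the Macdonald function; the
   absolute value in the kernel makes it continuous on the whole line. *)
Definition bess s z := \int[mu]_(r in hl) bess_kern s z r.

Lemma hlP x : hl x = (0 < x) :> Prop.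
Proof. by rewrite /= in_itv/= andbT. Qed.

Lemma integrable_hlZ k (f : R -> R) : mu.-integrable hl (EFin \o f) ->
  mu.-integrable hl (EFin \o (fun x => k * f x)).
Proof.
move=> intf.
have : mu.-integrable hl (fun x => k%:E * (EFin \o f) x)%E.
  by apply: integrableZl => //; exact: measurable_itv.
by [].
Qed.

Lemma gt0_powRD x a b : 0 < x -> x `^ (a + b) = x `^ a * x `^ b.
Proof. by move=> x0; rewrite powRD// (gt_eqF x0) implybT. Qed.

Lemma gt0_powRB x a b : 0 < x -> x `^ (a - b) = x `^ a / x `^ b.
Proof. by move=> x0; rewrite powRB// (gt_eqF x0) implybT. Qed.

Lemma powR_continuous a x : 0 < x -> {for x, continuous (fun x => x `^ a)}.
Proof.
move=> x0; have := is_derive1_powR a x0 => ?.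
by apply: differentiable_continuous; apply/derivable1_diffP; exact: ex_derive.
Qed.

Lemma bess_kern_continuous s z x : 0 < x -> {for x, continuous (bess_kern s z)}.
Proof.
move=> x0; apply: cvgM; first apply: cvgM.
- exact: powR_continuous.
- apply: (@continuous_comp _ _ _ (-%R) expR); first exact: cvgN.
  exact: continuous_expR.
- apply: (@continuous_comp _ _ _ (fun r => - (`|z| / r)) expR).
    apply: cvgN; apply: cvgM; first exact: cvg_cst.
    by apply: inv_continuous; rewrite gt_eqF.
  exact: continuous_expR.
Qed.

Lemma bess_kern_ge0 s z r : 0 <= bess_kern s z r.
Proof. by rewrite !mulr_ge0 ?powR_ge0 ?expR_ge0. Qed.

Lemma bess_kern_le s z r : 0 < r -> bess_kern s z r <= bess_kern s 0 r.
Proof.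
move=> r0; rewrite ler_wpM2l ?mulr_ge0 ?powR_ge0 ?expR_ge0//.
by rewrite ler_expR lerN2 normr0 mul0r divr_ge0 ?(ltW r0).
Qed.

Lemma bess_kern_measurable s z : measurable_fun hl (bess_kern s z).
Proof. by apply: continuous_halfline_measurable => x /bess_kern_continuous. Qed.

Lemma mulr_expRN_le1 x : x * expR (- x) <= 1.
Proof.
rewrite expRN ler_pdivrMr ?expR_gt0// mul1r (le_trans _ (expR_ge1Dx x))//.
by rewrite lerDr.
Qed.

(** Raise t / s <= exp (t / s) to the power s. *)
Lemma powR_le_expR s t : 0 < s -> 0 <= t -> t `^ s <= expR t * s `^ s.
Proof.
move=> s0 t0; have sn0 : s != 0 by rewrite gt_eqF.
rewrite -{1}(divfK sn0 t) powRM ?divr_ge0 ?(ltW s0)// ler_wpM2r ?powR_ge0//.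
have : t / s <= expR (t / s) by rewrite (le_trans _ (expR_ge1Dx _))// lerDr.
move=> /(ge0_ler_powR (ltW s0)); rewrite -expRM divfK//; apply.
  by rewrite nnegrE divr_ge0 ?(ltW s0).
by rewrite nnegrE expR_ge0.
Qed.

(* (t / (1 + t)) `^ s is a bounded increasing function on the half-line whose
   derivative dominates the integrand of the Gamma function. *)
Lemma bess_kern0_integrable s : 0 < s ->
  mu.-integrable hl (EFin \o bess_kern s 0).
Proof.
move=> s0; pose F t : R := (t / (1 + t)) `^ s.
pose f t : R := s * t `^ (s - 1) * (1 + t) `^ (- (s + 1)).
have q0 t : 0 < t -> 0 < t / (1 + t) by move=> t0; rewrite divr_gt0// addr_gt0.
have dF t : 0 < t -> is_derive t 1 F (f t).
  move=> t0; have t1 : 0 < 1 + t by rewrite addr_gt0.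
  have tn0 : 1 + t != 0 by rewrite gt_eqF.
  have d1 : is_derive t 1 (fun t : R => t / (1 + t)) ((1 + t) ^- 2).
    by apply: is_derive_eq; rewrite /GRing.scale/= add0r; field.
  have d2 := is_derive1_powR s (q0 _ t0).
  suff -> : f t = s * (t / (1 + t)) `^ (s - 1) * (1 + t) ^- 2.
    exact: (@is_derive1_comp R (fun x => x `^ s) (fun t => t / (1 + t)) t _ _ d2 d1).
  apply/esym; rewrite /f -!mulrA; congr (_ * _).
  rewrite powRM ?invr_ge0 ?(ltW t0) ?(ltW t1)// -mulrA; congr (_ * _).
  rewrite -powR_inv1 ?(ltW t1)// -powRrM -powR_mulrn ?(ltW t1)// -powRN -powRD.
    by congr (_ `^ _); ring.
  by rewrite tn0 implybT.
have f0 t : 0 < t -> 0 <= f t by move=> t0; rewrite !mulr_ge0 ?powR_ge0// ltW.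
have cf t : 0 < t -> {for t, continuous f}.
  move=> t0; apply: cvgM; first apply: cvgM.
  - exact: cvg_cst.
  - exact: powR_continuous.
  - apply: (@continuous_comp _ _ _ (fun t => 1 + t) (fun x => x `^ (- (s + 1)))).
      by apply: cvgD; [exact: cvg_cst|exact: cvg_id].
    by apply: powR_continuous; rewrite addr_gt0.
have cF t : 0 < t -> {for t, continuous F}.
  move=> t0; have := dF _ t0 => ?.
  by apply: differentiable_continuous; apply/derivable1_diffP; exact: ex_derive.
have mf : measurable_fun hl (EFin \o f).
  by apply/measurable_EFinP; exact: continuous_halfline_measurable.
have If : mu.-integrable hl (EFin \o f).
  apply/integrableP; split => //.
  rewrite (_ : (\int[mu]_(x in _) _)%E = \int[mu]_(x in hl) (f x)%:E)%E; last first.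
    by apply: eq_integral => x; rewrite inE hlP => x0; rewrite gee0_abs ?lee_fin ?f0.
  have f0E x : 0 < x -> (0 <= (EFin \o f) x)%E by move=> /f0 ?; rewrite lee_fin.
  have C := cvg_integral_halfline ltr01 mf f0E.
  apply: (@le_lt_trans _ _ 1%:E); last by rewrite ltry.
  rewrite -(cvg_lim (@ereal_hausdorff R) C).
  apply: lime_le; first by apply/cvg_ex; eexists; exact: C.
  (* At n = 0 the interval is the single point 1, while the fundamental theorem of calculus wants a
     nondegenerate one. *)
  apply: nearW => -[|n].
    by rewrite mulr1 divr1 set_itv1 integral_set1 lee_fin.
  have n0 : 0 < 1 / n.+2%:R :> R by rewrite divr_gt0.
  rewrite (@continuous_FTC2 _ f F).
  - rewrite -EFinB lee_fin (@le_trans _ _ (F (1 * n.+2%:R)))//.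
      by rewrite gerBl powR_ge0.
    have p1 : 1 `^ s = 1 :> R by rewrite powR1.
    rewrite /F -[leRHS]p1 ge0_ler_powR ?(ltW s0) ?nnegrE ?ltW ?q0//.
    by rewrite mul1r ltr_pdivrMr ?mul1r ?addr_gt0// ltrDr.
  - rewrite !mul1r (@lt_trans _ _ 1)//; last by rewrite ltr1n.
    by rewrite invf_lt1// ltr1n.
  - exact: continuous_within_halfline.
  - split.
    + move=> x; rewrite in_itv/= => /andP[nx _]; have := dF _ (lt_trans n0 nx) => ?.
      exact: ex_derive.
    + by apply: cvg_at_right_filter; exact: cF.
    + by apply: cvg_at_left_filter; apply: cF; rewrite mul1r.
  - move=> x; rewrite in_itv/= => /andP[nx _]; have := dF _ (lt_trans n0 nx) => ?.
    by rewrite derive1E; exact: derive_val.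
(* [powR_le_expR] with exponent s + 1 at 1 + t bounds (1 + t)^(s + 1) by e^(1 + t) (s + 1)^(s + 1);
   the division by s cancels the factor s of [f]. *)
pose C := expR 1 * (s + 1) `^ (s + 1) / s.
have C0 : 0 <= C by rewrite divr_ge0 ?mulr_ge0 ?expR_ge0 ?powR_ge0// ltW.
have : mu.-integrable hl (fun x => C%:E * (EFin \o f) x)%E.
  by apply: integrableZl => //; exact: measurable_itv.
apply: le_integrable => //.
  by apply/measurable_EFinP; exact: bess_kern_measurable.
move=> t; rewrite hlP => t0 /=; rewrite lee_fin [leLHS]ger0_norm ?bess_kern_ge0//.
rewrite [leRHS]ger0_norm; last by apply: mulr_ge0 => //; exact: f0.
rewrite /C /f /bess_kern normr0 mul0r oppr0 expR0 mulr1.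
have t1 : 0 < 1 + t by rewrite addr_gt0.
have sn0 : s != 0 by rewrite gt_eqF.
rewrite [leRHS](_ : _ = t `^ (s - 1) *
   (expR 1 * (s + 1) `^ (s + 1) * (1 + t) `^ (- (s + 1)))); last by field.
rewrite ler_wpM2l ?powR_ge0// powRN ler_pdivlMr ?powR_gt0//.
have := @powR_le_expR (s + 1) (1 + t).
rewrite addr_gt0// => /(_ isT (ltW t1)) h.
rewrite mulrC -ler_pdivlMr ?expR_gt0// -expRN opprK.
by rewrite mulrAC -expRD.
Qed.

Lemma bess_kern_integrable s z : 0 < s -> mu.-integrable hl (EFin \o bess_kern s z).
Proof.
move=> s0; apply: le_integrable (bess_kern0_integrable s0).
- exact: measurable_itv.
- by apply/measurable_EFinP; exact: bess_kern_measurable.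
- move=> r; rewrite hlP => r0 /=.
  by rewrite lee_fin !ger0_norm ?bess_kern_ge0// bess_kern_le.
Qed.

Lemma bess_ge0 s z : 0 <= bess s z.
Proof. by apply: Rintegral_ge0 => x _; exact: bess_kern_ge0. Qed.

Lemma bess0 s : bess s 0 = Gamma s.
Proof.
apply: eq_Rintegral => r _.
by rewrite /bess_kern normr0 mul0r oppr0 expR0 mulr1.
Qed.

Lemma EFin_bess s z : 0 < s ->
  (bess s z)%:E = (\int[mu]_(r in hl) (bess_kern s z r)%:E)%E.
Proof.
move=> s0; rewrite /bess /Rintegral fineK//.
apply: integrable_fin_num; [exact: measurable_itv|exact: bess_kern_integrable].
Qed.

Lemma bess_le_Gamma s z : 0 < s -> bess s z <= Gamma s.
Proof.
move=> s0; rewrite -bess0; apply: le_Rintegral.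
- exact: measurable_itv.
- exact: bess_kern_integrable.
- exact: bess_kern_integrable.
- by move=> r; rewrite hlP; exact: bess_kern_le.
Qed.

Lemma Gamma_ge0 s : 0 <= Gamma s.
Proof. by rewrite -bess0 bess_ge0. Qed.

(** If the integral vanished, so would the integrand almost everywhere; it is positive on the whole
    half-line, which has infinite measure. *)
Lemma Gamma_gt0 s : 0 < s -> 0 < Gamma s.
Proof.
move=> s0; rewrite lt_neqAle Gamma_ge0 andbT eq_sym; apply/eqP => G0.
have := EFin_bess 0 s0; rewrite bess0 G0 => /esym I0.
have : (\int[mu]_(r in hl) `|(EFin \o bess_kern s 0) r| = 0)%E.
  rewrite -[RHS]/(0%:E) -I0; apply: eq_integral => r _ /=.
  by rewrite ger0_norm// bess_kern_ge0.
have mk : measurable_fun hl (EFin \o bess_kern s 0).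
  by apply/measurable_EFinP; exact: bess_kern_measurable.
move/(ae_eq_integral_abs mu (measurable_itv _) mk) => [N [mN N0 hN]].
have : hl `<=` N.
  move=> r hr; apply: hN => /= /(_ hr) [] /eqP; apply/negP.
  move: hr; rewrite hlP => r0.
  by rewrite gt_eqF// !mulr_gt0 ?powR_gt0 ?expR_gt0.
move=> /(le_measure mu); rewrite !inE => /(_ (measurable_itv _) mN).
have hly : mu hl = +oo%E by rewrite lebesgue_measure_itv/= lt0y.
by rewrite [X in (_ <= X)%E]N0 [X in (X <= _)%E]hly leye_eq.
Qed.

(** The inequality x e^(-x) <= 1 at x = |z| / r trades the factor |z| for a factor r, which raises
    the index by one. This is the decay of K for large z. *)
Lemma mul_bess_le s z : 0 < s -> `|z| * bess s z <= Gamma (s + 1).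
Proof.
move=> s0; rewrite -bess0 -RintegralZl; last 2 first.
- exact: measurable_itv.
- exact: bess_kern_integrable.
apply: le_Rintegral.
- exact: measurable_itv.
- by apply: integrable_hlZ; exact: bess_kern_integrable.
- by apply: bess_kern_integrable; rewrite addr_gt0.
- move=> r; rewrite hlP => r0.
  rewrite /bess_kern addrK normr0 mul0r oppr0 expR0 mulr1 -(mulr_powRB1 (ltW r0) s0).
  rewrite [leLHS](_ : _ = r * r `^ (s - 1) * expR (- r) *
    (`|z| / r * expR (- (`|z| / r)))); last by field; rewrite gt_eqF.
  by rewrite ler_piMr ?mulr_expRN_le1// !mulr_ge0 ?powR_ge0 ?expR_ge0// ltW.
Qed.

(** The inversion r -> z / r exchanges the two exponentials of the kernel; integrated, this is the
    reflection K_{-s}(z) = z^(-s) K_s(z), which gives access to negative indices. *)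
Lemma bess_kern_inv s z r : 0 < z -> 0 < r ->
  bess_kern (- s) z (z / r) * (z / r ^+ 2) = z `^ (- s) * bess_kern s z r.
Proof.
move=> z0 r0; rewrite /bess_kern (gtr0_norm z0).
have -> : z / (z / r) = r by field; rewrite !gt_eqF.
rewrite [LHS](_ : _ = expR (- (z / r)) * expR (- r) *
  ((z / r) `^ (- s - 1) * (z / r ^+ 2))); last by ring.
rewrite [RHS](_ : _ = expR (- (z / r)) * expR (- r) *
  (z `^ (- s) * r `^ (s - 1))); last by ring.
congr (_ * _).
rewrite powRM ?invr_ge0 ?(ltW r0) ?(ltW z0)//.
rewrite -(powR_inv1 (ltW r0)) -powRrM.
rewrite (gt0_powRB _ _ z0) powRr1 ?(ltW z0)//.
have -> : -1 * (- s - 1) = (s - 1) + 2%:R :> R by ring.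
rewrite (gt0_powRD _ _ r0) powR_mulrn ?(ltW r0)//.
by field; rewrite !gt_eqF.
Qed.

Lemma integral_bess_kernN s z : 0 < s -> 0 < z ->
  (\int[mu]_(r in hl) (bess_kern (- s) z r)%:E = (z `^ (- s) * bess s z)%:E)%E.
Proof.
move=> s0 z0; rewrite (@integral_halfline_inv _ z)//; last 2 first.
- by move=> x; exact: bess_kern_continuous.
- by move=> x _; exact: bess_kern_ge0.
rewrite EFinM EFin_bess// -ge0_integralZl.
- by apply: eq_integral => r; rewrite inE hlP => r0; rewrite bess_kern_inv.
- exact: measurable_itv.
- by apply/measurable_EFinP; exact: bess_kern_measurable.
- by move=> x _; rewrite lee_fin bess_kern_ge0.
- by rewrite lee_fin powR_ge0.
Qed.

Lemma bess_kernN_integrable s z : 0 < s -> 0 < z ->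
  mu.-integrable hl (EFin \o bess_kern (- s) z).
Proof.
move=> s0 z0; apply/integrableP; split.
  by apply/measurable_EFinP; exact: bess_kern_measurable.
rewrite (_ : (\int[mu]_(x in _) _)%E = \int[mu]_(x in hl) (bess_kern (- s) z x)%:E)%E.
  by rewrite integral_bess_kernN// ltry.
by apply: eq_integral => r _ /=; rewrite ger0_norm ?bess_kern_ge0.
Qed.

Lemma bessN s z : 0 < s -> 0 < z -> bess (- s) z = z `^ (- s) * bess s z.
Proof. by move=> s0 z0; rewrite /bess /Rintegral integral_bess_kernN. Qed.

(** The kernel at z = 0 dominates all the others, so continuity holds up to and across 0, where the
    boundary limits are taken. *)
Lemma bess_continuous s : 0 < s -> continuous (bess s).
Proof.
move=> s0 a.
apply: (@continuity_under_integral R _ _ mu (bess_kern s) hl _ (a - 1) (a + 1)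
  _ _ (bess_kern s 0)).
- exact: measurable_itv.
- by move=> x _; exact: bess_kern_integrable.
- apply: aeW => r; rewrite hlP => r0 x _.
  apply: cvgM; first exact: cvg_cst.
  apply: (@continuous_comp _ _ _ (fun x : R => - (`|x| / r)) expR).
    apply: cvgN; apply: cvgM; last exact: cvg_cst.
    exact: norm_continuous.
  exact: continuous_expR.
- exact: bess_kern0_integrable.
- move=> x _; apply: aeW => r; rewrite hlP => r0.
  by rewrite ger0_norm ?bess_kern_ge0// bess_kern_le.
- by rewrite inE/= in_itv/= ltrBlDr !ltrDl ltr01.
Qed.

Lemma bess_measurable s : 0 < s -> measurable_fun [set: R] (bess s).
Proof. by move=> s0; apply: continuous_measurable_fun; exact: bess_continuous. Qed.

Lemma is_derive_bess s z : 0 < s -> s < 1 -> 0 < z ->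
  is_derive z 1 (bess s) (- (z `^ (s - 1) * bess (1 - s) z)).
Proof.
move=> s0 s1 z0.
(* The kernel without the absolute value: it is differentiable in x everywhere and agrees with
   [bess_kern] for x > 0. *)
pose f x r := r `^ (s - 1) * expR (- r) * expR (- (x / r)).
have fE x r : 0 < x -> f x r = bess_kern s x r.
  by move=> x0; rewrite /f /bess_kern (gtr0_norm x0).
have df x r : 0 < r -> is_derive x 1 (f ^~ r) (- (r^-1 * f x r)).
  move=> r0; apply: is_derive_eq.
  rewrite /GRing.scale/= /f !mulr0 ?addr0 ?add0r ?mulr1; ring.
have d1f x r : 0 < r -> partial1of2 f x r = - (r^-1 * f x r).
  by move=> r0; rewrite partial1of2E; have := df x r r0 => ?; exact: derive_val.
have z2 : z / 2 < z by rewrite ltr_pdivrMr// mulr_natr mulr2n ltrDl.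
have Iz : `]z / 2, z + 1[%classic z by rewrite /= in_itv/= z2 ltrDl ltr01.
have Ipos x : `]z / 2, z + 1[%classic x -> 0 < x.
  by rewrite /= in_itv/= => /andP[+ _]; apply: lt_trans; rewrite divr_gt0.
(* The majorant comes from r^(-1) e^(-x / r) <= 1 / x <= 2 / z for x > z / 2. *)
have := @cvg_differentiation_under_integral R _ _ mu f hl (measurable_itv _)
  z (z / 2) (z + 1) Iz _ _ (fun r => 2 / z * bess_kern s 0 r).
move=> H.
have {}H : h^-1 *: (\int[mu]_(r in hl) f (h + z) r - \int[mu]_(r in hl) f z r)
    @[h --> 0^'] --> - (z `^ (s - 1) * bess (1 - s) z).
  rewrite (_ : - (_ * _) = \int[mu]_(r in hl) partial1of2 f z r).
    apply: H.
    - move=> x /Ipos x0; have := @bess_kern_integrable s x s0.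
      by apply: eq_integrable => [|r _]; [exact: measurable_itv|rewrite /= fE].
    - move=> x r _; rewrite hlP => r0; have := df x r r0 => ?; exact: ex_derive.
    - by move=> r; rewrite mulr_ge0 ?bess_kern_ge0// divr_ge0// ltW.
    - by apply: integrable_hlZ; exact: bess_kern0_integrable.
    - move=> x r Ix; rewrite hlP => r0; have x0 := Ipos _ Ix.
      rewrite d1f// normrN ger0_norm; last first.
        by rewrite mulr_ge0 ?invr_ge0 ?(ltW r0)// fE ?bess_kern_ge0.
      rewrite /f /bess_kern normr0 mul0r oppr0 expR0 mulr1.
      rewrite [leLHS](_ : _ = (x^-1 * (x / r * expR (- (x / r)))) *
        (r `^ (s - 1) * expR (- r))); last by field; rewrite !gt_eqF.
      rewrite ler_wpM2r ?mulr_ge0 ?powR_ge0 ?expR_ge0//.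
      rewrite (@le_trans _ _ x^-1)//.
        by rewrite ler_piMr ?mulr_expRN_le1// invr_ge0 ltW.
      rewrite -[2 / z]invf_div lef_pV2 ?posrE ?divr_gt0//.
      by move: Ix; rewrite /= in_itv/= => /andP[/ltW].
  (* Differentiation lowers the index to s - 1, which is negative, and the reflection formula turns
     it into 1 - s. *)
  have s1E : s - 1 = - (1 - s) by rewrite opprB.
  rewrite s1E -bessN ?subr_gt0// /bess -mulN1r -RintegralZl; last 2 first.
  - exact: measurable_itv.
  - by apply: bess_kernN_integrable; rewrite ?subr_gt0.
  apply: eq_Rintegral => r; rewrite inE hlP => r0.
  rewrite d1f// mulN1r; congr (- _).
  rewrite fE// /bess_kern opprB (gt0_powRB (s - 1) 1 r0).
  by rewrite powRr1 ?(ltW r0)//; ring.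
have dF : is_derive z 1 (fun x => \int[mu]_(r in hl) f x r)
    (- (z `^ (s - 1) * bess (1 - s) z)).
  apply: DeriveDef.
    apply/cvg_ex; eexists; under eq_fun do rewrite scaler1; exact: H.
  apply/cvg_lim; first exact: Rhausdorff.
  by under eq_fun do rewrite scaler1; exact: H.
apply: near_eq_is_derive dF.
  near=> x; apply: eq_Rintegral => r; rewrite inE hlP => r0.
  by rewrite fE//; near: x; exact: lt_nbhsr.
Unshelve. all: by end_near. Qed.

(** Comparing K_s with z^s in Cauchy's mean value theorem makes the singular factors w^(s - 1) of
    the two derivatives cancel; what remains is bounded and continuous at 0. *)
Lemma bess_MVT s z : 0 < s -> s < 1 -> 0 < z ->
  exists2 w, 0 < w < z &
    (bess s z - Gamma s) / z `^ s = - (bess (1 - s) w / s).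
Proof.
move=> s0 s1 z0.
have cp : {within `[0, z], continuous (fun x => x `^ s)}.
  apply/continuous_within_itvP => //; split.
  - by move=> x; rewrite in_itv/= => /andP[x0 _]; exact: powR_continuous.
  - by rewrite powR0 ?gt_eqF//; exact: powR_cvg0.
  - by apply: cvg_at_left_filter; exact: powR_continuous.
have cb : {within `[0, z], continuous (bess s)}.
  by apply: continuous_subspaceT => x; exact: bess_continuous.
have := @cauchy_MVT R (bess s) (fun x => - (x `^ (s - 1) * bess (1 - s) x))
   (fun x => x `^ s) (fun x => s * x `^ (s - 1)) 0 z z0 cb cp.
case.
- by move=> x; rewrite in_itv/= => /andP[x0 _]; exact: is_derive_bess.
- by move=> x; rewrite in_itv/= => /andP[x0 _]; exact: is_derive1_powR.
- move=> x; rewrite in_itv/= => /andP[x0 _].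
  by rewrite mulf_neq0 ?gt_eqF// powR_gt0.
move=> w /[!in_itv]/= /andP[w0 wz]; rewrite bess0 powR0 ?gt_eqF// subr0 => <-.
exists w; first by rewrite w0.
by field; rewrite !gt_eqF ?powR_gt0.
Qed.

Lemma integral_bess_subordination s c l : 0 < s -> 0 <= c -> 0 <= l ->
  (\int[mu]_(r in hl) (expR (- (c / r * l)) * (expR (- r) / r `^ (1 - s)))%:E =
   (bess s (c * l))%:E)%E.
Proof.
move=> s0 c0 l0; rewrite EFin_bess//.
apply: eq_integral => r; rewrite inE hlP => r0; congr (_%:E).
rewrite /bess_kern ger0_norm ?mulr_ge0// -(opprB 1 s) powRN.
rewrite (_ : c / r * l = c * l / r); last by ring.
by ring.
Qed.

Lemma integral_bess_poisson s c l : 0 < s -> 0 < c -> 0 <= l ->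
  (\int[mu]_(t in hl) (expR (- (t * l)) * (expR (- (c / t)) / t `^ (1 + s)))%:E =
   (c `^ (- s) * bess s (c * l))%:E)%E.
Proof.
move=> s0 c0 l0; rewrite EFinM EFin_bess//.
rewrite (@integral_halfline_inv _ c (bess_kern s (c * l)))//; last 2 first.
- by move=> x; exact: bess_kern_continuous.
- by move=> x _; exact: bess_kern_ge0.
rewrite -ge0_integralZl.
- apply: eq_integral => t; rewrite inE hlP => t0; rewrite -EFinM; congr (_%:E).
  rewrite /bess_kern ger0_norm ?mulr_ge0 ?(ltW c0)//.
  have -> : c * l / (c / t) = t * l by field; rewrite !gt_eqF.
  rewrite powRM ?invr_ge0 ?(ltW c0) ?(ltW t0)// -(powR_inv1 (ltW t0)) -powRrM.
  have -> : -1 * (s - 1) = (2%:R - (1 + s)) :> R by ring.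
  rewrite (gt0_powRB _ _ c0) (gt0_powRB _ _ t0).
  rewrite powRN powRr1 ?(ltW c0)// powR_mulrn ?(ltW t0)//.
  rewrite (powR_inv1 (ltW t0)).
  by field; rewrite !gt_eqF ?powR_gt0.
- exact: measurable_itv.
- apply/measurable_EFinP; apply: continuous_halfline_measurable => x x0.
  apply: cvgM; first apply: (@continuous_comp _ _ _ (fun x => c / x) (bess_kern s (c * l))).
  + apply: cvgM; first exact: cvg_cst.
    by apply: inv_continuous; rewrite gt_eqF.
  + by apply: bess_kern_continuous; rewrite divr_gt0.
  + apply: cvgM; first exact: cvg_cst.
    apply: (@continuous_comp _ _ _ (fun x => x ^+ 2) (@GRing.inv R)).
      exact: exprn_continuous.
    by apply: inv_continuous; rewrite gt_eqF ?exprn_gt0.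
- by move=> x; rewrite hlP => x0;
    rewrite lee_fin mulr_ge0 ?bess_kern_ge0 ?divr_ge0 ?sqr_ge0// ltW.
- by rewrite lee_fin powR_ge0.
Qed.

(** Strict positivity of l is essential: at l = 0 the left side is 0, because l^s vanishes, while
    the right side is Gamma(s). This is where the kernel of L enters the first formula for u. *)
Lemma integral_bess_heat s c l : 0 < s -> 0 <= c -> 0 < l ->
  (\int[mu]_(t in hl)
      (expR (- (t * l)) * l `^ s * (expR (- (c / t)) / t `^ (1 - s)))%:E =
   (bess s (c * l))%:E)%E.
Proof.
move=> s0 c0 l0; rewrite EFin_bess//.
rewrite [RHS](@integral_halfline_scale _ l)//; last 2 first.
- by move=> x; exact: bess_kern_continuous.
- by move=> x _; exact: bess_kern_ge0.
apply: eq_integral => t; rewrite inE hlP => t0; congr (_%:E).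
rewrite /bess_kern ger0_norm ?mulr_ge0 ?(ltW l0)//.
have -> : c * l / (l * t) = c / t by field; rewrite !gt_eqF.
rewrite powRM ?(ltW t0) ?(ltW l0)// -[t `^ (s - 1)]invrK -powRN opprB.
rewrite (gt0_powRB _ _ l0) powRr1 ?(ltW l0)// (mulrC l t).
by field; rewrite !gt_eqF ?powR_gt0.
Qed.

End bessel_integral.

(** * Integration against signed set functions *)

Section signed_integral.
Context {d : measure_display} {T : measurableType d} {R : realType}.
Implicit Types (nu : set T -> R) (D A B P : set T) (phi : T -> R).

(** [integral] makes sense for a plain set function and reaches it only through level sets of simple
    functions, which are measurable. Hence the set functions of the definitions can be replaced by
    genuine measures. *)
Lemma eq_setfun_integral (m1 m2 : set T -> \bar R) D (f : T -> \bar R) :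
  (forall A, measurable A -> m1 A = m2 A) ->
  (\int[m1]_(x in D) f x = \int[m2]_(x in D) f x)%E.
Proof.
move=> m12.
have E (h : {nnsfun T >-> R}) : sintegral m1 h = sintegral m2 h.
  by apply: eq_fsbigr => r _; rewrite m12.
rewrite /integral; congr (ereal_sup _ - ereal_sup _)%E;
  by apply/seteqP; split => _ [h hh <-]; exists h => //; rewrite E.
Qed.

Definition sigma_additive_setfun nu := nu set0 = 0 /\
  forall A : nat -> set T, (forall k, measurable (A k)) -> trivIset setT A ->
    series (fun k => nu (A k)) @ \oo --> nu (\bigcup_k A k).

(** Packed as a charge, [nu] has a Hahn decomposition. The positive set P is kept along with the two
    measures so that their values can be computed from [nu]. *)
Lemma Jordan_setfun nu : sigma_additive_setfun nu ->
  exists (m1 m2 : {finite_measure set T -> \bar R}) P,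
  [/\ measurable P, forall A, measurable A -> m1 A = (nu (A `&` P))%:E,
      forall A, measurable A -> m2 A = (- nu (A `&` ~` P))%:E &
      forall A, measurable A -> (nu A)%:E = (m1 A - m2 A)%E].
Proof.
move=> [nu0 nus]; pose nuE A := (nu A)%:E.
have h0 : nuE set0 = 0%E by rewrite /nuE nu0.
have h1 (A : set T) : measurable A -> nuE A \is a fin_num by [].
have h2 : semi_sigma_additive nuE.
  move=> F mF tF _; under eq_fun do rewrite sumEFin.
  by apply: cvg_EFin; [exact: nearW|exact: nus].
pose C : {charge set T -> \bar R} :=
  HB.pack nuE (isCharge.Build _ _ _ nuE h0 h1 h2).
have [P [N PN]] := Hahn_decomposition C.
have [[mP _] [mN _] PUN PIN] := PN.
have NE : N = ~` P.
  apply/seteqP; split => x.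
    by move=> Nx Px; have : (P `&` N) x by []; rewrite PIN.
  by move=> nPx; have : (P `|` N) x by [rewrite PUN]; case.
exists (jordan_pos PN), (jordan_neg PN), P; split => //.
- move=> A mA; change (jordan_pos PN A = (nu (A `&` P))%:E).
  by rewrite jordan_posE cjordan_posE /crestr0 mem_set.
- move=> A mA; change (jordan_neg PN A = (- nu (A `&` ~` P))%:E).
  by rewrite jordan_negE cjordan_negE /crestr0 mem_set// -NE.
- by move=> A mA; have := jordan_decomp PN mA; rewrite /cadd/= cscaleN1.
Qed.

(** The supremum is attained at the part of A inside P, and m1 bounds [nu] on every subset of A. *)
Lemma upper_variationE nu P (m1 m2 : {finite_measure set T -> \bar R}) A :
  measurable P -> measurable A ->
  (forall A, measurable A -> m1 A = (nu (A `&` P))%:E) ->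
  (forall A, measurable A -> (nu A)%:E = (m1 A - m2 A)%E) ->
  upper_variation nu A = m1 A.
Proof.
move=> mP mA m1E nuE; apply/eqP; rewrite eq_le; apply/andP; split.
  apply: ub_ereal_sup => _ [B [mB BA] <-].
  rewrite nuE// (@le_trans _ _ (m1 B))//; last by rewrite le_measure ?inE.
  by rewrite leeBlDr ?leeDl// fin_num_measure.
rewrite m1E//; apply: ereal_sup_ubound; exists (A `&` P) => //.
by split; [exact: measurableI|exact: subIsetl].
Qed.

Lemma le_finite_measure_integrable (m a : {finite_measure set T -> \bar R}) D phi :
  measurable D -> (forall A, measurable A -> (m A <= a A)%E) ->
  a.-integrable D (EFin \o phi) -> m.-integrable D (EFin \o phi).
Proof.
move=> mD ma /integrableP[mphi iphi]; apply/integrableP; split => //.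
apply: le_lt_trans iphi.
rewrite integral_mkcond [leRHS]integral_mkcond.
apply: ge0_le_measure_integral => //.
  by move=> x; rewrite patchE; case: ifPn => // _; exact: abse_ge0.
by apply/(measurable_restrictT _ mD); exact: measurableT_comp.
Qed.

(** The Jordan decomposition is minimal, m1 <= a1 and m2 <= a2, so integrability passes down to it;
    then m1 + a2 and a1 + m2 are the same measure and the two differences of integrals agree. From
    here on any convenient decomposition can replace the variations. *)
Lemma signed_integralE nu (a1 a2 : {finite_measure set T -> \bar R}) D phi :
  sigma_additive_setfun nu -> measurable D ->
  (forall A, measurable A -> (nu A)%:E = (a1 A - a2 A)%E) ->
  a1.-integrable D (EFin \o phi) -> a2.-integrable D (EFin \o phi) ->
  signed_integral nu D phi =
  \int[a1]_(x in D) phi x - \int[a2]_(x in D) phi x.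
Proof.
move=> nus mD nuE i1 i2.
have [m1 [m2 [P [mP m1E m2E nuM]]]] := Jordan_setfun nus.
have le1 A : measurable A -> (m1 A <= a1 A)%E.
  move=> mA; rewrite m1E// nuE; last exact: measurableI.
  rewrite (@le_trans _ _ (a1 (A `&` P)))//.
    by rewrite leeBlDr ?leeDl// fin_num_measure//; exact: measurableI.
  by rewrite le_measure ?inE//; exact: measurableI.
have le2 A : measurable A -> (m2 A <= a2 A)%E.
  have mAP B : measurable B -> measurable (B `&` ~` P).
    by move=> mB; apply: measurableI => //; exact: measurableC.
  move=> mA; rewrite m2E// EFinN nuE; last exact: mAP.
  rewrite fin_num_oppeB ?fin_num_measure//; [|exact: mAP..].
  rewrite (@le_trans _ _ (a2 (A `&` ~` P)))//.
    by rewrite addeC leeBlDr ?leeDl// fin_num_measure//; exact: mAP.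
  by rewrite le_measure ?inE//; exact: mAP.
have j1 := le_finite_measure_integrable mD le1 i1.
have j2 := le_finite_measure_integrable mD le2 i2.
rewrite /signed_integral /lower_variation.
rewrite (@eq_setfun_integral _ m1); last first.
  by move=> A mA; exact: (upper_variationE mP mA m1E nuM).
rewrite (@eq_setfun_integral (upper_variation _) m2); last first.
  move=> A mA; apply: (@upper_variationE _ (~` P) m2 m1) => //.
    exact: measurableC.
  by move=> B mB; rewrite EFinN nuM// fin_num_oppeB ?fin_num_measure// addeC.
have E : (\int[m1]_(x in D) (phi x)%:E + \int[a2]_(x in D) (phi x)%:E =
          \int[a1]_(x in D) (phi x)%:E + \int[m2]_(x in D) (phi x)%:E)%E.
  rewrite -!integral_measure_add//.
  apply: eq_measure_integral => A mA _ /=; rewrite /measure_add/= /msum !big_ord_recl !big_ord0/= !adde0.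
  have := nuE A mA; rewrite nuM// => /eqP.
  rewrite -(fineK (fin_num_measure m1 A mA)) -(fineK (fin_num_measure m2 A mA)).
  rewrite -(fineK (fin_num_measure a1 A mA)) -(fineK (fin_num_measure a2 A mA)).
  rewrite -!EFinD => /eqP [h]; congr (_%:E); lra.
have f1 := integrable_fin_num mD j1; have f2 := integrable_fin_num mD j2.
have f3 := integrable_fin_num mD i1; have f4 := integrable_fin_num mD i2.
rewrite /Rintegral; move: E f1 f2 f3 f4.
move: (integral m1 _ _) (integral m2 _ _) (integral a1 _ _) (integral a2 _ _).
move=> [x1| |] // [x2| |] // [x3| |] // [x4| |] // [h] _ _ _ _ /=; lra.
Qed.

Lemma nneg_setfun_measure nu : sigma_additive_setfun nu ->
  (forall A, measurable A -> 0 <= nu A) ->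
  exists m : {finite_measure set T -> \bar R},
    forall A, measurable A -> m A = (nu A)%:E.
Proof.
move=> nus nu0; have [m1 [m2 [P [mP m1E m2E nuM]]]] := Jordan_setfun nus.
exists m1 => A mA; rewrite nuM// (_ : m2 A = 0%E) ?sube0//.
apply/eqP; rewrite eq_le measure_ge0 andbT m2E// lee_fin oppr_le0 nu0//.
by apply: measurableI => //; exact: measurableC.
Qed.

Lemma mulr2_le_of_sqr_le (y a b c : R) : 0 <= y -> 0 <= a -> 0 <= b -> 0 <= c ->
  a ^+ 2 <= b * c -> 2 * (y * a) <= y ^+ 2 * b + c.
Proof.
move=> y0 a0 b0 c0 abc.
rewrite -(@ler_sqr _ (2 * _)) ?nnegrE ?addr_ge0 ?mulr_ge0 ?sqr_ge0//.
have : 0 <= (y ^+ 2 * b - c) ^+ 2 by exact: sqr_ge0.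
have : y ^+ 2 * a ^+ 2 <= y ^+ 2 * (b * c) by rewrite ler_wpM2l// sqr_ge0.
rewrite !expr2; nra.
Qed.

(* Integrates the arithmetic-geometric mean inequality over the level sets of
   simple functions. *)
Lemma integral_sqrt_measure_le (m m1 m2 : {finite_measure set T -> \bar R}) D phi :
  measurable D -> measurable_fun D phi ->
  (forall A, measurable A -> (fine (m A)) ^+ 2 <= fine (m1 A) * fine (m2 A)) ->
  (2%:E * \int[m]_(x in D) `|phi x|%:E <=
     \int[m1]_(x in D) (phi x ^+ 2)%:E + m2 setT)%E.
Proof.
move=> mD mphi mm.
pose f : T -> \bar R := fun x => `|phi x|%:E.
have mf : measurable_fun D f.
  by apply/measurable_EFinP; apply: measurableT_comp.
have f0 x : D x -> (0 <= f x)%E by move=> _; rewrite lee_fin.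
pose h := nnsfun_approx mD mf.
have C1 : (\int[m]_(x in D) (h n x)%:E)%E @[n --> \oo] --> (\int[m]_(x in D) f x)%E.
  rewrite (_ : (\int[m]_(x in D) f x)%E =
    (\int[m]_(x in D) limn (fun n => (h n x)%:E))%E); last first.
    apply: eq_integral => x; rewrite inE => Dx.
    by apply/esym/cvg_lim => //; exact: cvg_nnsfun_approx.
  apply: cvg_monotone_convergence => //.
  - by move=> n; apply/measurable_EFinP; apply: measurable_funTS.
  - by move=> n x _; rewrite lee_fin.
  - by move=> x _ a b ab; rewrite lee_fin; exact/lefP/nd_nnsfun_approx.
rewrite -(cvg_lim (@ereal_hausdorff R) C1) -limeMl//; last by apply/cvg_ex; eexists; exact: C1.
apply: lime_le.
  by apply: is_cvgeMl => //; apply/cvg_ex; eexists; exact: C1.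
apply: nearW => n.
have hle x : D x -> h n x <= `|phi x|.
  by move=> Dx; rewrite -lee_fin nnsfun_approxE; exact: le_approx.
apply: (@le_trans _ _ (\int[m1]_(x in D) ((h n x) ^+ 2)%:E + m2 setT)%E); last first.
  rewrite leeD2r// ge0_le_integral//.
  - by move=> x _; rewrite lee_fin sqr_ge0.
  - apply/measurable_EFinP; apply: measurable_funX; exact: measurable_funTS.
  - by apply/measurable_EFinP; apply: measurable_funX.
  - move=> x Dx; rewrite lee_fin -(real_normK (num_real (phi x))).
    by rewrite lerXn2r ?nnegrE ?hle.
have fin := fimfunP (h n).
pose A y := h n @^-1` [set y] `&` D.
have mA y : measurable (A y) by apply: measurableI.
have S1 : (\int[m]_(x in D) (h n x)%:E = \sum_(y \in range (h n)) y%:E * m (A y))%E.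
  rewrite (eq_integral (fun x => \sum_(y \in range (h n)) (y * \1_(h n @^-1` [set y]) x)%:E)); last first.
    by move=> x _; rewrite fsumEFin// -fimfunE.
  rewrite ge0_integral_fsum//.
  - apply: eq_fsbigr => y; rewrite inE => -[x _ <-].
    under eq_integral do rewrite EFinM.
    by rewrite integralZl_indic_nnsfun// integral_indic.
  - by move=> y; apply/measurable_EFinP; apply: measurable_funM.
  - by move=> y x _; exact: nnfun_muleindic_ge0.
have S2 : (\int[m1]_(x in D) ((h n x) ^+ 2)%:E =
    \sum_(y \in range (h n)) (y ^+ 2)%:E * m1 (A y))%E.
  rewrite (eq_integral (fun x => \sum_(y \in range (h n))
      (y ^+ 2 * \1_(h n @^-1` [set y]) x)%:E)); last first.
    move=> x _; rewrite fsumEFin//; congr (_%:E).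
    (* Exactly one level set contains x, so squaring the simple function produces no cross terms. *)
    rewrite (fsbigD1 (h n x))//=; last by exists x.
    rewrite indicE mem_set// mulr1 fsbig1 ?addr0// => y [_ /= ynx].
    by rewrite indicE memNset ?mulr0//= => /esym.
  rewrite ge0_integral_fsum//.
  - apply: eq_fsbigr => y; rewrite inE => -[x _ <-].
    under eq_integral do rewrite EFinM.
    rewrite ge0_integralZl//; first by rewrite integral_indic.
      by apply/measurable_EFinP.
    by rewrite lee_fin sqr_ge0.
  - by move=> y; apply/measurable_EFinP; apply: measurable_funM.
  - by move=> y x _; rewrite lee_fin mulr_ge0 ?sqr_ge0.
have S3 : (\sum_(y \in range (h n)) m2 (A y) <= m2 setT)%E.
  rewrite -measure_fsbig//.
  - by rewrite fsbig_setU// le_measure ?inE//; apply: fin_bigcup_measurable.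
  - move=> y z _ _ [x [[/= <- _] [/= <- _]]]; by [].
rewrite S1 S2; apply: le_trans (leeD2l _ S3).
rewrite -fsbig_split//= ge0_mule_fsumr.
  apply: lee_fsum => // y [x _ <-].
  rewrite -(fineK (fin_num_measure m _ (mA (h n x)))) -(fineK (fin_num_measure m1 _ (mA (h n x)))).
  rewrite -(fineK (fin_num_measure m2 _ (mA (h n x)))) -!EFinM -EFinD lee_fin.
  have := mm _ (mA (h n x)); set a := fine (m _); set b := fine (m1 _); set c := fine (m2 _).
  have a0 : 0 <= a by apply: fine_ge0.
  have b0 : 0 <= b by apply: fine_ge0.
  have c0 : 0 <= c by apply: fine_ge0.
  have y0 : 0 <= h n x by [].
  exact: mulr2_le_of_sqr_le.
move=> y; have [y0|y0] := leP 0 y; first by rewrite mule_ge0.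
rewrite /A (_ : h n @^-1` [set y] = set0) ?set0I ?measure0 ?mule0//.
by apply/seteqP; split => // x /= hx; have : 0 <= h n x by []; rewrite hx leNgt y0.
Qed.

End signed_integral.

(** * The complex L2 space as a real Hilbert space *)

Section complex_dot.
Context {R : realType}.
Implicit Types (a b c : R[i]) (t : R).

Definition cdot a b : R :=
  complex.Re a * complex.Re b + complex.Im a * complex.Im b.

Lemma Re_mulCJ a b : complex.Re (a * b^*) = cdot a b.
Proof. by case: a => p q; case: b => r s; rewrite /cdot/=; ring. Qed.

(** The imaginary part is again a real scalar product, with i b in place of b. An identity of real
    pairings valid for all test functions thus implies the complex one. *)
Lemma Im_mulCJ a b : complex.Im (a * b^*) = cdot a ((0 +i* 1) * b).
Proof. by case: a => p q; case: b => r s; rewrite /cdot/=; ring. Qed.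

Lemma cdotC a b : cdot a b = cdot b a.
Proof. by rewrite /cdot; ring. Qed.

Lemma cdot_lin t a b c : cdot (t%:C * a + b) c = t * cdot a c + cdot b c.
Proof. by case: a => p q; case: b => r s; case: c => u v; rewrite /cdot/=; ring. Qed.

Lemma cdot_ge0 a : 0 <= cdot a a.
Proof. by rewrite /cdot -!expr2 addr_ge0 ?sqr_ge0. Qed.

Lemma cdot_eq0 a : cdot a a = 0 -> a = 0.
Proof.
case: a => p q; rewrite /cdot/= -!expr2 => /eqP.
by rewrite paddr_eq0 ?sqr_ge0// !sqrf_eq0 => /andP[/eqP -> /eqP ->].
Qed.

Lemma norm_cdot_le a b : `|cdot a b| <= cdot a a + cdot b b.
Proof.
case: a => p q; case: b => r s; rewrite /cdot/= ler_norml; apply/andP; split.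
  have := sqr_ge0 (p + r); have := sqr_ge0 (q + s).
  have := sqr_ge0 (p - r); have := sqr_ge0 (q - s); rewrite !expr2; nra.
have := sqr_ge0 (p + r); have := sqr_ge0 (q + s).
have := sqr_ge0 (p - r); have := sqr_ge0 (q - s); rewrite !expr2; nra.
Qed.

(** By the parallelogram identity the two sides differ by |a b - c|^2. *)
Lemma cdot_lin_le a b c : cdot (a * b + c) (a * b + c) <=
  2 * cdot a a * cdot b b + 2 * cdot c c.
Proof.
case: a => p q; case: b => r s; case: c => u v; rewrite /cdot/=.
rewrite -subr_ge0 [leRHS](_ : _ = (p * r - q * s - u) ^+ 2 + (p * s + q * r - v) ^+ 2).
  by rewrite addr_ge0 ?sqr_ge0.
by ring.
Qed.

End complex_dot.

Section L2_space.
Context {d : measure_display} {T : measurableType d} {R : realType}.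
Variables (eta : {measure set T -> \bar R}) (Omega : set T).
Hypothesis mO : measurable Omega.
Implicit Types (f g h : T -> R[i]).
Local Notation L2 := (L2 eta Omega).

Definition rinner f g : R := \int[eta]_(x in Omega) cdot (f x) (g x).

Definition mulI f : T -> R[i] := fun x => (0 +i* 1) * f x.

Lemma innerE f g : inner eta Omega f g = rinner f g +i* rinner f (mulI g).
Proof.
rewrite /inner; congr (_ +i* _); apply: eq_Rintegral => x _.
  by rewrite Re_mulCJ.
by rewrite Im_mulCJ.
Qed.

Lemma L2P f : L2 f <->
  [/\ measurable_fun Omega (fun x => complex.Re (f x)),
      measurable_fun Omega (fun x => complex.Im (f x)) &
      eta.-integrable Omega (EFin \o (fun x => cdot (f x) (f x)))].
Proof.
split=> -[m1 m2 h3]; split => //.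
  apply/integrableP; split.
    by apply/measurable_EFinP; apply: measurable_funD; apply: measurable_funM.
  apply: le_lt_trans h3; rewrite le_eqVlt; apply/orP; left; apply/eqP.
  by apply: eq_integral => x _ /=; rewrite ger0_norm ?cdot_ge0// /cdot -!expr2.
move/integrableP : h3 => [_]; apply: le_lt_trans.
rewrite le_eqVlt; apply/orP; left; apply/eqP.
by apply: eq_integral => x _ /=; rewrite ger0_norm ?cdot_ge0// /cdot -!expr2.
Qed.

Lemma cdot_measurable f g : L2 f -> L2 g ->
  measurable_fun Omega (fun x => cdot (f x) (g x)).
Proof.
by move=> [f1 f2 _] [g1 g2 _]; apply: measurable_funD; apply: measurable_funM.
Qed.

Lemma cdot_integrable f g : L2 f -> L2 g ->
  eta.-integrable Omega (EFin \o (fun x => cdot (f x) (g x))).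
Proof.
move=> Lf Lg; have /L2P[_ _ If] := Lf; have /L2P[_ _ Ig] := Lg.
apply: le_integrable (integrableD mO If Ig) => //.
  by apply/measurable_EFinP; exact: cdot_measurable.
move=> x _ /=; rewrite lee_fin [leRHS]ger0_norm; last by apply: addr_ge0; exact: cdot_ge0.
exact: norm_cdot_le.
Qed.

Lemma EFin_rinner f : L2 f -> (rinner f f)%:E = L2norm2 eta Omega f.
Proof.
move=> Lf; rewrite /rinner /Rintegral fineK.
  by apply: eq_integral => x _; rewrite /cdot -!expr2.
by apply: integrable_fin_num => //; exact: cdot_integrable.
Qed.

Lemma L2_lin (a : R[i]) f g : L2 f -> L2 g -> L2 (fun x => a * f x + g x).
Proof.
move=> Lf Lg; have [f1 f2 _] := Lf; have [g1 g2 _] := Lg.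
have m1 : measurable_fun Omega (fun x => complex.Re (a * f x + g x)).
  rewrite (_ : (fun x => _) = fun x =>
    complex.Re a * complex.Re (f x) - complex.Im a * complex.Im (f x) + complex.Re (g x)).
    by apply: measurable_funD => //; apply: measurable_funB; apply: measurable_funM.
  by apply/funext => x; move: (a) (f x) (g x) => [? ?] [? ?] [? ?].
have m2 : measurable_fun Omega (fun x => complex.Im (a * f x + g x)).
  rewrite (_ : (fun x => _) = fun x =>
    complex.Re a * complex.Im (f x) + complex.Im a * complex.Re (f x) + complex.Im (g x)).
    by apply: measurable_funD => //; apply: measurable_funD; apply: measurable_funM.
  by apply/funext => x; move: (a) (f x) (g x) => [? ?] [? ?] [? ?].
apply/L2P; split => //.
have If := integrableZl mO (2 * cdot a a) (cdot_integrable Lf Lf).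
have Ig := integrableZl mO 2 (cdot_integrable Lg Lg).
apply: le_integrable (integrableD mO If Ig) => //.
  by apply/measurable_EFinP; apply: measurable_funD; apply: measurable_funM.
move=> x _ /=; rewrite lee_fin [leRHS]ger0_norm; last first.
  by apply: addr_ge0; apply: mulr_ge0; rewrite ?mulr_ge0 ?(cdot_ge0 a) ?(cdot_ge0 (f x)) ?(cdot_ge0 (g x)).
by rewrite ger0_norm ?cdot_ge0// cdot_lin_le.
Qed.

Lemma L2_0 : L2 (fun=> 0).
Proof.
split; [exact: measurable_cst|exact: measurable_cst|].
rewrite /L2norm2 (_ : (\int[eta]_(x in Omega) _)%E = 0%E) ?ltry//.
by apply: integral0_eq => x _ /=; rewrite expr0n addr0.
Qed.

Lemma L2_Z (a : R[i]) f : L2 f -> L2 (fun x => a * f x).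
Proof.
move=> Lf; have := L2_lin a Lf L2_0.
by rewrite (_ : (fun x => _) = (fun x => a * f x))//; apply/funext => x; rewrite addr0.
Qed.

Lemma L2_mulI f : L2 f -> L2 (mulI f). Proof. exact: L2_Z. Qed.

Lemma rinnerC f g : rinner f g = rinner g f.
Proof. by apply: eq_Rintegral => x _; rewrite cdotC. Qed.

Lemma rinner_linl (t : R) f g h : L2 f -> L2 g -> L2 h ->
  rinner (fun x => t%:C * f x + g x) h = t * rinner f h + rinner g h.
Proof.
move=> Lf Lg Lh; rewrite /rinner -RintegralZl//; last exact: cdot_integrable.
rewrite -RintegralD//.
- by apply: eq_Rintegral => x _; rewrite cdot_lin.
- exact: (integrableZl mO t (cdot_integrable Lf Lh)).
- exact: cdot_integrable.
Qed.

Lemma rinner0l g : rinner (fun=> 0) g = 0.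
Proof.
rewrite /rinner (eq_Rintegral _ _ (g := cst 0)).
  by rewrite /Rintegral integral0.
by move=> x _; rewrite /cdot/= !mul0r addr0.
Qed.

Lemma rinner_Zl (t : R) f h : L2 f -> L2 h ->
  rinner (fun x => t%:C * f x) h = t * rinner f h.
Proof.
move=> Lf Lh; have := rinner_linl t Lf L2_0 Lh; rewrite rinner0l addr0 => <-.
by congr rinner; apply/funext => x; rewrite addr0.
Qed.

Lemma rinner_ael f f' g : L2 f -> L2 f' -> L2 g -> f = f' %[ae eta in Omega] ->
  rinner f g = rinner f' g.
Proof.
move=> Lf Lf' Lg ff'; congr fine; apply: ae_eq_integral => //.
- by apply/measurable_EFinP; exact: cdot_measurable.
- by apply/measurable_EFinP; exact: cdot_measurable.
- by apply: filterS ff' => x fx Ox; rewrite fx.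
Qed.

Lemma rinner_ge0 f : 0 <= rinner f f.
Proof. by apply: Rintegral_ge0 => x _; exact: cdot_ge0. Qed.

Lemma rinner_CS f g : L2 f -> L2 g ->
  rinner f g ^+ 2 <= rinner f f * rinner g g.
Proof.
move=> Lf Lg; set a := rinner f f; set b := rinner f g; set c := rinner g g.
have H t : 0 <= t ^+ 2 * a + 2 * t * b + c.
  have := rinner_ge0 (fun x => t%:C * f x + g x).
  have Lh : L2 (fun x => t%:C * f x + g x) by exact: L2_lin.
  rewrite rinner_linl// (rinnerC f) (rinnerC g) !rinner_linl// (rinnerC g f).
  by rewrite -/a -/b -/c => h; apply: le_trans h _; rewrite le_eqVlt; apply/orP; left; apply/eqP; ring.
have a0 : 0 <= a by exact: rinner_ge0.
have c0 : 0 <= c by exact: rinner_ge0.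
have [a0'|an0] := eqVneq a 0.
  have [->|bn0] := eqVneq b 0; first by rewrite expr0n mulr_ge0.
  (* With a = 0 the polynomial in t is affine; if b != 0 this t gives it the value -1. *)
  have := H (- ((c + 1) / (2 * b))); rewrite a0' mulr0 add0r.
  rewrite (_ : _ + c = - 1); last by field; rewrite bn0.
  by rewrite oppr_ge0 ler10.
have {}a0 : 0 < a by rewrite lt_neqAle eq_sym an0.
(* The minimiser of the quadratic polynomial. *)
have := H (- (b / a)).
rewrite (_ : _ + c = c - b ^+ 2 / a); last by field.
by rewrite subr_ge0 ler_pdivrMr// mulrC.
Qed.

Lemma rinner_eq0 f : L2 f -> rinner f f = 0 -> f = (fun=> 0) %[ae eta in Omega].
Proof.
move=> Lf f0.
have mf : measurable_fun Omega (EFin \o (fun x => cdot (f x) (f x))).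
  by apply/measurable_EFinP; exact: cdot_measurable.
have : (\int[eta]_(x in Omega) `|(EFin \o (fun x => cdot (f x) (f x))) x| = 0)%E.
  rewrite -[RHS]/(0%:E) -f0 EFin_rinner//; apply: eq_integral => x _ /=.
  by rewrite ger0_norm ?cdot_ge0// /cdot -!expr2.
move/(ae_eq_integral_abs eta mO mf); apply: filterS => x fx Ox.
by apply: cdot_eq0; have [] := fx Ox.
Qed.

Lemma L2_sep h (k : T -> R[i]) : L2 h -> L2 k -> (forall g, L2 g -> rinner h g = rinner k g) ->
  h = k %[ae eta in Omega].
Proof.
move=> Lh Lk hk; pose g x := (-1)%:C * k x + h x.
have Lg : L2 g by exact: L2_lin.
have : rinner g g = 0 by rewrite {1}/g rinner_linl// hk// mulN1r addNr.
move/(rinner_eq0 Lg); apply: filterS => x gx Ox.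
have := gx Ox; rewrite /g => /eqP; rewrite addrC.
by rewrite (_ : (-1)%:C = -1) ?mulN1r ?subr_eq0 => [/eqP//|]; rewrite rmorphN rmorph1.
Qed.

Lemma sum_geometric_le2 (q : R) n : 0 <= q -> q <= 2^-1 ->
  \sum_(0 <= k < n) q ^+ k <= 2.
Proof.
(* The subtracted term 2 q^n makes the bound strong enough for induction. *)
move=> q0 q1; suff : \sum_(0 <= k < n) q ^+ k <= 2 * (1 - q ^+ n).
  move/le_trans; apply; rewrite ler_piMr// lerBlDr lerDl exprn_ge0//.
elim: n => [|n IH]; first by rewrite big_geq// expr0 subrr mulr0.
rewrite big_nat_recr//= exprS; have := exprn_ge0 n q0.
move: IH; set S := \sum_(_ <= _ < _) _; set p := q ^+ n => IH p0.
have : q * p <= 2^-1 * p by rewrite ler_wpM2r.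
lra.
Qed.

(** The Riesz-Fischer argument. Half of the decay 16^(-k) is spent on the weights 4^k in W, the sum
    of 4^k a_k^2, which stays integrable. Where W is finite, |a_k| <= 2^(-k) sqrt W, so the series
    converges absolutely and its partial sums have squares at most 4 W. The majorant 4 W + c^2 then
    gives convergence of the pairings, the only mode of convergence used later. *)
Lemma L2_complete_real (a : nat -> T -> R) (C : R) :
  (forall k, measurable_fun Omega (a k)) ->
  (forall k, (\int[eta]_(x in Omega) ((a k x) ^+ 2)%:E <= (C * (16^-1) ^+ k)%:E)%E) ->
  exists b : T -> R, [/\ measurable_fun Omega b,
    (\int[eta]_(x in Omega) ((b x) ^+ 2)%:E < +oo)%E &
    forall c : T -> R, measurable_fun Omega c ->
      (\int[eta]_(x in Omega) ((c x) ^+ 2)%:E < +oo)%E ->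
      \int[eta]_(x in Omega) ((\sum_(0 <= k < n) a k x) * c x) @[n --> \oo] -->
      \int[eta]_(x in Omega) (b x * c x)].
Proof.
move=> ma Ia.
pose u k x : \bar R := (4 ^+ k * (a k x) ^+ 2)%:E.
have u0 k x : (0 <= u k x)%E by rewrite lee_fin mulr_ge0 ?sqr_ge0 ?exprn_ge0.
have mu_ k : measurable_fun Omega (u k).
  by apply/measurable_EFinP; apply: measurable_funM => //; exact: measurable_funX.
pose W x : \bar R := (\sum_(0 <= k <oo) u k x)%E.
have W0 x : (0 <= W x)%E by apply: nneseries_ge0.
have mW : measurable_fun Omega W.
  by apply: ge0_emeasurable_sum => // k x _ _; exact: u0.
have IW : (\int[eta]_(x in Omega) W x < +oo)%E.
  rewrite integral_nneseries//.
  apply: (@le_lt_trans _ _ (2 * `|C|)%:E); last exact: ltry.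
  apply: lime_le; first by apply: is_cvg_nneseries => k _ _; exact: integral_ge0.
  apply: nearW => n.
  apply: (@le_trans _ _ (\sum_(0 <= k < n) (`|C| * (4^-1) ^+ k)%:E)%E).
    apply: lee_sum => k _.
    rewrite (_ : (\int[eta]_(x in Omega) u k x)%E =
      ((4 ^+ k)%:E * \int[eta]_(x in Omega) ((a k x) ^+ 2)%:E)%E); last first.
      rewrite -ge0_integralZl//.
      - by apply/measurable_EFinP; exact: measurable_funX.
      - by move=> x _; rewrite lee_fin sqr_ge0.
    apply: le_trans (lee_wpmul2l _ (Ia k)) _; first by rewrite lee_fin exprn_ge0.
    rewrite -EFinM lee_fin mulrCA -exprMn.
    rewrite (_ : 4 * 16^-1 = 4^-1 :> R); last by field.
    by rewrite ler_wpM2r ?exprn_ge0 ?invr_ge0// ler_norm.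
  rewrite sumEFin lee_fin -mulr_sumr mulrC ler_wpM2r//.
  by apply: sum_geometric_le2; lra.
have iW : eta.-integrable Omega W.
  by apply/integrableP; split => //; under eq_integral do rewrite gee0_abs//.
pose F := Omega `&` W @^-1` (~` [set +oo%E]).
have mF : measurable F by apply: mW => //; exact: measurableC.
have aW k x : F x -> `|a k x| <= (2^-1) ^+ k * Num.sqrt (fine (W x)).
  move=> [Ox Wx].
  have fW : W x \is a fin_num by rewrite ge0_fin_numE// ltey; apply/eqP.
  have : (u k x <= W x)%E.
    apply: le_trans (nneseries_lim_ge k.+1 (fun n _ _ => u0 n x)).
    by rewrite big_nat_recr//= leeDr// sume_ge0.
  move=> h'; have h : 4 ^+ k * a k x ^+ 2 <= fine (W x) by rewrite -lee_fin fineK.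
  rewrite -ler_sqr ?nnegrE// ?mulr_ge0 ?exprn_ge0 ?sqrtr_ge0//.
  rewrite exprMn sqr_sqrtr ?fine_ge0// real_normK ?num_real// -exprM mulnC exprM.
  rewrite (_ : (2^-1) ^+ 2 = 4^-1 :> R); last by field.
  by rewrite exprVn ler_pdivlMl ?exprn_gt0.
pose s n x := \sum_(0 <= k < n) a k x.
(* Cut off to F, the partial sums converge at every point; W being integrable, F fills Omega up to a
   null set and the integrals do not change. *)
pose s' n x := s n x * \1_F x.
have sW n x : F x -> `|s n x| <= 2 * Num.sqrt (fine (W x)).
  move=> Fx; rewrite /s (le_trans (ler_norm_sum _ _ _))//.
  apply: (@le_trans _ _ (\sum_(0 <= k < n) (2^-1) ^+ k * Num.sqrt (fine (W x)))).
    by apply: ler_sum => k _; exact: aW.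
  rewrite -mulr_suml ler_wpM2r ?sqrtr_ge0//.
  by apply: sum_geometric_le2; lra.
have s'W n x : Omega x -> (((s' n x) ^+ 2)%:E <= 4%:E * W x)%E.
  move=> Ox; rewrite /s' indicE; have [Fx|nFx] := pselect (F x); last first.
    by rewrite memNset// mulr0 expr0n mule_ge0.
  rewrite mem_set// mulr1; have [_ Wx] := Fx.
  have fW : W x \is a fin_num by rewrite ge0_fin_numE// ltey; apply/eqP.
  rewrite -(fineK fW) -EFinM lee_fin -(real_normK (num_real _)).
  rewrite -[4](_ : 2 ^+ 2 = 4 :> R); last by ring.
  rewrite -(sqr_sqrtr (fine_ge0 (W0 x))) -exprMn lerXn2r ?nnegrE ?sW//.
have cs x : F x -> cvgn (series (a^~ x)).
  move=> Fx; apply: normed_cvg.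
  apply: (@series_le_cvg _ _ (geometric (Num.sqrt (fine (W x))) 2^-1)) => //.
  - by move=> n /=.
  - by move=> n; rewrite /geometric/= mulr_ge0 ?sqrtr_ge0 ?exprn_ge0.
  - by move=> n; rewrite /geometric/= mulrC; exact: aW.
  - by apply: is_cvg_geometric_series; rewrite ger0_norm; lra.
pose b x := limn (series (a^~ x)) * \1_F x.
have s'b x : s' n x @[n --> \oo] --> b x.
  rewrite /s' /b indicE; have [Fx|nFx] := pselect (F x); last first.
    rewrite memNset// mulr0; under eq_fun do rewrite mulr0; exact: cvg_cst.
  by rewrite mem_set// mulr1; under eq_fun do rewrite mulr1; exact: cs.
have ms n : measurable_fun Omega (s n) by apply: measurable_sum.
have ms' n : measurable_fun Omega (s' n).
  by apply: measurable_funM => //; exact: measurable_indic.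
have mb : measurable_fun Omega b by apply: measurable_fun_cvg (fun x _ => s'b x).
have bW x : Omega x -> (((b x) ^+ 2)%:E <= 4%:E * W x)%E.
  move=> Ox; have [Wy|Wy] := eqVneq (W x) +oo%E.
    by rewrite Wy gt0_muley ?leey// lte_fin.
  have fW : W x \is a fin_num by rewrite ge0_fin_numE// ltey.
  rewrite -(fineK fW) -EFinM lee_fin.
  have C1 : s' n x ^+ 2 @[n --> \oo] --> b x ^+ 2.
    by rewrite expr2; under eq_fun do rewrite expr2; apply: cvgM; exact: s'b.
  apply: (ler_cvg_to C1 (cvg_cst _)); apply: nearW => n.
  by have := s'W n _ Ox; rewrite -(fineK fW) -EFinM lee_fin.
exists b; split => //.
  apply: (@le_lt_trans _ _ (\int[eta]_(x in Omega) (4%:E * W x))%E).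
    apply: ge0_le_integral => //.
    - by move=> x _; rewrite lee_fin sqr_ge0.
    - by apply/measurable_EFinP; exact: measurable_funX.
    - exact: emeasurable_funM.
  by rewrite ge0_integralZl// lte_mul_pinfty// lee_fin.
move=> c mc Ic.
have ic2 : eta.-integrable Omega (fun x => ((c x) ^+ 2)%:E).
  apply/integrableP; split; first by apply/measurable_EFinP; exact: measurable_funX.
  by under eq_integral do rewrite gee0_abs ?lee_fin ?sqr_ge0//.
have ig : eta.-integrable Omega (fun x => 4%:E * W x + ((c x) ^+ 2)%:E)%E.
  by apply: integrableD => //; exact: integrableZl.
have H1 n : measurable_fun Omega (fun x => (s' n x * c x)%:E).
  by apply/measurable_EFinP; exact: measurable_funM.
have H2 : measurable_fun Omega (fun x => (b x * c x)%:E).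
  by apply/measurable_EFinP; exact: measurable_funM.
have H3 : {ae eta, forall x, Omega x ->
    (s' n x * c x)%:E @[n --> \oo] --> (b x * c x)%:E}.
  apply: aeW => x _; apply: cvg_EFin; first exact: nearW.
  by apply: cvgM; [exact: s'b|exact: cvg_cst].
have H4 : {ae eta, forall x n, Omega x ->
    (`|(s' n x * c x)%:E| <= 4%:E * W x + ((c x) ^+ 2)%:E)%E}.
  apply: aeW => x n Ox; rewrite abse_EFin.
  apply: (@le_trans _ _ ((s' n x) ^+ 2 + (c x) ^+ 2)%:E).
    rewrite lee_fin normrM.
    have := sqr_ge0 (`|s' n x| - `|c x|); rewrite sqrrB !real_normK ?num_real//.
    have := mulr_ge0 (normr_ge0 (s' n x)) (normr_ge0 (c x)); lra.
  by rewrite EFinD leeD2r// s'W.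
have [ib _ Cv] := dominated_convergence mO H1 H2 H3 ig H4.
have Fae : {ae eta, forall x, Omega x -> F x}.
  have := integrable_ae mO iW; apply: filterS => x Wx Ox; split => //=.
  by move=> Wy; have := Wx Ox; rewrite Wy.
have fb := integrable_fin_num mO ib.
move: Cv; rewrite -(fineK fb) => /fine_cvg Cv.
rewrite /Rintegral; apply: cvg_trans Cv; apply: near_eq_cvg; apply: nearW => n /=.
congr fine; apply: ae_eq_integral => //.
- by apply/measurable_EFinP; apply: measurable_funM => //; exact: ms.
- by apply: filterS Fae => x Fx Ox; rewrite /s' indicE mem_set ?mulr1//; exact: Fx.
Qed.

(** Real and imaginary parts are summed separately, the pairing with g being a sum of two real
    integrals. *)
Lemma L2_complete (u : nat -> T -> R[i]) (C : R) : (forall k, L2 (u k)) ->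
  (forall k, rinner (u k) (u k) <= C * (16^-1) ^+ k) ->
  exists2 h, L2 h & forall g, L2 g ->
    \sum_(0 <= k < n) rinner (u k) g @[n --> \oo] --> rinner h g.
Proof.
move=> Lu uC.
have sq_le (p : R[i] -> R) k : measurable_fun Omega (fun x => p (u k x)) ->
    (forall c, (p c) ^+ 2 <= cdot c c) ->
    (\int[eta]_(x in Omega) ((p (u k x)) ^+ 2)%:E <= (C * (16^-1) ^+ k)%:E)%E.
  move=> mp ple; have := uC k; rewrite -lee_fin; apply: le_trans.
  rewrite EFin_rinner//; apply: ge0_le_integral => //.
  - by move=> x _; rewrite lee_fin sqr_ge0.
  - by apply/measurable_EFinP; exact: measurable_funX.
  - apply/measurable_EFinP; have [m1 m2 _] := Lu k.
    by apply: measurable_funD; exact: measurable_funX.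
  - by move=> x _; rewrite lee_fin (le_trans (ple _))// /cdot -!expr2.
have leRe (c : R[i]) : complex.Re c ^+ 2 <= cdot c c.
  by rewrite /cdot -!expr2 lerDl sqr_ge0.
have leIm (c : R[i]) : complex.Im c ^+ 2 <= cdot c c.
  by rewrite /cdot -!expr2 lerDr sqr_ge0.
have mRe k : measurable_fun Omega (fun x => complex.Re (u k x)) by have [] := Lu k.
have mIm k : measurable_fun Omega (fun x => complex.Im (u k x)) by have [] := Lu k.
have [b1 [mb1 Ib1 cb1]] := L2_complete_real mRe (fun k => sq_le _ k (mRe k) leRe).
have [b2 [mb2 Ib2 cb2]] := L2_complete_real mIm (fun k => sq_le _ k (mIm k) leIm).
have Lh : L2 (fun x => b1 x +i* b2 x).
  split => //=; rewrite /L2norm2/=.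
  under eq_integral do rewrite EFinD.
  rewrite ge0_integralD//; first exact: lte_add_pinfty.
  - by move=> x _; rewrite lee_fin sqr_ge0.
  - by apply/measurable_EFinP; exact: measurable_funX.
  - by move=> x _; rewrite lee_fin sqr_ge0.
  - by apply/measurable_EFinP; exact: measurable_funX.
exists (fun x => b1 x +i* b2 x) => // g Lg.
have [mg1 mg2 Ig] := Lg.
have sq_g (p : R[i] -> R) : measurable_fun Omega (fun x => p (g x)) ->
    (forall c, (p c) ^+ 2 <= cdot c c) ->
    (\int[eta]_(x in Omega) ((p (g x)) ^+ 2)%:E < +oo)%E.
  move=> mp ple; apply: le_lt_trans Ig; apply: ge0_le_integral => //.
  - by move=> x _; rewrite lee_fin sqr_ge0.
  - by apply/measurable_EFinP; exact: measurable_funX.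
  - apply/measurable_EFinP.
    by apply: measurable_funD; exact: measurable_funX.
  - by move=> x _; rewrite lee_fin (le_trans (ple _))// /cdot -!expr2.
have c1 := cb1 _ mg1 (sq_g _ mg1 leRe).
have c2 := cb2 _ mg2 (sq_g _ mg2 leIm).
(* Each component of h, seen as an element of L2, makes the corresponding product with g integrable;
   this allows the pairing to be split. *)
have LRe h : L2 h -> L2 (fun x => (complex.Re (h x))%:C).
  move=> Lh'; have [m1 m2 _] := Lh'; apply/L2P; split => //=.
  apply: le_integrable (cdot_integrable Lh' Lh') => //.
    by apply/measurable_EFinP; rewrite /cdot/=; apply: measurable_funD; apply: measurable_funM.
  move=> x _ /=; rewrite lee_fin !ger0_norm ?cdot_ge0//.
  by rewrite {1}/cdot/= mulr0 addr0 -expr2 leRe.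
have LIm h : L2 h -> L2 (fun x => 0 +i* complex.Im (h x)).
  move=> Lh'; have [m1 m2 _] := Lh'; apply/L2P; split => //=.
  apply: le_integrable (cdot_integrable Lh' Lh') => //.
    by apply/measurable_EFinP; rewrite /cdot/=; apply: measurable_funD; apply: measurable_funM.
  move=> x _ /=; rewrite lee_fin !ger0_norm ?cdot_ge0//.
  by rewrite {1}/cdot/= mulr0 add0r -expr2 leIm.
have split_rinner h : L2 h -> rinner h g =
   \int[eta]_(x in Omega) (complex.Re (h x) * complex.Re (g x)) +
   \int[eta]_(x in Omega) (complex.Im (h x) * complex.Im (g x)).
  move=> Lh'; rewrite /rinner -RintegralD//.
  - have := cdot_integrable (LRe _ Lh') Lg; apply: eq_integrable => // x _ /=.
    by rewrite /cdot/= mul0r addr0.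
  - have := cdot_integrable (LIm _ Lh') Lg; apply: eq_integrable => // x _ /=.
    by rewrite /cdot/= mul0r add0r.
rewrite split_rinner//=.
pose U n x := \sum_(0 <= k < n) u k x.
have US n x : U n.+1 x = 1%:C * U n x + u n x.
  by rewrite /U big_nat_recr//= mul1r.
have LU n : L2 (U n).
  elim: n => [|n IH].
    by rewrite (_ : U 0%N = (fun=> 0)); [exact: L2_0|apply/funext => x; rewrite /U big_geq].
  by rewrite (_ : U n.+1 = (fun x => 1%:C * U n x + u n x)); [exact: L2_lin|apply/funext => x; rewrite US].
have rU n : \sum_(0 <= k < n) rinner (u k) g = rinner (U n) g.
  elim: n => [|n IH].
    rewrite big_geq// (_ : U 0%N = (fun=> 0)) ?rinner0l//.
    by apply/funext => x; rewrite /U big_geq.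
  rewrite big_nat_recr//= IH (_ : U n.+1 = (fun x => 1%:C * U n x + u n x)).
    by rewrite rinner_linl// mul1r.
  by apply/funext => x; rewrite US.
have ReU n x : complex.Re (U n x) = \sum_(0 <= k < n) complex.Re (u k x).
  elim: n => [|n IH]; first by rewrite /U !big_geq.
  by rewrite US mul1r big_nat_recr//= -IH; case: (U n x) => ? ?; case: (u n x).
have ImU n x : complex.Im (U n x) = \sum_(0 <= k < n) complex.Im (u k x).
  elim: n => [|n IH]; first by rewrite /U !big_geq.
  by rewrite US mul1r big_nat_recr//= -IH; case: (U n x) => ? ?; case: (u n x).
apply: cvg_trans (cvgD c1 c2); apply: near_eq_cvg; apply: nearW => n /=.
rewrite rU split_rinner//; congr (_ + _); apply: eq_Rintegral => x _.
  by rewrite ReU.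
by rewrite ImU.
Qed.

End L2_space.

(** * Spectral measures *)

Section density.
Context {d : measure_display} {T : measurableType d} {R : realType}.
Variables (m : {finite_measure set T -> \bar R}) (D : set T) (F : T -> R).
Hypotheses (mD : measurable D) (F0 : forall x, D x -> 0 <= F x)
  (iF : m.-integrable D (EFin \o F)).

(** Termwise integration gives additivity, since at each point at most one of the disjoint sets
    contributes. Such measures serve to describe the spectral measures of phi(L) f in terms of those
    of f. *)
Lemma density_ex : exists M : {finite_measure set T -> \bar R},
  forall A, measurable A -> M A = (\int[m]_(x in D) (F x * \1_A x)%:E)%E.
Proof.
have mF : measurable_fun D F by apply/measurable_EFinP; exact: measurable_int iF.
have IA (A : set T) : measurable A ->
    m.-integrable D (EFin \o (fun x => F x * \1_A x)).
  move=> mA; apply: le_integrable iF => //.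
    by apply/measurable_EFinP; apply: measurable_funM => //; exact: measurable_indic.
  move=> x Dx /=; rewrite lee_fin normrM ler_piMr//.
  by rewrite indicE; case: (x \in A); rewrite ?normr1 ?normr0.
pose nu A := \int[m]_(x in D) (F x * \1_A x).
have nuE A : measurable A -> (nu A)%:E = (\int[m]_(x in D) (F x * \1_A x)%:E)%E.
  by move=> mA; rewrite /nu /Rintegral fineK//; apply: integrable_fin_num => //; exact: IA.
have nus : sigma_additive_setfun nu.
  split.
    rewrite /nu /Rintegral (_ : (\int[m]_(x in D) _)%E = 0%E)//.
    by apply: integral0_eq => x _; rewrite indic0 mulr0.
  move=> A mA tA; have mU : measurable (\bigcup_k A k) by exact: bigcup_measurable.
  have H : (\int[m]_(x in D) (F x * \1_(\bigcup_k A k) x)%:E =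
      \sum_(0 <= k <oo) \int[m]_(x in D) (F x * \1_(A k) x)%:E)%E.
    rewrite -integral_nneseries//; last 2 first.
    - by move=> k; exact: measurable_int (IA _ (mA k)).
    - by move=> k x Dx; rewrite lee_fin mulr_ge0 ?F0.
    apply: eq_integral => x; rewrite inE => Dx.
    have [[k _ Akx]|nA] := pselect ((\bigcup_k A k) x).
      rewrite (@nneseriesD1 _ _ k)//; last by move=> i _; rewrite lee_fin mulr_ge0 ?F0.
      rewrite eseries0.
        by rewrite adde0 !indicE !mem_set//; exists k.
      move=> i _ ik; rewrite indicE memNset ?mulr0// => Aix.
      by move/trivIsetP : tA => /(_ i k I I ik); apply/eqP/set0P; exists x.
    rewrite eseries0 ?indicE ?memNset ?mulr0// => i _ _.
    by rewrite indicE memNset ?mulr0// => Aix; apply: nA; exists i.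
  have C : \sum_(0 <= k < n) (nu (A k))%:E @[n --> \oo] --> (nu (\bigcup_k A k))%:E.
    rewrite nuE// H; under eq_fun do under eq_bigr do rewrite nuE//.
    by apply: is_cvg_nneseries => k _ _; apply: integral_ge0 => x Dx; rewrite lee_fin mulr_ge0 ?F0.
  move: C; under eq_fun do rewrite sumEFin; move/fine_cvg; exact.
have nu0 A : measurable A -> 0 <= nu A.
  by move=> _; apply: Rintegral_ge0 => x Dx; rewrite mulr_ge0 ?F0.
have [M ME] := nneg_setfun_measure nus nu0.
by exists M => A mA; rewrite ME// nuE.
Qed.

(** For simple functions this is the description of M on sets; both sides then follow by monotone
    convergence along one increasing sequence. *)
Lemma integral_density (M : {finite_measure set T -> \bar R}) (psi : T -> R) :
  (forall A, measurable A -> M A = (\int[m]_(x in D) (F x * \1_A x)%:E)%E) ->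
  measurable_fun D psi -> (forall x, D x -> 0 <= psi x) ->
  (\int[M]_(x in D) (psi x)%:E = \int[m]_(x in D) (psi x * F x)%:E)%E.
Proof.
move=> ME mpsi psi0.
have mF : measurable_fun D F by apply/measurable_EFinP; exact: measurable_int iF.
pose f := EFin \o psi.
have mf : measurable_fun D f by exact/measurable_EFinP.
have f0 x : D x -> (0 <= f x)%E by move=> Dx; rewrite lee_fin psi0.
pose h := nnsfun_approx mD mf.
have hc x : D x -> (h n x)%:E @[n --> \oo] --> f x.
  by move=> Dx; exact: cvg_nnsfun_approx.
have hnd x : {homo (fun n => h n x) : n k / (n <= k)%N >-> n <= k}.
  by move=> n k nk; exact/lefP/nd_nnsfun_approx.
have C1 : (\int[M]_(x in D) (h n x)%:E)%E @[n --> \oo] --> (\int[M]_(x in D) f x)%E.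
  rewrite (_ : (\int[M]_(x in D) f x)%E =
    (\int[M]_(x in D) limn (fun n => (h n x)%:E))%E); last first.
    by apply: eq_integral => x; rewrite inE => Dx; apply/esym/cvg_lim => //; exact: hc.
  apply: cvg_monotone_convergence => //.
  - by move=> n; apply/measurable_EFinP; apply: measurable_funTS.
  - by move=> n x _; rewrite lee_fin.
  - by move=> x _ a b ab; rewrite lee_fin hnd.
have C2 : (\int[m]_(x in D) (h n x * F x)%:E)%E @[n --> \oo] -->
    (\int[m]_(x in D) (psi x * F x)%:E)%E.
  rewrite (_ : (\int[m]_(x in D) (psi x * F x)%:E)%E =
    (\int[m]_(x in D) limn (fun n => (h n x * F x)%:E))%E); last first.
    apply: eq_integral => x; rewrite inE => Dx; apply/esym/cvg_lim => //.
    rewrite EFinM; under eq_fun do rewrite EFinM.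
    by apply: cvgeZr => //; exact: hc.
  apply: cvg_monotone_convergence => //.
  - move=> n; apply/measurable_EFinP; apply: measurable_funM => //.
    exact: measurable_funTS.
  - by move=> n x Dx; rewrite lee_fin mulr_ge0 ?F0.
  - by move=> x Dx a b ab; rewrite lee_fin ler_wpM2r ?F0 ?hnd.
apply: (cvg_unique (@ereal_hausdorff R) C1).
rewrite (_ : (fun n => _) = fun n => (\int[m]_(x in D) (h n x * F x)%:E)%E)//.
apply/funext => n.
have fin := fimfunP (h n).
have mh y : measurable (h n @^-1` [set y]) by [].
transitivity (\sum_(y \in range (h n)) (y%:E * M (h n @^-1` [set y] `&` D)))%E.
  rewrite (eq_integral (fun x => \sum_(y \in range (h n)) (y * \1_(h n @^-1` [set y]) x)%:E)); last first.
    by move=> x _; rewrite fsumEFin// -fimfunE.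
  rewrite ge0_integral_fsum//.
  - apply: eq_fsbigr => y; rewrite inE => -[x _ <-].
    under eq_integral do rewrite EFinM.
    by rewrite integralZl_indic_nnsfun// integral_indic.
  - by move=> y; apply/measurable_EFinP; apply: measurable_funM.
  - by move=> y x _; exact: nnfun_muleindic_ge0.
transitivity (\sum_(y \in range (h n)) (\int[m]_(x in D)
    (y * (F x * \1_(h n @^-1` [set y]) x))%:E))%E.
  apply: eq_fsbigr => y; rewrite inE => -[x _ <-].
  rewrite ME; last exact: measurableI.
  under [RHS]eq_integral do rewrite EFinM.
  rewrite ge0_integralZl//; last 3 first.
  - apply/measurable_EFinP; apply: measurable_funM => //; exact: measurable_indic.
  - by move=> z Dz; rewrite lee_fin mulr_ge0 ?F0.
  - by rewrite lee_fin.
  congr (_ * _)%E; apply: eq_integral => z; rewrite inE => Dz.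
  by rewrite !indicE in_setI (mem_set Dz) andbT.
rewrite -ge0_integral_fsum//.
- apply: eq_integral => x; rewrite inE => Dx; rewrite fsumEFin//; congr (_%:E).
  rewrite (fsbigD1 (h n x))//=; last by exists x.
  rewrite indicE mem_set// mulr1 fsbig1 ?addr0// => y [_ /= ynx].
  by rewrite indicE memNset ?mulr0//= => /esym.
- move=> y; apply/measurable_EFinP; apply: measurable_funM => //.
  apply: measurable_funM => //; exact: measurable_indic.
- move=> y x Dx; have [y0|y0] := leP 0 y; first by rewrite lee_fin !mulr_ge0 ?F0.
  rewrite indicE memNset ?mulr0//= => hx.
  by have : 0 <= h n x by []; rewrite hx leNgt y0.
Qed.

End density.

(** * The measures E_{f,g} and the graph of phi(L) *)

Section spectral_calculus.
Context {d : measure_display} {T : measurableType d} {R : realType}.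
Variables (eta : {measure set T -> \bar R}) (Omega : set T).
Hypothesis mO : measurable Omega.
Variable E : set R -> (T -> R[i]) -> (T -> R[i]).
Hypothesis hE : resolution_of_identity eta Omega E.
Local Notation Rp := (`[0%R, +oo[%classic : set R).
Hypothesis hE0 : forall f, L2 eta Omega f -> E Rp f = f %[ae eta in Omega].
Local Notation L2 := (L2 eta Omega).
Local Notation rin := (rinner eta Omega).
Implicit Types (f g h : T -> R[i]) (A B : set R) (phi psi : R -> R).

(** The real part of E_{f,g}; the imaginary part is [spectral_re f (mulI g)]. *)
Definition spectral_re f g A : R := rin (E A f) g.

Lemma mRp : measurable Rp. Proof. exact: measurable_itv. Qed.
Hint Resolve mRp : core.

Lemma E_L2 A f : measurable A -> L2 f -> L2 (E A f).
Proof. by case: hE => + _ _ _ _ mA Lf => /(_ A mA)[[[_ /(_ f Lf)[]]]]. Qed.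

Lemma Re_inner f g : complex.Re (inner eta Omega f g) = rin f g.
Proof. by rewrite innerE. Qed.

Lemma Im_inner f g : complex.Im (inner eta Omega f g) = rin f (mulI g).
Proof. by rewrite innerE. Qed.

Lemma E_sym A f g : measurable A -> L2 f -> L2 g -> rin (E A f) g = rin f (E A g).
Proof.
move=> mA Lf Lg; case: hE => /(_ A mA)[_ _ /(_ f g Lf Lg) h] _ _ _ _.
by rewrite -!Re_inner h.
Qed.

(** Symmetry moves E B to the left factor, where projections multiply by intersecting their sets.
    With A = B this exhibits E_{f,g}(A) as a pairing of E A f and E A g, whence positivity and the
    Cauchy-Schwarz bound. *)
Lemma rin_EE A B f g : measurable A -> measurable B -> L2 f -> L2 g ->
  rin (E A f) (E B g) = spectral_re f g (A `&` B).
Proof.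
move=> mA mB Lf Lg; rewrite -E_sym//; last exact: E_L2.
rewrite /spectral_re setIC; apply: rinner_ael => //; try exact: E_L2.
- by apply: E_L2 => //; exact: E_L2.
- by apply: E_L2 => //; exact: measurableI.
- case: hE => _ _ _ /(_ B A f mB mA Lf) h _.
  by apply: filterS h => x hx Ox; rewrite hx.
Qed.

Lemma sm_sigma_additive f g : L2 f -> L2 g -> sigma_additive_setfun (spectral_re f g).
Proof.
move=> Lf Lg; split.
  rewrite /spectral_re (@rinner_ael _ _ _ eta Omega mO _ (fun=> 0)) ?rinner0l//.
  - exact: E_L2.
  - exact: L2_0.
  - by case: hE => _ /(_ f Lf).
move=> A mA tA; case: hE => _ _ _ _ /(_ A f g mA tA Lf Lg)[+ _].
by rewrite Re_inner; under eq_fun do rewrite Re_inner.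
Qed.

Lemma smC f g A : measurable A -> L2 f -> L2 g -> spectral_re f g A = spectral_re g f A.
Proof. by move=> mA Lf Lg; rewrite /spectral_re E_sym// rinnerC. Qed.

Lemma sm_Rp f g A : measurable A -> L2 f -> L2 g -> spectral_re f g (A `&` Rp) = spectral_re f g A.
Proof.
move=> mA Lf Lg; rewrite -rin_EE// rinnerC [RHS]rinnerC.
apply: rinner_ael => //; first exact: E_L2.
- exact: E_L2.
- exact: hE0.
Qed.

Lemma sm_total f g : L2 f -> L2 g -> spectral_re f g Rp = rin f g.
Proof.
by move=> Lf Lg; apply: rinner_ael => //; [exact: E_L2|exact: hE0].
Qed.

Lemma sm_ge0 f A : measurable A -> L2 f -> 0 <= spectral_re f f A.
Proof. by move=> mA Lf; rewrite -(setIid A) -rin_EE// rinner_ge0. Qed.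

Lemma sm_CS f g A : measurable A -> L2 f -> L2 g ->
  spectral_re f g A ^+ 2 <= spectral_re f f A * spectral_re g g A.
Proof.
move=> mA Lf Lg; rewrite -(setIid A) -!rin_EE//.
by apply: rinner_CS => //; exact: E_L2.
Qed.

Lemma spectral_measure_ex f : L2 f -> exists m : {finite_measure set R -> \bar R},
  forall A, measurable A -> m A = (spectral_re f f A)%:E.
Proof.
move=> Lf; apply: nneg_setfun_measure; first exact: sm_sigma_additive.
by move=> A mA; exact: sm_ge0.
Qed.

Lemma sm_mono f A B : measurable A -> measurable B -> A `<=` B -> L2 f ->
  spectral_re f f A <= spectral_re f f B.
Proof.
move=> mA mB AB Lf; have [m mE] := spectral_measure_ex Lf.
by rewrite -lee_fin -!mE// le_measure ?inE.
Qed.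

Lemma calculus_domE f (m : {finite_measure set R -> \bar R}) phi :
  (forall A, measurable A -> m A = (spectral_re f f A)%:E) ->
  calculus_dom eta Omega E phi f <->
  L2 f /\ (\int[m]_(x in Rp) (phi x ^+ 2)%:E < +oo)%E.
Proof.
move=> mE; rewrite /calculus_dom /mkset.
rewrite (@eq_setfun_integral _ _ _ _ m); last first.
  by move=> A mA; rewrite mE// /spectral_re -Re_inner.
rewrite (eq_integral (fun x => (phi x ^+ 2)%:E))// => x _.
by rewrite real_normK ?num_real.
Qed.

(** Two finite measures whose difference is the real part of E_{f,g}. They need not be the Jordan
    parts: the bounds by E_{f,f} E_{g,g} are all that the integrability arguments use. *)
Definition spectral_pair f g (m1 m2 : {finite_measure set R -> \bar R}) :=
  [/\ forall A, measurable A -> (spectral_re f g A)%:E = (m1 A - m2 A)%E,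
      forall A, measurable A -> fine (m1 A) ^+ 2 <= spectral_re f f A * spectral_re g g A &
      forall A, measurable A -> fine (m2 A) ^+ 2 <= spectral_re f f A * spectral_re g g A].

(** The Jordan parts of E_{f,g} are, up to sign, its values on intersections with a fixed set or
    with its complement; Cauchy-Schwarz applies there, and E_{f,f} and E_{g,g} only grow when
    passing back to A. *)
Lemma spectral_pair_ex f g : L2 f -> L2 g -> exists m1 m2, spectral_pair f g m1 m2.
Proof.
move=> Lf Lg; have [m1 [m2 [P [mP m1E m2E mE]]]] := Jordan_setfun (sm_sigma_additive Lf Lg).
have H A B : measurable A -> measurable B -> spectral_re f g (A `&` B) ^+ 2 <= spectral_re f f A * spectral_re g g A.
  move=> mA mB; have mAB : measurable (A `&` B) by exact: measurableI.
  apply: le_trans (sm_CS mAB Lf Lg) _.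
  by apply: ler_pM; rewrite ?sm_ge0// sm_mono//; exact: subIsetl.
exists m1, m2; split => // A mA; first by rewrite m1E//=; exact: H.
by rewrite m2E//= sqrrN; apply: H => //; exact: measurableC.
Qed.

(** An additive form of Cauchy-Schwarz. It is not homogeneous in phi, so besides integrability it
    yields rates of convergence when applied to large multiples of a small phi. *)
Lemma spectral_pair_bound f g m1 m2 (mf mg : {finite_measure set R -> \bar R}) phi :
  (forall A, measurable A -> mf A = (spectral_re f f A)%:E) ->
  (forall A, measurable A -> mg A = (spectral_re g g A)%:E) ->
  spectral_pair f g m1 m2 -> measurable_fun Rp phi ->
  (2%:E * \int[m1]_(x in Rp) `|phi x|%:E <=
     \int[mf]_(x in Rp) (phi x ^+ 2)%:E + mg setT)%E /\
  (2%:E * \int[m2]_(x in Rp) `|phi x|%:E <=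
     \int[mf]_(x in Rp) (phi x ^+ 2)%:E + mg setT)%E.
Proof.
move=> mfE mgE [_ h1 h2] mphi; split; apply: integral_sqrt_measure_le => // A mA.
  by rewrite mfE// mgE//; exact: h1.
by rewrite mfE// mgE//; exact: h2.
Qed.

Lemma spectral_pair_integrable f g m1 m2 phi : L2 g ->
  spectral_pair f g m1 m2 -> measurable_fun Rp phi ->
  calculus_dom eta Omega E phi f ->
  m1.-integrable Rp (EFin \o phi) /\ m2.-integrable Rp (EFin \o phi).
Proof.
move=> Lg sp mphi dphi; have Lf : L2 f by case: dphi.
have [mf mfE] := spectral_measure_ex Lf; have [mg mgE] := spectral_measure_ex Lg.
have [_ fphi] := proj1 (calculus_domE phi mfE) dphi.
have [b1 b2] := spectral_pair_bound mfE mgE sp mphi.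
have fin : (\int[mf]_(x in Rp) (phi x ^+ 2)%:E + mg setT < +oo)%E.
  by apply: lte_add_pinfty => //; rewrite -ge0_fin_numE// fin_num_measure.
have fin2 (m : {finite_measure set R -> \bar R}) :
    (2%:E * \int[m]_(x in Rp) `|phi x|%:E <=
     \int[mf]_(x in Rp) (phi x ^+ 2)%:E + mg setT)%E ->
    m.-integrable Rp (EFin \o phi).
  move=> b; apply/integrableP; split; first exact/measurable_EFinP.
  rewrite ltNge leye_eq; apply/negP => /eqP iy.
  move: b; rewrite (_ : (\int[m]_(x in Rp) _)%E = +oo%E)// gt0_muley ?lte_fin//.
  by rewrite leye_eq => /eqP h; move: fin; rewrite h ltxx.
by split; exact: fin2.
Qed.

Lemma spectral_pair_signed f g m1 m2 phi : L2 g ->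
  spectral_pair f g m1 m2 -> measurable_fun Rp phi ->
  calculus_dom eta Omega E phi f ->
  signed_integral (spectral_re f g) Rp phi =
  \int[m1]_(x in Rp) phi x - \int[m2]_(x in Rp) phi x.
Proof.
move=> Lg sp mphi dphi; have Lf : L2 f by case: dphi.
have [i1 i2] := spectral_pair_integrable Lg sp mphi dphi.
apply: signed_integralE => //; first exact: sm_sigma_additive.
by case: sp.
Qed.

(** Testing against i g recovers the imaginary part of the defining identity from its real part. *)
Lemma calculus_graphP phi f h : calculus_graph eta Omega E phi f h <->
  [/\ calculus_dom eta Omega E phi f, L2 h &
      forall g, L2 g -> rin h g = signed_integral (spectral_re f g) Rp phi].
Proof.
have ReE g : (fun A => complex.Re (spectral_measure eta Omega E f g A)) = spectral_re f g.
  by apply/funext => A; rewrite /spectral_measure Re_inner.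
have ImE g : (fun A => complex.Im (spectral_measure eta Omega E f g A)) = spectral_re f (mulI g).
  by apply/funext => A; rewrite /spectral_measure Im_inner.
split=> -[df Lh hh]; split; try exact: df; try exact: Lh.
  by move=> g Lg; rewrite -Re_inner (hh g Lg) -ReE.
move=> g Lg.
by rewrite innerE /complex_integral ReE ImE (hh g Lg) hh//; exact: L2_mulI.
Qed.

Lemma calculus_graph_pair phi f h g m1 m2 : L2 g -> measurable_fun Rp phi ->
  spectral_pair f g m1 m2 -> calculus_graph eta Omega E phi f h ->
  rin h g = \int[m1]_(x in Rp) phi x - \int[m2]_(x in Rp) phi x.
Proof.
move=> Lg mphi sp /calculus_graphP[df Lh ->//].
exact: spectral_pair_signed.
Qed.

Lemma calculus_graph_uniq phi f h h' : calculus_graph eta Omega E phi f h ->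
  calculus_graph eta Omega E phi f h' -> h = h' %[ae eta in Omega].
Proof.
move=> /calculus_graphP[_ Lh e] /calculus_graphP[_ Lh' e'].
by apply: L2_sep => // g Lg; rewrite e// e'.
Qed.

End spectral_calculus.

(** * Existence and composition in the functional calculus *)

Section step_functions.
Context {R : realType}.
Local Notation Rp := (`[0%R, +oo[%classic : set R).
Implicit Types (l : seq (R * set R)) (m : {finite_measure set R -> \bar R}).

(** Step functions are lists of coefficients and sets, with arbitrary signs and overlaps: sums and
    differences become concatenations, and the same list also defines an operator. *)
Fixpoint meas_steps l : Prop :=
  if l is p :: l' then measurable p.2 /\ meas_steps l' else True.

Definition stepfun l (x : R) : R := \sum_(p <- l) p.1 * \1_(p.2) x.

Definition negsteps l := [seq (- p.1, p.2) | p : R * set R <- l].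

Lemma meas_steps_cat l l' : meas_steps l -> meas_steps l' -> meas_steps (l ++ l').
Proof. by elim: l => //= p l IH [? /IH h] /h. Qed.

Lemma meas_negsteps l : meas_steps l -> meas_steps (negsteps l).
Proof. by elim: l => //= p l IH [? /IH]. Qed.

Lemma stepfun_cons p l x : stepfun (p :: l) x = p.1 * \1_(p.2) x + stepfun l x.
Proof. by rewrite /stepfun big_cons. Qed.

Lemma stepfun_cat l l' x : stepfun (l ++ l') x = stepfun l x + stepfun l' x.
Proof. by rewrite /stepfun big_cat. Qed.

Lemma stepfun_neg l x : stepfun (negsteps l) x = - stepfun l x.
Proof.
elim: l => [|p l IH]; first by rewrite /stepfun !big_nil oppr0.
by rewrite /= !stepfun_cons IH opprD mulNr.
Qed.

Lemma stepfun_measurable l : meas_steps l -> measurable_fun Rp (stepfun l).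
Proof.
elim: l => [_|p l IH [mp /IH ml]].
  rewrite (_ : stepfun [::] = cst 0); first exact: measurable_cst.
  by apply/funext => x; rewrite /stepfun big_nil.
rewrite (_ : stepfun (p :: l) = fun x => p.1 * \1_(p.2) x + stepfun l x).
  by apply: measurable_funD => //; apply: measurable_funM => //; exact: measurable_indic.
by apply/funext => x; rewrite stepfun_cons.
Qed.

Lemma integrable_mul_indic m (F : R -> R) A : measurable A ->
  m.-integrable Rp (EFin \o F) -> m.-integrable Rp (EFin \o (fun x => F x * \1_A x)).
Proof.
move=> mA iF; have mF : measurable_fun Rp F.
  by apply/measurable_EFinP; exact: measurable_int iF.
apply: le_integrable iF => //.
  by apply/measurable_EFinP; apply: measurable_funM => //; exact: measurable_indic.
move=> x _ /=; rewrite lee_fin normrM ler_piMr//.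
by rewrite indicE; case: (x \in A); rewrite ?normr1 ?normr0.
Qed.

Lemma integrable_mul_step m (F : R -> R) l : meas_steps l ->
  m.-integrable Rp (EFin \o F) ->
  m.-integrable Rp (EFin \o (fun x => F x * stepfun l x)).
Proof.
move=> + iF; elim: l => [_|p l IH [mp /IH il]].
  have := integrable0 m Rp; apply: eq_integrable; first exact: mRp.
  by move=> x _ /=; rewrite /stepfun big_nil mulr0.
have := integrableD mRp (integrableZl mRp p.1 (integrable_mul_indic mp iF)) il.
apply: eq_integrable; first exact: mRp.
by move=> x _ /=; rewrite stepfun_cons -EFinM -EFinD; congr (_%:E); ring.
Qed.

Lemma Rintegral_mul_step m (F : R -> R) l : meas_steps l ->
  m.-integrable Rp (EFin \o F) ->
  \int[m]_(x in Rp) (F x * stepfun l x) =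
  \sum_(p <- l) p.1 * \int[m]_(x in Rp) (F x * \1_(p.2) x).
Proof.
move=> + iF; elim: l => [_|p l IH [mp ml]].
  rewrite big_nil (eq_Rintegral _ _ (g := cst 0)) ?/Rintegral ?integral0//.
  by move=> x _; rewrite /stepfun big_nil mulr0.
rewrite big_cons -IH// -RintegralZl; [|exact: mRp|exact: integrable_mul_indic].
rewrite -RintegralD.
- by apply: eq_Rintegral => x _; rewrite stepfun_cons; ring.
- exact: mRp.
- exact: (integrableZl mRp p.1 (integrable_mul_indic mp iF)).
- exact: integrable_mul_step.
Qed.

Lemma nnsfun_stepfun (h : {nnsfun R >-> R}) :
  exists2 l, meas_steps l & forall x, h x = stepfun l x.
Proof.
have fin := fimfunP h.
exists [seq (y, h @^-1` [set y]) | y <- finmap.enum_fset (fset_set (range h))].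
  by elim: (finmap.enum_fset _) => //= y s IH; split.
move=> x; rewrite fimfunE fsbig_finite//= /stepfun big_map.
by [].
Qed.

(** The approximants increase to phi from below, so phi^2 dominates the squared error. *)
Lemma stepfun_approx m (phi : R -> R) (e : R) : measurable_fun Rp phi ->
  (forall x, 0 <= x -> 0 <= phi x) ->
  (\int[m]_(x in Rp) (phi x ^+ 2)%:E < +oo)%E -> 0 < e ->
  exists2 l, meas_steps l &
    (\int[m]_(x in Rp) ((phi x - stepfun l x) ^+ 2)%:E <= e%:E)%E.
Proof.
move=> mphi phi0 iphi e0.
pose f : R -> \bar R := EFin \o phi.
have mf : measurable_fun Rp f by exact/measurable_EFinP.
have f0 x : Rp x -> (0 <= f x)%E.
  by rewrite /= in_itv/= andbT => x0; rewrite lee_fin phi0.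
pose h := nnsfun_approx mRp mf.
have i2 : m.-integrable Rp (fun x => (phi x ^+ 2)%:E).
  apply/integrableP; split; first by apply/measurable_EFinP; exact: measurable_funX.
  by under eq_integral do rewrite gee0_abs ?lee_fin ?sqr_ge0//.
have C : (\int[m]_(x in Rp) ((phi x - h n x) ^+ 2)%:E)%E @[n --> \oo] -->
    (\int[m]_(x in Rp) (cst 0 x))%E.
  apply: (@dominated_cvg _ _ _ m Rp mRp _ _ (fun x => (phi x ^+ 2)%:E)) => //.
  - move=> n; apply/measurable_EFinP; apply: measurable_funX.
    by apply: measurable_funB => //; exact: measurable_funTS.
  - move=> x Rx; apply: cvg_EFin; first exact: nearW.
    have hc : h n x @[n --> \oo] --> phi x.
      by have /fine_cvg := cvg_nnsfun_approx mRp mf f0 Rx.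
    have c1 : phi x - h n x @[n --> \oo] --> 0.
      by rewrite -(subrr (phi x)); apply: cvgB => //; exact: cvg_cst.
    have c2 : (phi x - h n x) * (phi x - h n x) @[n --> \oo] --> 0.
      by rewrite -[X in _ --> X](mulr0 0); exact: cvgM.
    by apply: cvg_trans c2; apply: near_eq_cvg; apply: nearW => n /=; rewrite expr2.
  - move=> n x Rx; rewrite abse_EFin lee_fin ger0_norm ?sqr_ge0//.
    have hx : h n x <= phi x by rewrite -lee_fin nnsfun_approxE; exact: le_approx.
    have hx0 : 0 <= h n x by [].
    by rewrite lerXn2r ?nnegrE ?subr_ge0 ?gerBl// (le_trans hx0).
move: C; rewrite integral0 => /fine_cvgP[fin /cvgr0_norm_le /(_ _ e0) le].
near \oo => n.
have [l ml hl] := nnsfun_stepfun (h n).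
exists l => //; under eq_integral do rewrite -hl.
have fn : (\int[m]_(x in Rp) ((phi x - h n x) ^+ 2)%:E)%E \is a fin_num by near: n.
rewrite -(fineK fn) lee_fin; apply: le_trans (ler_norm _) _.
by near: n.
Unshelve. all: by end_near. Qed.

End step_functions.

(** * Step operators, existence of phi(L) f and composition *)

Section spectral_calculus.
Context {d : measure_display} {T : measurableType d} {R : realType}.
Variables (eta : {measure set T -> \bar R}) (Omega : set T).
Hypothesis mO : measurable Omega.
Variable E : set R -> (T -> R[i]) -> (T -> R[i]).
Hypothesis hE : resolution_of_identity eta Omega E.
Local Notation Rp := (`[0%R, +oo[%classic : set R).
Hypothesis hE0 : forall f, L2 eta Omega f -> E Rp f = f %[ae eta in Omega].
Local Notation L2 := (L2 eta Omega).
Local Notation rin := (rinner eta Omega).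
Local Notation sm := (spectral_re eta Omega E).
Local Notation pair_of := (spectral_pair eta Omega E).
Local Notation graph := (calculus_graph eta Omega E).
Local Notation dom := (calculus_dom eta Omega E).
Implicit Types (f g h : T -> R[i]) (A B : set R) (phi psi : R -> R).
Implicit Types (l : seq (R * set R)).

Definition stepop l f : T -> R[i] := fun x => \sum_(p <- l) (p.1)%:C * E p.2 f x.

Lemma stepop_cons p l f : stepop (p :: l) f = fun x => (p.1)%:C * E p.2 f x + stepop l f x.
Proof. by apply/funext => x; rewrite /stepop big_cons. Qed.

Lemma stepop_nil f : stepop [::] f = fun=> 0.
Proof. by apply/funext => x; rewrite /stepop big_nil. Qed.

Lemma stepop_L2 l f : meas_steps l -> L2 f -> L2 (stepop l f).
Proof.
elim: l => [_ _|p l IH [mp /IH il] Lf]; first by rewrite stepop_nil; exact: L2_0.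
rewrite stepop_cons; apply: L2_lin => //; last exact: il.
exact: E_L2.
Qed.

Lemma rin_stepop l f g : meas_steps l -> L2 f -> L2 g ->
  rin (stepop l f) g = \sum_(p <- l) p.1 * sm f g p.2.
Proof.
move=> + Lf Lg; elim: l => [_|p l IH [mp ml]].
  by rewrite stepop_nil big_nil rinner0l.
rewrite stepop_cons rinner_linl// ?big_cons ?IH//; first exact: (E_L2 hE).
exact: stepop_L2.
Qed.

Lemma Rintegral_indicRp (m : {finite_measure set R -> \bar R}) A : measurable A ->
  \int[m]_(x in Rp) \1_A x = fine (m (A `&` Rp)).
Proof. by move=> mA; rewrite /Rintegral integral_indic//; exact: mRp. Qed.

Lemma cst1_integrable (m : {finite_measure set R -> \bar R}) :
  m.-integrable Rp (EFin \o cst 1).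
Proof. by apply: finite_measure_integrable_cst; exact: mRp. Qed.

Lemma stepfun_integrable (m : {finite_measure set R -> \bar R}) l :
  meas_steps l -> m.-integrable Rp (EFin \o stepfun l).
Proof.
move=> ml; have := integrable_mul_step ml (cst1_integrable m).
by apply: eq_integrable; [exact: mRp|move=> x _ /=; rewrite mul1r].
Qed.

Lemma Rintegral_stepfun (m : {finite_measure set R -> \bar R}) l : meas_steps l ->
  \int[m]_(x in Rp) stepfun l x = \sum_(p <- l) p.1 * fine (m (p.2 `&` Rp)).
Proof.
move=> ml; transitivity (\int[m]_(x in Rp) (cst 1 x * stepfun l x)).
  by apply: eq_Rintegral => x _; rewrite mul1r.
rewrite Rintegral_mul_step//; last exact: cst1_integrable.
elim: l ml => [_|p l IH [mp ml]]; first by rewrite !big_nil.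
rewrite !big_cons IH//; congr (_ * _ + _); rewrite -Rintegral_indicRp//.
by apply: eq_Rintegral => x _; rewrite mul1r.
Qed.

Lemma rin_stepop_pair l f g m1 m2 : meas_steps l -> L2 f -> L2 g ->
  pair_of f g m1 m2 ->
  rin (stepop l f) g = \int[m1]_(x in Rp) stepfun l x - \int[m2]_(x in Rp) stepfun l x.
Proof.
move=> ml Lf Lg [sp _ _]; rewrite rin_stepop// !Rintegral_stepfun//.
elim: l ml => [_|p l IH [mp ml]]; first by rewrite !big_nil subrr.
rewrite !big_cons IH//.
have mpR : measurable (p.2 `&` Rp) by apply: measurableI => //; exact: mRp.
have := sp _ mpR; rewrite (sm_Rp mO hE hE0)//.
rewrite -(fineK (fin_num_measure m1 _ mpR)) -(fineK (fin_num_measure m2 _ mpR)).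
rewrite -EFinB => -[->] /=; ring.
Qed.

(** The isometry of the functional calculus on step functions. The two factors are expanded one
    after the other, and the products of projections collapse to intersections. *)
Lemma rin_stepop_sqr l f (mf : {finite_measure set R -> \bar R}) :
  (forall A, measurable A -> mf A = (sm f f A)%:E) -> meas_steps l -> L2 f ->
  rin (stepop l f) (stepop l f) = \int[mf]_(x in Rp) (stepfun l x ^+ 2).
Proof.
move=> mfE ml Lf.
transitivity (\int[mf]_(x in Rp) (stepfun l x * stepfun l x)); last first.
  by apply: eq_Rintegral => x _; rewrite expr2.
rewrite rin_stepop//; last exact: stepop_L2.
rewrite Rintegral_mul_step//; last exact: stepfun_integrable.
have H A : measurable A ->
    sm f (stepop l f) A = \int[mf]_(x in Rp) (stepfun l x * \1_A x).
  move=> mA; rewrite (smC hE)//; last exact: stepop_L2.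
  rewrite /spectral_re (E_sym hE)//; last exact: stepop_L2.
  rewrite rin_stepop//; last exact: (E_L2 hE).
  transitivity (\int[mf]_(x in Rp) (\1_A x * stepfun l x)); last first.
    by apply: eq_Rintegral => x _; rewrite mulrC.
  rewrite Rintegral_mul_step//; last first.
    have := integrable_mul_indic mA (cst1_integrable mf).
    by apply: eq_integrable; [exact: mRp|move=> x _ /=; rewrite mul1r].
  elim: l ml => [_|p l' IH [mp ml]]; first by rewrite !big_nil.
  rewrite !big_cons IH//; congr (_ * _ + _).
  rewrite /spectral_re (rin_EE mO hE)//.
  transitivity (\int[mf]_(x in Rp) \1_(p.2 `&` A) x); last first.
    by apply: eq_Rintegral => x _; rewrite indicI/= mulrC.
  have mpA : measurable (p.2 `&` A) by exact: measurableI.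
  rewrite Rintegral_indicRp// mfE//=; last by apply: measurableI => //; exact: mRp.
  by rewrite (sm_Rp mO hE hE0).
(* The list summed over is separated from the one inside the integrand, which the induction has to
   keep fixed. *)
suff HS l' : meas_steps l' -> \sum_(p <- l') p.1 * sm f (stepop l f) p.2 =
    \sum_(p <- l') p.1 * \int[mf]_(x in Rp) (stepfun l x * \1_(p.2) x) by exact: HS.
elim: l' => [_|p l' IH [mp ml']]; first by rewrite !big_nil.
by rewrite !big_cons IH// H.
Qed.

(** Step functions approach phi in L2(E_{f,f}) with squared error 16^(-n). By the isometry the
    increments of the step operators on f satisfy the hypothesis of [L2_complete], and their sum is
    h. Its pairing with g is identified by letting the integrals of the step functions converge for
    both members of a spectral pair. *)
Lemma calculus_ex phi f : measurable_fun Rp phi -> (forall x, 0 <= x -> 0 <= phi x) ->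
  dom phi f -> exists h, graph phi f h.
Proof.
move=> mphi phi0 df; have Lf : L2 f by case: df.
have [mf mfE] := spectral_measure_ex mO hE Lf.
have [_ iphi] := proj1 (calculus_domE phi mfE) df.
have H n : exists l, meas_steps l /\
    (\int[mf]_(x in Rp) ((phi x - stepfun l x) ^+ 2)%:E <= ((16^-1) ^+ n)%:E)%E.
  have q0 : 0 < (16^-1 : R) ^+ n by rewrite exprn_gt0// invr_gt0.
  by have [l ml hl] := stepfun_approx mphi phi0 iphi q0; exists l.
have [ls /all_and2[mls hls]] := choice H.
(* The increments of the approximating sequence, so that its limit becomes the sum of a series. *)
pose dl n := if n is k.+1 then ls k.+1 ++ negsteps (ls k) else ls 0%N.
have mdl n : meas_steps (dl n).
  by case: n => [|n] //=; apply: meas_steps_cat => //; exact: meas_negsteps.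
pose I := fine (\int[mf]_(x in Rp) (phi x ^+ 2)%:E)%E.
have I0 : 0 <= I by apply: fine_ge0; apply: integral_ge0 => x _; rewrite lee_fin sqr_ge0.
have iphiE : (\int[mf]_(x in Rp) (phi x ^+ 2)%:E)%E = I%:E.
  rewrite fineK// ge0_fin_numE//; apply: integral_ge0 => x _; rewrite lee_fin sqr_ge0//.
have m2 (F : R -> R) : measurable_fun Rp F -> measurable_fun Rp (fun x => (F x ^+ 2)%:E).
  by move=> mF; apply/measurable_EFinP; exact: measurable_funX.
have mB l : meas_steps l -> measurable_fun Rp (fun x => phi x - stepfun l x).
  by move=> ml; apply: measurable_funB => //; exact: stepfun_measurable.
have sq2 (F G H' : R -> R) (a b : R) : measurable_fun Rp F -> measurable_fun Rp G ->
    measurable_fun Rp H' -> (forall x, H' x = F x - G x \/ H' x = F x + G x) ->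
    (\int[mf]_(x in Rp) (F x ^+ 2)%:E <= a%:E)%E ->
    (\int[mf]_(x in Rp) (G x ^+ 2)%:E <= b%:E)%E ->
    (\int[mf]_(x in Rp) (H' x ^+ 2)%:E <= (2 * a + 2 * b)%:E)%E.
  move=> mF mG mH HFG Fa Gb.
  apply: (@le_trans _ _ (\int[mf]_(x in Rp) (2%:E * (F x ^+ 2)%:E + 2%:E * (G x ^+ 2)%:E))%E).
    apply: ge0_le_integral => //.
    - by move=> x _; rewrite lee_fin sqr_ge0.
    - exact: m2.
    - by apply: emeasurable_funD; apply: measurable_funeM; exact: m2.
    - move=> x _; rewrite -!EFinM -EFinD lee_fin.
      have := sqr_ge0 (F x + G x); have := sqr_ge0 (F x - G x).
      by case: (HFG x) => ->; rewrite !expr2; nra.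
  rewrite ge0_integralD//; try exact: mRp.
  - rewrite !ge0_integralZl//; try exact: mRp; try exact: m2.
    + have -> : (2 * a + 2 * b)%:E = (2%:E * a%:E + 2%:E * b%:E)%E by [].
      by apply: leeD; apply: lee_wpmul2l.
    + by move=> x _; rewrite lee_fin sqr_ge0.
    + by move=> x _; rewrite lee_fin sqr_ge0.
  - by move=> x _; rewrite -EFinM lee_fin mulr_ge0 ?sqr_ge0.
  - by apply: measurable_funeM; exact: m2.
  - by move=> x _; rewrite -EFinM lee_fin mulr_ge0 ?sqr_ge0.
  - by apply: measurable_funeM; exact: m2.
(* For n >= 1 the two consecutive errors contribute 2 * 16 + 2 = 34 times 16^(-n); the first term
   contributes 2 I + 2. *)
have bound n : rin (stepop (dl n) f) (stepop (dl n) f) <= (2 * I + 34) * (16^-1) ^+ n.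
  rewrite (rin_stepop_sqr mfE)// /Rintegral.
  set J := (X in fine X <= _).
  suff J_le : (J <= ((2 * I + 34) * 16^-1 ^+ n)%:E)%E.
    have Jf : J \is a fin_num.
      rewrite ge0_fin_numE; first exact: le_lt_trans J_le (ltry _).
      by apply: integral_ge0 => x _; rewrite lee_fin sqr_ge0.
    by rewrite -lee_fin fineK.
  rewrite /J; case: n {J} => [|n] /=.
    have h0 := hls 0%N; rewrite expr0 in h0.
    apply: (le_trans (sq2 phi _ _ _ _ mphi (mB _ (mls 0%N)) _ _ _ h0)).
    - exact: (stepfun_measurable (mls 0%N)).
    - by move=> x; left; ring.
    - by rewrite iphiE; exact: lexx.
    - by rewrite lee_fin expr0 mulr1; lra.
  apply: (le_trans (sq2 _ _ _ _ _ (mB _ (mls n)) (mB _ (mls n.+1)) _ _ (hls n) (hls n.+1))).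
  - exact: (stepfun_measurable (mdl n.+1)).
  - by move=> x; left; rewrite stepfun_cat stepfun_neg; ring.
  - rewrite lee_fin exprS; set q := _ ^+ n.
    have q0 : 0 <= q by rewrite exprn_ge0.
    have := mulr_ge0 I0 q0; lra.
have [h Lh hc] := L2_complete mO (fun n => stepop_L2 (mdl n) Lf) bound.
exists h; apply/(calculus_graphP eta mO); split => // g Lg.
have [m1 [m2' sp]] := spectral_pair_ex mO hE Lf Lg.
rewrite (spectral_pair_signed mO hE Lg sp)//.
have tele n : \sum_(0 <= k < n.+1) rin (stepop (dl k) f) g = rin (stepop (ls n) f) g.
  elim: n => [|n IH]; first by rewrite big_nat1.
  rewrite big_nat_recr//= IH !(rin_stepop _ Lf Lg)//; last first.
    by apply: meas_steps_cat => //; exact: meas_negsteps.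
  rewrite big_cat/= addrCA [X in _ + X](_ : _ = 0) ?addr0//.
  by elim: (ls n) => [|p l IHl]; rewrite /= ?big_nil ?addr0// !big_cons/=; lra.
have [mg mgE] := spectral_measure_ex mO hE Lg.
have [i1 i2] := spectral_pair_integrable mO hE Lg sp mphi df.
pose G := fine (mg setT).
have lim (m : {finite_measure set R -> \bar R}) : m.-integrable Rp (EFin \o phi) ->
    (forall psi, measurable_fun Rp psi -> (2%:E * \int[m]_(x in Rp) `|psi x|%:E <=
     \int[mf]_(x in Rp) (psi x ^+ 2)%:E + mg setT)%E) ->
    \int[m]_(x in Rp) stepfun (ls n) x @[n --> \oo] --> \int[m]_(x in Rp) phi x.
  move=> im bm.
  have key n : `|\int[m]_(x in Rp) phi x - \int[m]_(x in Rp) stepfun (ls n) x| <=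
      (1 + G) * (4^-1) ^+ n.
    have is_ := stepfun_integrable m (mls n).
    have iB : m.-integrable Rp (EFin \o (fun x => phi x - stepfun (ls n) x)).
      exact: (integrableB mRp im is_).
    rewrite -RintegralB//.
    apply: le_trans (le_normr_Rintegral mRp iB) _.
    (* Scaling the error by 4^n keeps its squared norm below 1, while the left side gains the factor
       4^n; hence the rate 4^(-n). *)
    have := bm (fun x => 4 ^+ n * (phi x - stepfun (ls n) x)).
    have mpsi := mB _ (mls n).
    move=> /(_ (measurable_funM (measurable_cst _) mpsi)).
    have -> : (\int[m]_(x in Rp) `|4 ^+ n * (phi x - stepfun (ls n) x)|%:E =
        (4 ^+ n)%:E * \int[m]_(x in Rp) `|phi x - stepfun (ls n) x|%:E)%E.
      rewrite -ge0_integralZl//; try exact: mRp.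
      - by apply: eq_integral => x _; rewrite normrM ger0_norm ?exprn_ge0// EFinM.
      - by apply/measurable_EFinP; apply: measurableT_comp.
    have -> : (\int[mf]_(x in Rp) ((4 ^+ n * (phi x - stepfun (ls n) x)) ^+ 2)%:E =
        (16 ^+ n)%:E * \int[mf]_(x in Rp) ((phi x - stepfun (ls n) x) ^+ 2)%:E)%E.
      rewrite -ge0_integralZl//; try exact: mRp.
      - apply: eq_integral => x _; rewrite exprMn -exprM mulnC exprM EFinM.
        by rewrite (_ : 4 ^+ 2 = 16 :> R)//; ring.
      - exact: m2.
      - by move=> x _; rewrite lee_fin sqr_ge0.
    have iN := integrable_fin_num mRp (integrable_norm iB).
    have IE : (\int[m]_(x in Rp) `|phi x - stepfun (ls n) x|%:E)%E =
        (\int[m]_(x in Rp) `|phi x - stepfun (ls n) x|)%:E.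
      by rewrite /Rintegral fineK.
    rewrite IE; set J := \int[m]_(x in Rp) _ => b2.
    have b1 : ((16 ^+ n)%:E *
        \int[mf]_(x in Rp) ((phi x - stepfun (ls n) x) ^+ 2)%:E <= 1%:E)%E.
      apply: (@le_trans _ _ ((16 ^+ n)%:E * ((16^-1) ^+ n)%:E)%E).
        by rewrite lee_wpmul2l// lee_fin exprn_ge0.
      by rewrite -EFinM lee_fin -exprMn divff ?expr1n.
    have {b2} := le_trans b2 (leeD2r (mg setT) b1).
    rewrite -(fineK (fin_num_measure mg setT measurableT)) -/G -!EFinM -EFinD lee_fin => b2.
    have p0 : 0 < 4 ^+ n :> R by rewrite exprn_gt0.
    have J0 : 0 <= J by apply: Rintegral_ge0 => x _.
    rewrite exprVn ler_pdivlMr//; set p := 4 ^+ n in p0 b2 *.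
    have := mulr_ge0 (ltW p0) J0; lra.
  have c0 : (1 + G) * (4^-1) ^+ n @[n --> \oo] --> (0 : R).
    rewrite -(mulr0 (1 + G)); apply: cvgM; first exact: cvg_cst.
    by apply: cvg_expr; rewrite ger0_norm; lra.
  apply/cvgrPdist_le => e e0; move/cvgr0_norm_le : c0 => /(_ _ e0).
  by apply: filterS => n hn; apply: le_trans (key n) _; apply: le_trans (ler_norm _) _.
have L1 := lim m1 i1 (fun psi mpsi => (spectral_pair_bound mfE mgE sp mpsi).1).
have L2' := lim m2' i2 (fun psi mpsi => (spectral_pair_bound mfE mgE sp mpsi).2).
(* The sum of the first n + 1 increments is the n-th step operator, hence the shift. *)
have {}hc := hc g Lg; move: hc; rewrite -(cvg_shiftS _) => hc.
apply: (cvg_unique _ hc) => //.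
apply: cvg_trans (cvgB L1 L2'); apply: near_eq_cvg; apply: nearW => n /=.
by rewrite tele (rin_stepop_pair (mls n) Lf Lg sp).
Qed.

Lemma bounded_dom phi f (M : R) : measurable_fun Rp phi -> L2 f ->
  (forall x, 0 <= x -> `|phi x| <= M) -> dom phi f.
Proof.
move=> mphi Lf bphi; have [mf mfE] := spectral_measure_ex mO hE Lf.
apply/(calculus_domE phi mfE); split => //.
apply: (@le_lt_trans _ _ (\int[mf]_(x in Rp) (M ^+ 2)%:E)%E).
  apply: ge0_le_integral => //.
  - by move=> x _; rewrite lee_fin sqr_ge0.
  - by apply/measurable_EFinP; exact: measurable_funX.
  - move=> x; rewrite /= in_itv/= andbT => x0.
    rewrite lee_fin -(real_normK (num_real (phi x))).
    have := bphi _ x0 => h; rewrite lerXn2r ?nnegrE//.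
    exact: le_trans (normr_ge0 _) h.
rewrite integral_cst; last exact: mRp.
by rewrite lte_mul_pinfty// ?lee_fin ?sqr_ge0// -ge0_fin_numE// fin_num_measure//; exact: mRp.
Qed.

(** Moving E A to the other side, E_{h,g}(A) is the pairing of phi(L) f with E A g, and E_{f, E A g}
    is the restriction of E_{f,g} to A, obtained from a1 and a2 with the indicator of A as density.
    So E_{h,g} has density phi with respect to E_{f,g}. *)
Lemma calculus_sm phi f h g (a1 a2 : {finite_measure set R -> \bar R}) A :
  graph phi f h -> L2 g -> measurable A ->
  (forall B, measurable B -> (sm f g B)%:E = (a1 B - a2 B)%E) ->
  measurable_fun Rp phi -> (forall x, 0 <= x -> 0 <= phi x) ->
  a1.-integrable Rp (EFin \o phi) -> a2.-integrable Rp (EFin \o phi) ->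
  (sm h g A)%:E = (\int[a1]_(x in Rp) (phi x * \1_A x)%:E -
                   \int[a2]_(x in Rp) (phi x * \1_A x)%:E)%E.
Proof.
move=> /(calculus_graphP eta mO)[df Lh hh] Lg mA aE mphi phi0 i1 i2.
have Lf : L2 f by case: df.
have phi0' x : Rp x -> 0 <= phi x by rewrite /= in_itv/= andbT; exact: phi0.
have ind0 (x : R) : Rp x -> 0 <= \1_A x :> R by [].
have iA (a : {finite_measure set R -> \bar R}) : a.-integrable Rp (EFin \o \1_A).
  have := integrable_mul_indic mA (cst1_integrable a).
  by apply: eq_integrable; [exact: mRp|move=> x _ /=; rewrite mul1r].
have [b1 b1E] := density_ex mRp ind0 (iA a1).
have [b2 b2E] := density_ex mRp ind0 (iA a2).
have bE (a b : {finite_measure set R -> \bar R}) (H : forall B, measurable B ->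
     b B = (\int[a]_(x in Rp) (\1_A x * \1_B x)%:E)%E) B : measurable B ->
    b B = a (A `&` B `&` Rp).
  move=> mB; rewrite H// (eq_integral (fun x => (\1_(A `&` B) x)%:E)).
    by rewrite integral_indic//; exact: measurableI.
  by move=> x _; rewrite indicI.
have ib (a b : {finite_measure set R -> \bar R}) : (forall B, measurable B ->
     b B = (\int[a]_(x in Rp) (\1_A x * \1_B x)%:E)%E) ->
     a.-integrable Rp (EFin \o phi) ->
     b.-integrable Rp (EFin \o phi) /\
     (\int[b]_(x in Rp) (phi x)%:E = \int[a]_(x in Rp) (phi x * \1_A x)%:E)%E.
  move=> H ia; have e := integral_density mRp ind0 (iA a) H mphi phi0'.
  split => //; apply/integrableP; split; first exact/measurable_EFinP.
  rewrite (eq_integral (fun x => (phi x)%:E)); last first.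
    by move=> x; rewrite inE => Rx; rewrite gee0_abs// lee_fin phi0'.
  rewrite e -ge0_fin_numE; last by apply: integral_ge0 => x Rx; rewrite lee_fin mulr_ge0 ?phi0'.
  by apply: integrable_fin_num; [exact: mRp|exact: integrable_mul_indic].
have [ib1 e1] := ib a1 b1 b1E i1; have [ib2 e2] := ib a2 b2 b2E i2.
rewrite /spectral_re (E_sym hE)// hh; last exact: (E_L2 hE).
rewrite (@signed_integralE _ _ _ _ b1 b2)//.
- rewrite EFinB /Rintegral !fineK ?e1 ?e2//.
    by apply: integrable_fin_num; [exact: mRp|exact: integrable_mul_indic].
  by apply: integrable_fin_num; [exact: mRp|exact: integrable_mul_indic].
- by apply: (sm_sigma_additive mO hE) => //; exact: (E_L2 hE).
- move=> B mB; rewrite (bE _ _ b1E)// (bE _ _ b2E)//.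
  rewrite /spectral_re (rin_EE mO hE)// -aE; last first.
    by apply: measurableI; [exact: measurableI|exact: mRp].
  rewrite (sm_Rp mO hE hE0)//; last exact: measurableI.
  by rewrite setIC.
Qed.

(** Applied twice, [calculus_sm] shows that E_{f,h} has density phi and E_{h,h} density phi^2 with
    respect to E_{f,f}; hence h is in the domain of psi(L) because f is in that of (psi phi)(L). The
    density phi of E_{h,g} with respect to E_{f,g} then matches the integral of psi for the former
    with that of psi phi for the latter. *)
Lemma calculus_comp phi psi f h k : measurable_fun Rp phi -> measurable_fun Rp psi ->
  (forall x, 0 <= x -> 0 <= phi x) -> (forall x, 0 <= x -> 0 <= psi x) ->
  graph phi f h -> graph (fun x => psi x * phi x) f k -> graph psi h k.
Proof.
move=> mphi mpsi phi0 psi0 gh gk.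
have /(calculus_graphP eta mO)[df Lh hh] := gh; have /(calculus_graphP eta mO)[dk Lk hk] := gk.
have Lf : L2 f by case: df.
have phi0' x : Rp x -> 0 <= phi x by rewrite /= in_itv/= andbT; exact: phi0.
have psi0' x : Rp x -> 0 <= psi x by rewrite /= in_itv/= andbT; exact: psi0.
have mpp : measurable_fun Rp (fun x => psi x * phi x) by exact: measurable_funM.
have [mf mfE] := spectral_measure_ex mO hE Lf.
have [mh mhE] := spectral_measure_ex mO hE Lh.
have [_ iphi] := proj1 (calculus_domE phi mfE) df.
have [_ ipp] := proj1 (calculus_domE _ mfE) dk.
(* With all three measures equal, [integral_sqrt_measure_le] says that square integrable functions
   are integrable for a finite measure. *)
have ifphi : mf.-integrable Rp (EFin \o phi).
  apply/integrableP; split; first exact/measurable_EFinP.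
  have := @integral_sqrt_measure_le _ _ _ mf mf mf Rp phi mRp mphi.
  move=> b.
  have {}b : (2%:E * \int[mf]_(x in Rp) `|phi x|%:E <=
     \int[mf]_(x in Rp) (phi x ^+ 2)%:E + mf setT)%E.
    by apply: b => A mA; rewrite expr2.
  rewrite ltNge leye_eq; apply/negP => /eqP iy.
  move: b; rewrite (_ : (\int[mf]_(x in Rp) `|phi x|%:E)%E = +oo%E)// gt0_muley ?lte_fin//.
  rewrite leye_eq => /eqP b.
  have : (\int[mf]_(x in Rp) (phi x ^+ 2)%:E + mf setT < +oo)%E.
    by apply: lte_add_pinfty => //; rewrite -ge0_fin_numE// fin_num_measure.
  by rewrite b ltxx.
have [N NE] := density_ex mRp phi0' ifphi.
(* The zero measure, obtained as the density 0: [calculus_sm] expects a difference of two measures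
   even where one suffices. *)
have [Z ZE] : exists Z : {finite_measure set R -> \bar R}, forall A, measurable A -> Z A = 0%E.
  have [Z ZE] := density_ex (m := mf) (F := cst 0) mRp (fun _ _ => lexx _) (integrable0 mf Rp).
  exists Z => A mA; rewrite ZE//; apply: integral0_eq => x _; rewrite mul0r//.
have Zint (F : R -> R) : measurable_fun Rp F -> Z.-integrable Rp (EFin \o F).
  move=> mF; apply/integrableP; split; first exact/measurable_EFinP.
  rewrite (@eq_setfun_integral _ _ _ Z mzero); last by move=> A mA; rewrite ZE.
  by rewrite integral_measure_zero.
have Zint0 (F : R -> \bar R) : (\int[Z]_(x in Rp) F x = 0)%E.
  rewrite (@eq_setfun_integral _ _ _ Z mzero); last by move=> A mA; rewrite ZE.
  by rewrite integral_measure_zero.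
have smhf A : measurable A -> (sm f h A)%:E = (N A - Z A)%E.
  move=> mA; rewrite (smC hE)// (calculus_sm gh Lf mA _ mphi phi0 ifphi (Zint _ mphi)).
    by rewrite Zint0 NE// ZE.
  by move=> B mB; rewrite ZE// sube0 mfE.
have iNphi : N.-integrable Rp (EFin \o phi).
  apply/integrableP; split; first exact/measurable_EFinP.
  rewrite (eq_integral (fun x => (phi x)%:E)); last first.
    by move=> x; rewrite inE => Rx; rewrite gee0_abs// lee_fin phi0'.
  by rewrite (integral_density mRp phi0' ifphi NE)//; under eq_integral do rewrite -expr2.
have smhh A : measurable A -> mh A = (\int[mf]_(x in Rp) ((phi x ^+ 2) * \1_A x)%:E)%E.
  move=> mA; rewrite mhE// (calculus_sm gh Lh mA smhf mphi phi0 iNphi (Zint _ mphi)).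
  rewrite Zint0 sube0 (integral_density mRp phi0' ifphi NE (psi := fun x => phi x * \1_A x)).
  - by apply: eq_integral => x _; congr (_%:E); ring.
  - by apply: measurable_funM => //; exact: measurable_indic.
  - by move=> x Rx; rewrite mulr_ge0 ?phi0'.
have i2 : mf.-integrable Rp (EFin \o (fun x => phi x ^+ 2)).
  apply/integrableP; split; first by apply/measurable_EFinP; exact: measurable_funX.
  by under eq_integral do rewrite gee0_abs ?lee_fin ?sqr_ge0//.
have dpsi : dom psi h.
  apply/(calculus_domE psi mhE); split => //.
  rewrite (integral_density mRp (fun x _ => sqr_ge0 (phi x)) i2 smhh
    (psi := fun x => psi x ^+ 2)).
  - by move: ipp; under eq_integral do rewrite exprMn.
  - exact: measurable_funX.
  - by move=> x _; exact: sqr_ge0.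
apply/(calculus_graphP eta mO); split; [exact: dpsi|exact: Lk|move=> g Lg].
have [m1 [m2 sp]] := spectral_pair_ex mO hE Lf Lg; have [spE _ _] := sp.
have [i1 i2'] := spectral_pair_integrable mO hE Lg sp mphi df.
have [j1 j2] := spectral_pair_integrable mO hE Lg sp mpp dk.
have [M1 M1E] := density_ex mRp phi0' i1; have [M2 M2E] := density_ex mRp phi0' i2'.
rewrite (hk g Lg) (spectral_pair_signed mO hE Lg sp mpp dk).
have conv (m M : {finite_measure set R -> \bar R}) :
    (forall A, measurable A -> M A = (\int[m]_(x in Rp) (phi x * \1_A x)%:E)%E) ->
    m.-integrable Rp (EFin \o phi) -> m.-integrable Rp (EFin \o (fun x => psi x * phi x)) ->
    M.-integrable Rp (EFin \o psi) /\
    \int[M]_(x in Rp) psi x = \int[m]_(x in Rp) (psi x * phi x).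
  move=> ME im ip; have e := integral_density mRp phi0' im ME mpsi psi0'.
  split; last by rewrite /Rintegral e.
  apply/integrableP; split; first exact/measurable_EFinP.
  rewrite (eq_integral (fun x => (psi x)%:E)); last first.
    by move=> x; rewrite inE => Rx; rewrite gee0_abs// lee_fin psi0'.
  rewrite e -ge0_fin_numE; last by apply: integral_ge0 => x Rx; rewrite lee_fin mulr_ge0 ?phi0' ?psi0'.
  by apply: integrable_fin_num; [exact: mRp|].
have [k1 e1] := conv m1 M1 M1E i1 j1; have [k2 e2] := conv m2 M2 M2E i2' j2.
rewrite -e1 -e2; apply/esym; apply: signed_integralE => //.
- exact: (sm_sigma_additive mO hE).
- by move=> A mA; rewrite M1E// M2E// (calculus_sm gh Lg mA spE mphi phi0 i1 i2').
Qed.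

Lemma calculus_graph_indic A f : measurable A -> L2 f -> graph \1_A f (E A f).
Proof.
move=> mA Lf; have mi : measurable_fun Rp (\1_A : R -> R) by exact: measurable_indic.
have df : dom \1_A f.
  apply: (@bounded_dom _ _ 1) => // x _; rewrite indicE.
  by case: (x \in A); rewrite ?normr1 ?normr0.
apply/(calculus_graphP eta mO); split => //; first exact: (E_L2 hE).
move=> g Lg; have [m1 [m2 sp]] := spectral_pair_ex mO hE Lf Lg.
rewrite (spectral_pair_signed mO hE Lg sp)// !Rintegral_indicRp//.
have mAR : measurable (A `&` Rp) by apply: measurableI => //; exact: mRp.
have [spE _ _] := sp; have := spE _ mAR; rewrite (sm_Rp mO hE hE0)//.
rewrite -(fineK (fin_num_measure m1 _ mAR)) -(fineK (fin_num_measure m2 _ mAR)).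
by rewrite -EFinB => -[].
Qed.

End spectral_calculus.

(** * Kernels of the extension problem *)

Section under_integral.
Context {R : realType}.
Variable m : {finite_measure set R -> \bar R}.
Local Notation Rp := (`[0%R, +oo[%classic : set R).
Local Notation hl := (`]0%R, +oo[%classic : set R).
Local Notation mu := (@lebesgue_measure R).

Lemma RpP x : Rp x = (0 <= x) :> Prop.
Proof. by rewrite /= in_itv/= andbT. Qed.

(** As m is finite, a bound uniform in l and in x > y / 2 is an integrable majorant near y. *)
Lemma is_derive_under_integral (F F' : R -> R -> R) (y M : R) : 0 < y ->
  (forall x : R, 0 < x -> m.-integrable Rp (EFin \o F x)) ->
  (forall x l : R, 0 < x -> 0 <= l -> is_derive x 1 (F ^~ l) (F' x l)) ->
  (forall x l : R, y / 2 < x -> 0 <= l -> `|F' x l| <= M) ->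
  is_derive y 1 (fun x => \int[m]_(l in Rp) F x l) (\int[m]_(l in Rp) F' y l).
Proof.
move=> y0 iF dF bF'.
have y2 : y / 2 < y by rewrite ltr_pdivrMr// mulr_natr mulr2n ltrDl.
have Iy : `]y / 2, y + 1[%classic y by rewrite /= in_itv/= y2 ltrDl ltr01.
have Ilt x : `]y / 2, y + 1[%classic x -> y / 2 < x by rewrite /= in_itv/= => /andP[].
have Ipos x : `]y / 2, y + 1[%classic x -> 0 < x.
  by move/Ilt; apply: lt_trans; rewrite divr_gt0.
have d1F x l : 0 < x -> 0 <= l -> partial1of2 F x l = F' x l.
  by move=> x0 l0; rewrite partial1of2E; have := dF x l x0 l0 => ?; exact: derive_val.
have H := @cvg_differentiation_under_integral R _ _ m F Rp mRp y (y / 2) (y + 1) Iy _ _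
  (fun=> `|M|).
have {}H : h^-1 *: (\int[m]_(l in Rp) F (h + y) l - \int[m]_(l in Rp) F y l)
    @[h --> 0^'] --> \int[m]_(l in Rp) F' y l.
  rewrite (_ : \int[m]_(l in Rp) F' y l = \int[m]_(l in Rp) partial1of2 F y l).
    apply: H.
    - by move=> x /Ipos; exact: iF.
    - move=> x l /Ipos x0; rewrite RpP => l0; have := dF x l x0 l0 => ?; exact: ex_derive.
    - by move=> l; exact: normr_ge0.
    - by apply: finite_measure_integrable_cst; exact: mRp.
    - move=> x l Ix; rewrite RpP => l0; rewrite d1F//; last exact: Ipos.
      by apply: le_trans (bF' _ _ (Ilt _ Ix) l0) _; exact: ler_norm.
  by apply: eq_Rintegral => l; rewrite inE RpP => l0; rewrite d1F.
apply: DeriveDef.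
  by apply/cvg_ex; eexists; under eq_fun do rewrite scaler1; exact: H.
by apply/cvg_lim => //; under eq_fun do rewrite scaler1; exact: H.
Qed.

(** Dominated convergence along every sequence of positive numbers tending to 0. *)
Lemma cvg_at_right0_under_integral (F : R -> R -> R) (F0 g : R -> R) :
  (forall y, 0 < y -> measurable_fun Rp (F y)) ->
  m.-integrable Rp (EFin \o g) ->
  (forall l, 0 <= l -> F y l @[y --> 0^'+] --> F0 l) ->
  (forall y l, 0 < y -> 0 <= l -> `|F y l| <= g l) ->
  \int[m]_(l in Rp) F y l @[y --> 0^'+] --> \int[m]_(l in Rp) F0 l.
Proof.
move=> mF ig cF bF; apply/cvg_at_rightP => v [v0 cv].
have cFv l : Rp l -> F (v n) l @[n --> \oo] --> F0 l.
  by rewrite RpP => l0; have /cvg_at_rightP := cF l l0; apply.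
have H1 n : measurable_fun Rp (fun l => (F (v n) l)%:E).
  by apply/measurable_EFinP; exact: mF.
have H2 : measurable_fun Rp (fun l => (F0 l)%:E).
  by apply/measurable_EFinP; apply: (measurable_fun_cvg (fun n => mF _ (v0 n))).
have H3 : {ae m, forall l, Rp l -> (F (v n) l)%:E @[n --> \oo] --> (F0 l)%:E}.
  by apply: aeW => l Rl; apply: cvg_EFin; [exact: nearW|exact: cFv].
have H4 : {ae m, forall l n, Rp l -> (`|(F (v n) l)%:E| <= (EFin \o g) l)%E}.
  by apply: aeW => l n; rewrite RpP => l0; rewrite abse_EFin lee_fin bF.
have [i0 _ C] := dominated_convergence mRp H1 H2 H3 ig H4.
by move: C; rewrite -(fineK (integrable_fin_num mRp i0)) => /fine_cvg.
Qed.

(** The double integrand is nonnegative and its t-integral is the known function H, so Tonelli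
    applies, and integrability of H makes the outer integral in t converge absolutely. *)
Lemma heat_tonelli (a b k H : R -> R) :
  measurable_fun hl a -> (forall t, 0 < t -> 0 <= a t) ->
  m.-integrable Rp (EFin \o b) -> (forall l, 0 <= l -> 0 <= b l) ->
  measurable_fun hl k -> (forall t, 0 < t -> 0 <= k t) ->
  m.-integrable Rp (EFin \o H) ->
  (forall l, 0 <= l ->
    (\int[mu]_(t in hl) (expR (- (a t * l)) * b l * k t)%:E = (H l)%:E)%E) ->
  mu.-integrable hl (EFin \o (fun t => (\int[m]_(l in Rp) (expR (- (a t * l)) * b l)) * k t)) /\
  \int[mu]_(t in hl) ((\int[m]_(l in Rp) (expR (- (a t * l)) * b l)) * k t) =
  \int[m]_(l in Rp) H l.
Proof.
move=> ma a0 ib b0 mk k0 iH HE.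
have mb : measurable_fun Rp b by apply/measurable_EFinP; exact: measurable_int ib.
(* Tonelli is used on the whole plane, whereas a, b and k are controlled on half-lines only; they
   are extended by 0. *)
have ma' : measurable_fun setT (a \_ hl).
  by apply/(measurable_restrictT a _) => //; exact: measurable_itv.
have mb' : measurable_fun setT (b \_ Rp).
  by apply/(measurable_restrictT b _) => //; exact: measurable_itv.
have mk' : measurable_fun setT (k \_ hl).
  by apply/(measurable_restrictT k _) => //; exact: measurable_itv.
have b'0 l : 0 <= (b \_ Rp) l.
  by rewrite patchE; case: ifPn => //; rewrite inE RpP => /b0.
have k'0 t : 0 <= (k \_ hl) t.
  by rewrite patchE; case: ifPn => //; rewrite inE hlP => /k0.
pose f (p : R * R) : \bar R :=
  (expR (- ((a \_ hl) p.1 * p.2)) * (b \_ Rp) p.2 * (k \_ hl) p.1)%:E.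
have f0 p : (0 <= f p)%E by rewrite lee_fin !mulr_ge0 ?expR_ge0.
have mf : measurable_fun [set: R * R] f.
  apply/measurable_EFinP; apply: measurable_funM; first apply: measurable_funM.
  - apply: measurableT_comp; first exact: measurable_expR.
    apply: measurable_funN.
    apply: measurable_funM; last exact: measurable_snd.
    exact: (measurableT_comp ma' measurable_fst).
  - exact: (measurableT_comp mb' measurable_snd).
  - exact: (measurableT_comp mk' measurable_fst).
have iI t : 0 < t -> m.-integrable Rp (EFin \o (fun l => expR (- (a t * l)) * b l)).
  move=> t0; apply: le_integrable ib => //.
    apply/measurable_EFinP; apply: measurable_funM => //.
    apply: measurableT_comp; first exact: measurable_expR.
    by apply: measurable_funN; exact: measurable_funM.
  move=> l; rewrite RpP => l0 /=; rewrite lee_fin normrM ler_piMl//.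
  by rewrite ger0_norm ?expR_ge0// expR_le1 oppr_le0 mulr_ge0 ?a0.
pose I t := \int[m]_(l in Rp) (expR (- (a t * l)) * b l).
have IE t : (\int[m]_l f (t, l) = (((fun t => I t * k t) \_ hl) t)%:E)%E.
  rewrite patchE; case: ifPn; last first.
    move=> nt; apply: integral0_eq => l _.
    by rewrite /f/= [(k \_ hl) t]patchE (negbTE nt) mulr0.
  rewrite inE => ht; have t0 : 0 < t by move: ht; rewrite hlP.
  rewrite mulrC EFinM /I /Rintegral fineK; last first.
    by apply: integrable_fin_num; [exact: mRp|exact: iI].
  rewrite -ge0_integralZl//; last 3 first.
  - exact: measurable_int (iI _ t0).
  - by move=> l; rewrite RpP => l0; rewrite lee_fin mulr_ge0 ?expR_ge0 ?b0.
  - by rewrite lee_fin k0.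
  rewrite [RHS]integral_mkcond; apply: eq_integral => l _.
  rewrite /f/= !patchE (mem_set ht); case: ifPn => Rl; last by rewrite mulr0 mul0r.
  by rewrite -EFinM; congr (_%:E); rewrite mulrC.
have HE' l : (\int[mu]_t f (t, l) = ((H \_ Rp) l)%:E)%E.
  rewrite patchE; case: ifPn; last first.
    move=> nl; apply: integral0_eq => t _.
    by rewrite /f/= [(b \_ Rp) l]patchE (negbTE nl) mulr0 mul0r.
  rewrite inE => Rl; have l0 : 0 <= l by move: Rl; rewrite RpP.
  rewrite -HE// [RHS]integral_mkcond; apply: eq_integral => t _.
  by rewrite /f/= !patchE (mem_set Rl); case: ifPn => // _; rewrite mulr0.
have FT := @fubini_tonelli _ _ _ _ R mu m f mf f0.
have mI : measurable_fun setT (fun t => \int[m]_l f (t, l))%E.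
  exact: (@measurable_fun_fubini_tonelli_F _ _ _ _ R m f).
have mIk : measurable_fun hl (fun t => I t * k t).
  apply/(measurable_restrictT _ _); first exact: measurable_itv.
  apply/measurable_EFinP; move: mI; apply: eq_measurable_fun => t _.
  by rewrite IE.
have I0 t : 0 < t -> 0 <= I t * k t.
  move=> t0; rewrite mulr_ge0 ?k0//; apply: Rintegral_ge0 => l; rewrite RpP => l0.
  by rewrite mulr_ge0 ?expR_ge0 ?b0.
have tot : (\int[mu]_(t in hl) (I t * k t)%:E = \int[m]_(l in Rp) (H l)%:E)%E.
  transitivity (\int[mu]_t (\int[m]_l f (t, l)))%E.
    rewrite integral_mkcond; apply: eq_integral => t _; rewrite IE !patchE.
    by case: ifPn.
  rewrite FT [RHS]integral_mkcond; apply: eq_integral => l _.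
  by rewrite HE' !patchE; case: ifPn.
split; last by rewrite /Rintegral tot.
apply/integrableP; split; first exact/measurable_EFinP.
apply: (@le_lt_trans _ _ (\int[mu]_(t in hl) (I t * k t)%:E)%E).
  rewrite le_eqVlt; apply/orP; left; apply/eqP; apply: eq_integral => t.
  by rewrite inE hlP => t0; rewrite abse_EFin ger0_norm ?I0.
rewrite tot; have /integrableP[_] := iH; apply: le_lt_trans.
apply: le_trans (le_abse_integral _ mRp _); first exact: lee_abs.
exact: measurable_int iH.
Qed.

End under_integral.

(** * The scalar kernels of u, its derivatives and L u *)

Section extension_kernels.
Context {R : realType}.
Local Notation Rp := (`[0%R, +oo[%classic : set R).
Variable s : R.
Hypotheses (s0 : 0 < s) (s1 : s < 1).
Implicit Types y l z : R.
Let G := Gamma s.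

Let G0 : 0 < G. Proof. exact: Gamma_gt0. Qed.
Let Gn0 : G != 0. Proof. by rewrite gt_eqF. Qed.
Let s1' : 0 < 1 - s. Proof. by rewrite subr_gt0. Qed.

Definition ext0 y l : R := bess s (y ^+ 2 / 4 * l) / G.
(** The kernel of - (y / 2) u_y, normalised so as to be nonnegative and bounded uniformly in y. *)
Definition ext1 y l : R :=
  (y ^+ 2 / 4 * l) `^ s * bess (1 - s) (y ^+ 2 / 4 * l) / G.
Definition ext2 y l : R := l * ext0 y l.

Definition ext_const := Gamma_opp s / (4 `^ s * Gamma s).

Lemma arg_ge0 y l : 0 <= l -> 0 <= y ^+ 2 / 4 * l.
Proof. by move=> l0; rewrite mulr_ge0// divr_ge0// sqr_ge0. Qed.

Lemma ext0_ge0 y l : 0 <= ext0 y l.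
Proof. by rewrite divr_ge0 ?bess_ge0// ltW. Qed.

Lemma ext0_le1 y l : `|ext0 y l| <= 1.
Proof. by rewrite ger0_norm ?ext0_ge0// ler_pdivrMr// mul1r bess_le_Gamma. Qed.

Lemma ext0_0 l : ext0 0 l = 1.
Proof. by rewrite /ext0 expr0n/= !mul0r bess0 divff. Qed.

Lemma ext1_ge0 y l : 0 <= ext1 y l.
Proof. by rewrite divr_ge0 ?mulr_ge0 ?powR_ge0 ?bess_ge0// ltW. Qed.

Definition ext1_bound := (Gamma (1 - s) + Gamma (2 - s)) / G.

(** For z <= 1 the power z^s is at most 1 and K_{1-s} is at most Gamma(1 - s); for z > 1, z^s <= z
    and z K_{1-s}(z) <= Gamma(2 - s). The bound adds both cases. *)
Lemma ext1_le y l : 0 <= l -> `|ext1 y l| <= ext1_bound.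
Proof.
move=> l0; rewrite ger0_norm ?ext1_ge0// ler_pM2r ?invr_gt0//.
set z := y ^+ 2 / 4 * l; have z0 : 0 <= z by exact: arg_ge0.
have g1 := Gamma_ge0 (1 - s); have g2 := Gamma_ge0 (2 - s).
have [z1|z1] := leP z 1.
  have zs : z `^ s <= 1.
    have p1 : 1 `^ s = 1 :> R by rewrite powR1.
    by rewrite -p1 ge0_ler_powR ?nnegrE// ltW.
  apply: (@le_trans _ _ (Gamma (1 - s))); last by rewrite lerDl.
  apply: le_trans (bess_le_Gamma z s1').
  by rewrite ler_piMl ?bess_ge0.
apply: (@le_trans _ _ (Gamma (2 - s))); last by rewrite lerDr.
have := mul_bess_le z s1'; rewrite (ger0_norm z0).
rewrite (_ : 1 - s + 1 = 2 - s); last by ring.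
apply: le_trans; rewrite ler_wpM2r ?bess_ge0// -{2}(powRr1 z0).
by rewrite ler_powR ?ltW.
Qed.

Lemma ext2_ge0 y l : 0 <= l -> 0 <= ext2 y l.
Proof. by move=> l0; rewrite mulr_ge0 ?ext0_ge0. Qed.

(** With z = y^2 l / 4 one has l = 4 z / y^2 and z K_s(z) <= Gamma(s + 1). Boundedness in l is what
    makes u(y) an element of the domain of L. *)
Lemma ext2_le y l : 0 < y -> 0 <= l ->
  `|ext2 y l| <= 4 / y ^+ 2 * Gamma (s + 1) / G.
Proof.
move=> y0 l0; rewrite ger0_norm ?ext2_ge0//.
have := mul_bess_le (y ^+ 2 / 4 * l) s0; rewrite (ger0_norm (arg_ge0 y l0)) => h.
have yn0 : y != 0 by rewrite gt_eqF.
rewrite (_ : ext2 y l = 4 / y ^+ 2 *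
   (y ^+ 2 / 4 * l * bess s (y ^+ 2 / 4 * l)) / G); last by rewrite /ext2 /ext0; field; rewrite Gn0 yn0.
by rewrite ler_wpM2r ?invr_ge0 ?(ltW G0)// ler_wpM2l// divr_ge0// sqr_ge0.
Qed.

Lemma bess_arg_measurable a c : 0 < a -> measurable_fun Rp (fun l => bess a (c * l)).
Proof.
move=> a0; apply: measurableT_comp; first exact: bess_measurable.
exact: measurable_funM.
Qed.

Lemma ext0_measurable y : measurable_fun Rp (ext0 y).
Proof. by apply: measurable_funM => //; exact: bess_arg_measurable. Qed.

Lemma ext1_measurable y : measurable_fun Rp (ext1 y).
Proof.
apply: measurable_funM => //; apply: measurable_funM; last exact: bess_arg_measurable.
apply: (measurableT_comp (f := fun x => x `^ s)); first exact: measurable_powR.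
exact: measurable_funM.
Qed.

Lemma ext2_measurable y : measurable_fun Rp (ext2 y).
Proof. by apply: measurable_funM => //; exact: ext0_measurable. Qed.

Let is_derive_arg y l : is_derive y 1 (fun y => y ^+ 2 / 4 * l) (y / 2 * l).
Proof.
apply: is_derive_eq; rewrite /GRing.scale/= !mulr0 !add0r !mulr1 ?scaler0.
by rewrite ?expr1 ?mulr2n; field.
Qed.

(** At l = 0 the kernel is constant in y. For l > 0 the inner derivative y l / 2 equals 2 z / y, and
    its factor z raises the z^(s - 1) of the derivative of K_s to z^s. *)
Lemma is_derive_ext0 y l : 0 < y -> 0 <= l ->
  is_derive y 1 (ext0 ^~ l) (- (2 / y) * ext1 y l).
Proof.
move=> y0; rewrite le_eqVlt => /predU1P[<-|l0].
  rewrite /ext1 mulr0 powR0 ?gt_eqF// !mul0r mulr0.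
  rewrite (_ : ext0^~ 0 = cst (bess s 0 / G)); first exact: is_derive_cst.
  by apply/funext => x; rewrite /ext0 mulr0.
have z0 : 0 < y ^+ 2 / 4 * l by rewrite mulr_gt0// divr_gt0// exprn_gt0.
have d1 := @is_derive1_comp R (bess s) (fun y => y ^+ 2 / 4 * l) y _ _
   (is_derive_bess s0 s1 z0) (is_derive_arg y l).
have d2 := is_deriveM d1 (is_derive_cst G^-1 y (1 : R)).
apply: (@is_derive_eq _ _ _ _ _ _ _ _ d2).
rewrite scaler0 add0r /ext1 /GRing.scale/= -(mulr_powRB1 (ltW z0) s0).
by field; rewrite Gn0 gt_eqF.
Qed.

(** The extension equation for fixed l: since u_y = - (2 / y) [ext1], the right side is l u - ((1 -
    2 s) / y) u_y. The derivative of K_{1-s} brings back K_s with the power z^(-s), which cancels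
    the z^s in [ext1]. *)
Lemma is_derive_ext1 y l : 0 < y -> 0 <= l ->
  is_derive y 1 (fun y => - (2 / y) * ext1 y l)
    ((2 - 4 * s) / y ^+ 2 * ext1 y l + ext2 y l).
Proof.
move=> y0; rewrite le_eqVlt => /predU1P[<-|l0].
  rewrite (_ : (fun y => _) = cst 0); last first.
    by apply/funext => x; rewrite /ext1 mulr0 powR0 ?gt_eqF// !mul0r mulr0.
  rewrite /ext2 /ext1 mulr0 powR0 ?gt_eqF// !mul0r mulr0 addr0.
  exact: is_derive_cst.
have yn0 : y != 0 by rewrite gt_eqF.
have z0 : 0 < y ^+ 2 / 4 * l by rewrite mulr_gt0// divr_gt0// exprn_gt0.
have t1 : 1 - s < 1 by rewrite ltrBlDr ltrDl.
have d1 := @is_derive1_comp R (bess (1 - s)) (fun y => y ^+ 2 / 4 * l) y _ _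
   (is_derive_bess s1' t1 z0) (is_derive_arg y l).
have d2 := @is_derive1_comp R (fun z => z `^ s) (fun y => y ^+ 2 / 4 * l) y _ _
   (is_derive1_powR s z0) (is_derive_arg y l).
have d3 := is_deriveM (is_deriveM d2 d1) (is_derive_cst G^-1 y (1 : R)).
have dV : is_derive y 1 (fun y : R => y^-1) (- y ^- 2 *: 1).
  exact: (is_deriveV yn0 (is_derive_id y 1)).
have d4 := is_deriveM (is_derive_cst (-2 : R) y (1 : R)) dV.
have d5 := is_deriveM d4 d3.
rewrite (_ : (fun y => _) = (cst (-2) * (fun y : R => y^-1)) *
   (((fun z => z `^ s) \o (fun y => y ^+ 2 / 4 * l)) *
    (bess (1 - s) \o (fun y => y ^+ 2 / 4 * l)) * cst G^-1)); last first.
  by apply/funext => x; rewrite /ext1 !fctE/=; ring.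
apply: (@is_derive_eq _ _ _ _ _ _ _ _ d5).
rewrite !scaler0 !addr0 /ext1 /ext2 /ext0 /GRing.scale/= !fctE/=.
set z := y ^+ 2 / 4 * l in z0 *.
have -> : 1 - s - 1 = - s by ring.
have -> : 1 - (1 - s) = s by ring.
rewrite powRN -(mulr_powRB1 (ltW z0) s0).
have p0 : z `^ (s - 1) != 0 by rewrite gt_eqF// powR_gt0.
have zn0 : z != 0 by rewrite gt_eqF.
(* With l eliminated, the power of z and the two Bessel values can be treated as independent atoms
   of a rational identity. *)
have lE : l = 4 * z / y ^+ 2 by rewrite /z; field.
rewrite {}lE; move: (z `^ (s - 1)) (bess (1 - s) z) (bess s z) p0 => p B1 B0 p0.
by field; rewrite Gn0 yn0 zn0 p0.
Qed.

Let cvg_arg l : y ^+ 2 / 4 * l @[y --> (0 : R)] --> (0 : R).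
Proof.
have /derivable1_diffP/differentiable_continuous : derivable (fun y => y ^+ 2 / 4 * l) (0 : R) 1.
  by have := is_derive_arg 0 l => ?; exact: ex_derive.
move=> c; have {c} : y ^+ 2 / 4 * l @[y --> (0 : R)] --> (0 : R) ^+ 2 / 4 * l := c.
by rewrite [in X in _ --> X -> _]expr0n/= !mul0r.
Qed.

Lemma cvg_bess_arg (a l : R) : 0 < a ->
  bess a (y ^+ 2 / 4 * l) @[y --> (0 : R)^'+] --> Gamma a.
Proof.
move=> a0; rewrite -bess0; apply: cvg_at_right_filter.
have /= := @bess_continuous R a a0 0; rewrite /continuous_at => c.
exact: (cvg_comp _ _ (cvg_arg l) c).
Qed.

Lemma cvg_ext0 l : ext0 y l @[y --> 0^'+] --> (1 : R).
Proof.
rewrite -(divff Gn0); apply: cvgM; last exact: cvg_cst.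
exact: cvg_bess_arg.
Qed.

Lemma powR_arg y l : 0 < y -> 0 <= l ->
  (y ^+ 2 / 4 * l) `^ s = y `^ (2 * s) * l `^ s / 4 `^ s.
Proof.
move=> y0 l0; rewrite (powRM s (x := y ^+ 2 / 4)) ?divr_ge0 ?sqr_ge0//.
rewrite (powRM s (x := y ^+ 2)) ?sqr_ge0 ?invr_ge0//.
rewrite powRrM (powR_mulrn 2 (ltW y0)) -(powR_inv1 (a := 4))// -powRrM mulN1r powRN.
by rewrite mulrAC.
Qed.

Lemma ext0_quotient y l : 0 < y -> 0 < l -> exists2 w, 0 < w < y ^+ 2 / 4 * l &
  (ext0 y l - 1) / y `^ (2 * s) = - (bess (1 - s) w / s) * (l `^ s / (4 `^ s * G)).
Proof.
move=> y0 l0; have z0 : 0 < y ^+ 2 / 4 * l by rewrite mulr_gt0// divr_gt0// exprn_gt0.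
have [w hw e] := bess_MVT s0 s1 z0; exists w => //; rewrite -e powR_arg// ?ltW//.
rewrite /ext0 -/G; field.
by rewrite Gn0 !gt_eqF// powR_gt0.
Qed.

Lemma ext0_quotient_le y l : 0 < y -> 0 <= l ->
  `|(ext0 y l - 1) / y `^ (2 * s)| <= Gamma (1 - s) / s / (4 `^ s * G) * l `^ s.
Proof.
move=> y0; rewrite le_eqVlt => /predU1P[<-|l0].
  rewrite /ext0 mulr0 bess0 divff// subrr mul0r normr0 powR0 ?gt_eqF//.
  by rewrite mulr0.
have [w _ ->] := ext0_quotient y0 l0.
have c0 : 0 <= l `^ s / (4 `^ s * G).
  by rewrite divr_ge0 ?mulr_ge0 ?powR_ge0// ltW.
rewrite normrM normrN (ger0_norm c0) ger0_norm ?divr_ge0 ?bess_ge0 ?(ltW s0)//.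
rewrite [leRHS](_ : _ = Gamma (1 - s) / s * (l `^ s / (4 `^ s * G))); last by ring.
have si : 0 <= s^-1 by rewrite invr_ge0 ltW.
exact: (ler_wpM2r c0 (ler_wpM2r si (bess_le_Gamma w s1'))).
Qed.

(** The mean value point w is known only to lie between 0 and y^2 l / 4 and is not given as a
    function of y; so continuity of K_{1-s} at 0 is used with explicit tolerances rather than by
    composing limits. *)
Lemma cvg_ext0_quotient l : 0 <= l ->
  (ext0 y l - 1) / y `^ (2 * s) @[y --> 0^'+] --> ext_const * l `^ s.
Proof.
rewrite le_eqVlt => /predU1P[<-|l0].
  rewrite powR0 ?gt_eqF// mulr0.
  rewrite (_ : (fun y => _) = cst 0); first exact: cvg_cst.
  by apply/funext => y; rewrite /ext0 mulr0 bess0 divff// subrr mul0r.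
have c0 : 0 < l `^ s / (4 `^ s * G).
  by rewrite divr_gt0 ?mulr_gt0 ?powR_gt0.
set c := l `^ s / (4 `^ s * G) in c0.
have -> : ext_const * l `^ s = - (Gamma (1 - s) / s) * c.
  rewrite /ext_const /Gamma_opp /c -/G; field.
  by rewrite Gn0 !gt_eqF ?powR_gt0.
apply/cvgrPdist_le => e e0.
have e' : 0 < e * s / c by apply: divr_gt0 => //; exact: mulr_gt0.
have /= := @bess_continuous R _ s1' 0; rewrite /continuous_at bess0.
move/cvgrPdist_le => /(_ _ e')[r /= r0 hr].
have := cvg_arg l; move/cvgr0_norm_lt => /(_ _ r0) hz.
near=> y.
have y0 : 0 < y by near: y; exact: nbhs_right_gt.
have [w /andP[w0 wz] ->] := ext0_quotient y0 l0.
have zr : `|y ^+ 2 / 4 * l| < r by near: y; apply: cvg_at_right_filter hz; exact: cvg_id.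
have : `|Gamma (1 - s) - bess (1 - s) w| <= e * s / c.
  apply: hr => /=; rewrite sub0r normrN (gtr0_norm w0); apply: lt_trans wz _.
  by apply: le_lt_trans zr; exact: ler_norm.
rewrite -/c => h.
rewrite (_ : _ - _ = - ((Gamma (1 - s) - bess (1 - s) w) * (c / s))); last by ring.
have cs : 0 < c / s by exact: divr_gt0.
rewrite normrN normrM [X in _ * X](gtr0_norm cs) -ler_pdivlMr//; apply: le_trans h _.
by rewrite le_eqVlt; apply/orP; left; apply/eqP; field; rewrite !gt_eqF.
Unshelve. all: by end_near. Qed.

(** The powers y^(1 - 2 s), 1 / y and y^(2 s) cancel, leaving y only in the argument of K_{1-s}. *)
Lemma ext1_flux y l : 0 < y -> 0 <= l ->
  y `^ (1 - 2 * s) * (- (2 / y) * ext1 y l) =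
  - (2 / (4 `^ s * G)) * l `^ s * bess (1 - s) (y ^+ 2 / 4 * l).
Proof.
move=> y0 l0; rewrite /ext1 powR_arg// gt0_powRB// powRr1 ?ltW//.
by field; rewrite Gn0 !gt_eqF// powR_gt0.
Qed.

Lemma ext1_flux_le y l : 0 < y -> 0 <= l ->
  `|y `^ (1 - 2 * s) * (- (2 / y) * ext1 y l)| <=
  2 / (4 `^ s * G) * Gamma (1 - s) * l `^ s.
Proof.
move=> y0 l0; rewrite ext1_flux//.
have c0 : 0 <= 2 / (4 `^ s * G) by rewrite divr_ge0 ?mulr_ge0 ?powR_ge0// ltW.
rewrite 2!normrM normrN (ger0_norm c0) !ger0_norm ?bess_ge0 ?powR_ge0//.
rewrite -mulrA [leRHS](_ : _ = 2 / (4 `^ s * G) * (l `^ s * Gamma (1 - s))); last by ring.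
exact: (ler_wpM2l c0 (ler_wpM2l (powR_ge0 _ _) (bess_le_Gamma _ s1'))).
Qed.

Lemma cvg_ext1_flux l : 0 <= l ->
  y `^ (1 - 2 * s) * (- (2 / y) * ext1 y l) @[y --> 0^'+] -->
  2 * s * ext_const * l `^ s.
Proof.
move=> l0.
have -> : 2 * s * ext_const * l `^ s = - (2 / (4 `^ s * G)) * l `^ s * Gamma (1 - s).
  rewrite /ext_const /Gamma_opp -/G; field.
  by rewrite Gn0 !gt_eqF ?powR_gt0.
have C : - (2 / (4 `^ s * G)) * l `^ s * bess (1 - s) (y ^+ 2 / 4 * l)
    @[y --> 0^'+] --> - (2 / (4 `^ s * G)) * l `^ s * Gamma (1 - s).
  by apply: cvgM; [exact: cvg_cst|exact: cvg_bess_arg].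
apply: cvg_trans C; apply: near_eq_cvg; near=> y.
by rewrite ext1_flux//; near: y; exact: nbhs_right_gt.
Unshelve. all: by end_near. Qed.

End extension_kernels.

(** * Weak limits, derivatives and integrals through spectral measures *)

Section spectral_representation.
Context {d : measure_display} {T : measurableType d} {R : realType}.
Variables (eta : {measure set T -> \bar R}) (Omega : set T).
Hypothesis mO : measurable Omega.
Variable E : set R -> (T -> R[i]) -> (T -> R[i]).
Hypothesis hE : resolution_of_identity eta Omega E.
Local Notation Rp := (`[0%R, +oo[%classic : set R).
Local Notation hl := (`]0%R, +oo[%classic : set R).
Local Notation mu := (@lebesgue_measure R).
Hypothesis hE0 : forall f, L2 eta Omega f -> E Rp f = f %[ae eta in Omega].
Local Notation L2 := (L2 eta Omega).
Local Notation rin := (rinner eta Omega).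
Local Notation pair_of := (spectral_pair eta Omega E).
Local Notation graph := (calculus_graph eta Omega E).
Local Notation dom := (calculus_dom eta Omega E).
Local Notation calc := (calculus eta Omega E).
Implicit Types (f g h v w : T -> R[i]) (phi psi : R -> R).

Lemma calculusP phi f : measurable_fun Rp phi -> (forall x, 0 <= x -> 0 <= phi x) ->
  dom phi f -> graph phi f (calc phi f).
Proof.
move=> mphi phi0 df; have := calculus_ex mO hE hE0 mphi phi0 df.
exact: (@xgetPex _ (fun=> 0) [set h | graph phi f h]).
Qed.

Lemma le_dom phi psi f : dom phi f -> measurable_fun Rp phi -> measurable_fun Rp psi ->
  (forall x, 0 <= x -> `|psi x| <= `|phi x|) -> dom psi f.
Proof.
move=> df mphi mpsi le; have [Lf _] := df.
have [mf mfE] := spectral_measure_ex mO hE Lf.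
move/(calculus_domE _ mfE) : df => [_ i]; apply/(calculus_domE _ mfE); split => //.
apply: le_lt_trans i; apply: ge0_le_integral => //.
- by move=> x _; rewrite lee_fin sqr_ge0.
- by apply/measurable_EFinP; exact: measurable_funX.
- by apply/measurable_EFinP; exact: measurable_funX.
- move=> x; rewrite RpP => x0; rewrite lee_fin -real_normK ?num_real//.
  by rewrite -[leRHS]real_normK ?num_real// lerXn2r ?nnegrE ?le.
Qed.

(* The part of [v = phi(L) f] that survives linear combinations with
   coefficients of arbitrary sign. *)
Definition represents f phi v := L2 v /\ forall g m1 m2, L2 g -> pair_of f g m1 m2 ->
  rin v g = \int[m1]_(x in Rp) phi x - \int[m2]_(x in Rp) phi x.

Lemma graph_represents phi f h : measurable_fun Rp phi -> graph phi f h ->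
  represents f phi h.
Proof.
move=> mphi gh; have [_ Lh _] := gh; split => // g m1 m2 Lg sp.
exact: (calculus_graph_pair mO hE Lg mphi sp gh).
Qed.

Lemma represents_lin (t : R) phi psi f v w :
  measurable_fun Rp phi -> dom phi f -> measurable_fun Rp psi -> dom psi f ->
  represents f phi v -> represents f psi w ->
  represents f (fun l => t * phi l + psi l) (fun x => t%:C * v x + w x).
Proof.
move=> mphi dphi mpsi dpsi [Lv Hv] [Lw Hw]; split; first exact: L2_lin.
move=> g m1 m2 Lg sp; rewrite rinner_linl// (Hv _ _ _ Lg sp) (Hw _ _ _ Lg sp).
have [i1 i2] := spectral_pair_integrable mO hE Lg sp mphi dphi.
have [j1 j2] := spectral_pair_integrable mO hE Lg sp mpsi dpsi.
have lin (m : {finite_measure set R -> \bar R}) :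
    m.-integrable Rp (EFin \o phi) -> m.-integrable Rp (EFin \o psi) ->
    \int[m]_(x in Rp) (t * phi x + psi x) =
    t * \int[m]_(x in Rp) phi x + \int[m]_(x in Rp) psi x.
  move=> i j; rewrite RintegralD//; last exact: (integrableZl _ t i).
  by rewrite RintegralZl.
by rewrite !lin//; ring.
Qed.

Lemma represents_Z (t : R) phi f v : measurable_fun Rp phi -> dom phi f ->
  represents f phi v -> represents f (fun l => t * phi l) (fun x => t%:C * v x).
Proof.
move=> mphi dphi [Lv Hv]; split; first exact: L2_Z.
move=> g m1 m2 Lg sp; rewrite rinner_Zl// (Hv _ _ _ Lg sp).
have [i1 i2] := spectral_pair_integrable mO hE Lg sp mphi dphi.
by rewrite !RintegralZl// mulrBr.
Qed.

Lemma represents1 f : L2 f -> represents f (cst 1) f.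
Proof.
move=> Lf; split => // g m1 m2 Lg sp; have [spE _ _] := sp.
rewrite -(sm_total mO hE hE0 Lf Lg); have := spE _ (@mRp R).
rewrite -(fineK (fin_num_measure m1 _ (@mRp R))) -(fineK (fin_num_measure m2 _ (@mRp R))).
rewrite -EFinB => -[->].
by rewrite !Rintegral_cst ?mul1r.
Qed.

Lemma eq_represents phi psi f v : (forall x, 0 <= x -> phi x = psi x) ->
  represents f phi v -> represents f psi v.
Proof.
move=> e [Lv Hv]; split => // g m1 m2 Lg sp; rewrite (Hv _ _ _ Lg sp).
by congr (_ - _); apply: eq_Rintegral => x; rewrite inE RpP => /e.
Qed.

Lemma represents_ae phi f v w : L2 w -> v = w %[ae eta in Omega] ->
  represents f phi v -> represents f phi w.
Proof.
move=> Lw vw [Lv Hv]; split => // g m1 m2 Lg sp.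
by rewrite -(Hv _ _ _ Lg sp); apply/esym; exact: rinner_ael.
Qed.

Lemma weak_limit0_rinner (v : R -> T -> R[i]) h : L2 h ->
  (forall g, L2 g -> rin (v y) g @[y --> (0 : R)^'+] --> rin h g) ->
  weak_limit0 eta Omega v h.
Proof.
move=> Lh H; split => // g Lg.
rewrite (_ : (fun y => complex.Re _) = fun y => rin (v y) g); last first.
  by apply/funext => y; rewrite Re_inner.
rewrite (_ : (fun y => complex.Im _) = fun y => rin (v y) (mulI g)); last first.
  by apply/funext => y; rewrite Im_inner.
by rewrite Re_inner Im_inner; split; apply: H => //; exact: L2_mulI.
Qed.

Lemma weak_derivative_rinner (v : R -> T -> R[i]) (y : R) h : L2 h ->
  (forall g, L2 g -> is_derive y 1 (fun z => rin (v z) g) (rin h g)) ->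
  weak_derivative eta Omega v y h.
Proof.
move=> Lh H; split; first exact: Lh.
move=> g Lg.
rewrite (_ : (fun y => complex.Re _) = fun y => rin (v y) g); last first.
  by apply/funext => z; rewrite Re_inner.
rewrite (_ : (fun y => complex.Im _) = fun y => rin (v y) (mulI g)); last first.
  by apply/funext => z; rewrite Im_inner.
rewrite Re_inner Im_inner; split; apply: H; first exact: Lg.
exact: L2_mulI.
Qed.

Lemma represents_limit0 (Phi : R -> R -> R) phi psi f (v : R -> T -> R[i]) h :
  (forall y : R, 0 < y -> measurable_fun Rp (Phi y)) ->
  measurable_fun Rp psi -> dom psi f ->
  (forall l : R, 0 <= l -> Phi y l @[y --> (0 : R)^'+] --> phi l) ->
  (forall y l : R, 0 < y -> 0 <= l -> `|Phi y l| <= psi l) ->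
  (forall y : R, represents f (Phi y) (v y)) -> represents f phi h ->
  weak_limit0 eta Omega v h.
Proof.
move=> mPhi mpsi dpsi cPhi bPhi rv [Lh Hh]; apply: weak_limit0_rinner => // g Lg.
have [Lf _] := dpsi; have [m1 [m2 sp]] := spectral_pair_ex mO hE Lf Lg.
have [i1 i2] := spectral_pair_integrable mO hE Lg sp mpsi dpsi.
rewrite (Hh _ _ _ Lg sp).
rewrite (_ : (fun y => rin (v y) g) = fun y =>
  \int[m1]_(x in Rp) Phi y x - \int[m2]_(x in Rp) Phi y x); last first.
  by apply/funext => y; have [_ Hv] := rv y; rewrite (Hv _ _ _ Lg sp).
by apply: cvgB; apply: (cvg_at_right0_under_integral _ (g := psi)).
Qed.

Lemma represents_derivative (Phi Phi' : R -> R -> R) f (v : R -> T -> R[i]) h (y M : R) :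
  L2 f -> 0 < y ->
  (forall x : R, measurable_fun Rp (Phi x)) ->
  (forall x : R, 0 < x -> dom (Phi x) f) ->
  (forall x l : R, 0 < x -> 0 <= l -> is_derive x 1 (Phi ^~ l) (Phi' x l)) ->
  (forall x l : R, y / 2 < x -> 0 <= l -> `|Phi' x l| <= M) ->
  (forall x : R, represents f (Phi x) (v x)) -> represents f (Phi' y) h ->
  weak_derivative eta Omega v y h.
Proof.
move=> Lf y0 mPhi dPhi dP bP rv [Lh Hh]; apply: weak_derivative_rinner => // g Lg.
have [m1 [m2 sp]] := spectral_pair_ex mO hE Lf Lg.
rewrite (Hh _ _ _ Lg sp).
rewrite (_ : (fun y => rin (v y) g) = (fun y => \int[m1]_(x in Rp) Phi y x) -
  (fun y => \int[m2]_(x in Rp) Phi y x)); last first.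
  by apply/funext => x; have [_ Hv] := rv x; rewrite (Hv _ _ _ Lg sp).
have i x : 0 < x -> m1.-integrable Rp (EFin \o Phi x) /\ m2.-integrable Rp (EFin \o Phi x).
  by move=> x0; apply: (spectral_pair_integrable mO hE Lg sp) => //; exact: dPhi.
by apply: is_deriveB; apply: (is_derive_under_integral (M := M)) => // x /i[].
Qed.

(** The functions a and b cover all three integral formulas: a = id with b = l^s or b = 1 for those
    in t, and a = y^2 / (4 r) with b = 1 for the one in r. Tonelli is applied to each measure of a
    spectral pair, and the results are subtracted. *)
Lemma represents_weak_integral (a b k H : R -> R) (c : R) (F : R -> T -> R[i]) f h :
  measurable_fun hl a -> (forall t, 0 < t -> 0 <= a t) ->
  measurable_fun Rp b -> (forall l, 0 <= l -> 0 <= b l) -> dom b f ->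
  measurable_fun hl k -> (forall t, 0 < t -> 0 <= k t) ->
  measurable_fun Rp H -> dom H f ->
  (forall l, 0 <= l ->
    (\int[mu]_(t in hl) (expR (- (a t * l)) * b l * k t)%:E = (H l)%:E)%E) ->
  (forall t : R, 0 < t -> represents f (fun l => expR (- (a t * l)) * b l) (F t)) ->
  represents f (fun l => c * H l) h ->
  weak_integral eta Omega c k F h.
Proof.
move=> ma a0 mb b0 db mk k0 mH dH HE rF [Lh Hh]; have [Lf _] := db.
have key g : L2 g -> mu.-integrable hl (EFin \o (fun t => rin (F t) g * k t)) /\
    rin h g = c * \int[mu]_(t in hl) (rin (F t) g * k t).
  move=> Lg; have [m1 [m2 sp]] := spectral_pair_ex mO hE Lf Lg.
  have [ib1 ib2] := spectral_pair_integrable mO hE Lg sp mb db.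
  have [iH1 iH2] := spectral_pair_integrable mO hE Lg sp mH dH.
  have [j1 e1] := heat_tonelli ma a0 ib1 b0 mk k0 iH1 HE.
  have [j2 e2] := heat_tonelli ma a0 ib2 b0 mk k0 iH2 HE.
  have rE t : hl t -> rin (F t) g * k t =
      (\int[m1]_(l in Rp) (expR (- (a t * l)) * b l)) * k t -
      (\int[m2]_(l in Rp) (expR (- (a t * l)) * b l)) * k t.
    by rewrite hlP => t0; have [_ HF] := rF t t0; rewrite (HF _ _ _ Lg sp) mulrBl.
  split.
    apply: eq_integrable (integrableB _ j1 j2); [exact: measurable_itv| |exact: measurable_itv].
    by move=> t; rewrite inE => ht; rewrite /= rE// EFinB.
  have -> : \int[mu]_(t in hl) (rin (F t) g * k t) = \int[mu]_(t in hl)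
      ((\int[m1]_(l in Rp) (expR (- (a t * l)) * b l)) * k t -
       (\int[m2]_(l in Rp) (expR (- (a t * l)) * b l)) * k t).
    by apply: eq_Rintegral => t; rewrite inE => /rE.
  rewrite RintegralB//.
  by rewrite e1 e2 (Hh _ _ _ Lg sp) !RintegralZl// mulrBr.
split => // g Lg D re im.
have [i1 e1] := key g Lg; have [i2 e2] := key _ (L2_mulI mO Lg).
have reE : re = fun t => rin (F t) g * k t.
  by apply/funext => t; rewrite /re Re_inner.
have imE : im = fun t => rin (F t) (mulI g) * k t.
  by apply/funext => t; rewrite /im Im_inner.
rewrite reE imE; split => //; rewrite innerE e1 e2.
move: (Rintegral _ _ _) (Rintegral _ _ _) => p q.
by apply/eqP; rewrite eq_complex/= !mul0r subr0 addr0 !eqxx.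
Qed.

Lemma graph0 f : L2 f -> graph (cst 0) f (fun=> 0).
Proof.
move=> Lf.
have df : dom (cst 0) f by apply: (@bounded_dom _ _ _ _ _ mO _ hE _ _ 0) => // x _; rewrite normr0.
apply/(calculus_graphP eta mO); split => //; first exact: L2_0.
move=> g Lg; have [m1 [m2 sp]] := spectral_pair_ex mO hE Lf Lg.
by rewrite (spectral_pair_signed mO hE Lg sp)// rinner0l !Rintegral_cst// !mul0r subrr.
Qed.

(** Since l times the indicator of {0} vanishes, composition shows that E{0} maps into the kernel of
    L. This is the test element for orthogonality to the kernel. *)
Lemma graph_id_kernel f : L2 f -> graph id (E [set 0] f) (fun=> 0).
Proof.
move=> Lf; have m0 : measurable [set (0 : R)] by exact: measurable_set1.
apply: (calculus_comp mO hE hE0 (phi := \1_[set 0]) (f := f)) => //.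
- exact: calculus_graph_indic.
- rewrite (_ : (fun x => _) = cst 0); first exact: graph0.
  apply/funext => x /=; rewrite indicE.
  by case: (pselect (x = 0)) => [->|x0]; rewrite ?mul0r// memNset ?mulr0.
Qed.

(** The squares of both masses at 0 are at most E_{f,f}{0} E_{g,g}{0} = 0. *)
Lemma pair_set1_eq0 f g m1 m2 : L2 f -> L2 g -> rin f (E [set 0] f) = 0 ->
  pair_of f g m1 m2 -> m1 [set 0] = 0%E /\ m2 [set 0] = 0%E.
Proof.
move=> Lf Lg f0 [_ b1 b2]; have m0 : measurable [set (0 : R)] by exact: measurable_set1.
have s0 : spectral_re eta Omega E f f [set 0] = 0 by rewrite /spectral_re rinnerC.
have z (m : {finite_measure set R -> \bar R}) : fine (m [set 0]) ^+ 2 <= 0 -> m [set 0] = 0%E.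
  rewrite real_exprn_even_le0 ?num_real//= => /eqP e.
  by rewrite -(fineK (fin_num_measure m _ m0)) e.
by split; apply: z; [have := b1 _ m0|have := b2 _ m0]; rewrite s0 mul0r.
Qed.

Lemma eq_represents_off0 phi psi f v : L2 f -> rin f (E [set 0] f) = 0 ->
  measurable_fun Rp phi -> measurable_fun Rp psi ->
  (forall x, 0 < x -> phi x = psi x) ->
  represents f phi v -> represents f psi v.
Proof.
move=> Lf f0 mphi mpsi e [Lv Hv]; split => // g m1 m2 Lg sp; rewrite (Hv _ _ _ Lg sp).
have [z1 z2] := pair_set1_eq0 Lf Lg f0 sp.
have ae (m : {finite_measure set R -> \bar R}) : m [set 0] = 0%E ->
    \int[m]_(x in Rp) phi x = \int[m]_(x in Rp) psi x.
  move=> m0; congr fine; apply: ae_eq_integral => //; try exact/measurable_EFinP.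
  exists [set 0]; split => // x /= /not_implyP[]; rewrite in_itv/= andbT => x0.
  apply: contra_notP => xn0; rewrite e// lt_neqAle x0 andbT eq_sym.
  by apply/eqP.
by rewrite !ae.
Qed.

End spectral_representation.

(** * The extension of a function in the domain of a fractional power *)

Section extension_problem.
Context {d : measure_display} {T : measurableType d} {R : realType}.
Variables (eta : {measure set T -> \bar R}) (Omega : set T).
Hypothesis mO : measurable Omega.
Variable E : set R -> (T -> R[i]) -> (T -> R[i]).
Hypothesis hE : resolution_of_identity eta Omega E.
Local Notation Rp := (`[0%R, +oo[%classic : set R).
Local Notation hl := (`]0%R, +oo[%classic : set R).
Local Notation mu := (@lebesgue_measure R).
Hypothesis hE0 : forall f, L2 eta Omega f -> E Rp f = f %[ae eta in Omega].
Local Notation L2 := (L2 eta Omega).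
Local Notation rin := (rinner eta Omega).
Local Notation graph := (calculus_graph eta Omega E).
Local Notation dom := (calculus_dom eta Omega E).
Local Notation calc := (calculus eta Omega E).
Local Notation repr := (represents eta Omega E).
Variables (s : R) (f : T -> R[i]).
Hypotheses (s0 : 0 < s) (s1 : s < 1).
Hypothesis df : dom (fun l => l `^ s) f.
Implicit Types y l t : R.

Let Lf : L2 f. Proof. by case: df. Qed.

Let G0 : 0 < Gamma s. Proof. exact: Gamma_gt0. Qed.

Definition ext_u y := calc (ext0 s y) f.
Definition ext_p y := calc (ext1 s y) f.
Definition ext_Lu y := calc (ext2 s y) f.
(** A multiple of [ext_p] rather than a value of the calculus, because its kernel is not nonnegative
    for y > 0; likewise [ext_uyy], where 2 - 4 s has no fixed sign. *)
Definition ext_uy y x := (- (2 / y))%:C * ext_p y x.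
Definition ext_uyy y x := ((2 - 4 * s) / y ^+ 2)%:C * ext_p y x + ext_Lu y x.

Let mpow : measurable_fun Rp (fun l => l `^ s).
Proof. exact: (measurable_funS measurableT _ (measurable_powR s)). Qed.

Lemma dom_ext0 y : dom (ext0 s y) f.
Proof.
apply: (bounded_dom mO hE (M := 1)) => //; first exact: ext0_measurable.
by move=> l _; exact: ext0_le1.
Qed.

Lemma dom_ext1 y : dom (ext1 s y) f.
Proof.
apply: (bounded_dom mO hE (M := ext1_bound s)) => //; first exact: ext1_measurable.
by move=> l l0; exact: ext1_le.
Qed.

Lemma dom_ext2 y : 0 < y -> dom (ext2 s y) f.
Proof.
move=> y0; apply: (bounded_dom mO hE (M := 4 / y ^+ 2 * Gamma (s + 1) / Gamma s)) => //.
  exact: ext2_measurable.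
by move=> l l0; exact: ext2_le.
Qed.

Lemma graph_ext_u y : graph (ext0 s y) f (ext_u y).
Proof.
apply: calculusP => //; [exact: ext0_measurable| |exact: dom_ext0].
by move=> l _; exact: ext0_ge0.
Qed.

Lemma repr_ext_u y : repr f (ext0 s y) (ext_u y).
Proof. by apply: graph_represents => //; [exact: ext0_measurable|exact: graph_ext_u]. Qed.

Lemma repr_ext_p y : repr f (ext1 s y) (ext_p y).
Proof.
apply: graph_represents => //; first exact: ext1_measurable.
apply: calculusP => //; [exact: ext1_measurable| |exact: dom_ext1].
by move=> l _; exact: ext1_ge0.
Qed.

Lemma graph_ext_Lu y : 0 < y -> graph (ext2 s y) f (ext_Lu y).
Proof.
move=> y0; apply: calculusP => //; [exact: ext2_measurable| |exact: dom_ext2].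
by move=> l; exact: ext2_ge0.
Qed.

(** As [ext2] is l times [ext0] and is bounded in l, composition places u(y) in the domain of L for
    every y > 0 and computes L u(y). *)
Lemma graph_id_ext_u y : 0 < y -> graph id (ext_u y) (ext_Lu y).
Proof.
move=> y0; apply: (calculus_comp mO hE hE0 (phi := ext0 s y) (f := f)) => //.
- exact: ext0_measurable.
- by move=> l _; exact: ext0_ge0.
- exact: graph_ext_u.
- exact: graph_ext_Lu.
Qed.

Lemma repr_ext_uy y : repr f (fun l => - (2 / y) * ext1 s y l) (ext_uy y).
Proof.
apply: represents_Z => //; [exact: ext1_measurable|exact: dom_ext1|exact: repr_ext_p].
Qed.

Lemma repr_ext_uyy y : 0 < y ->
  repr f (fun l => (2 - 4 * s) / y ^+ 2 * ext1 s y l + ext2 s y l) (ext_uyy y).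
Proof.
move=> y0; apply: represents_lin => //.
- exact: ext1_measurable.
- exact: dom_ext1.
- exact: ext2_measurable.
- exact: dom_ext2.
- exact: repr_ext_p.
- by apply: graph_represents => //; [exact: ext2_measurable|exact: graph_ext_Lu].
Qed.

Lemma ext_u0 : ext_u 0 = f %[ae eta in Omega].
Proof.
have [Lu Hu] := repr_ext_u 0; have [_ Hf] := represents1 mO hE hE0 Lf.
apply: L2_sep => // g Lg; have [m1 [m2 sp]] := spectral_pair_ex mO hE Lf Lg.
rewrite (Hu _ _ _ Lg sp) (Hf _ _ _ Lg sp).
by congr (_ - _); apply: eq_Rintegral => l _; rewrite ext0_0.
Qed.

Lemma cvg_ext_u : weak_limit0 eta Omega ext_u f.
Proof.
apply: (represents_limit0 mO hE (Phi := ext0 s) (phi := cst 1) (psi := cst 1) (f := f)) => //.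
- by move=> y _; exact: ext0_measurable.
- by apply: (bounded_dom mO hE (M := 1)) => // x _; rewrite normr1.
- by move=> l _; exact: cvg_ext0.
- by move=> y l _ _; exact: ext0_le1.
- exact: repr_ext_u.
- exact: represents1.
Qed.

Lemma weak_derivative_ext_u y : 0 < y -> weak_derivative eta Omega ext_u y (ext_uy y).
Proof.
move=> y0; have B0 : 0 <= ext1_bound s by apply: le_trans (ext1_le s0 s1 0 (lexx 0)).
apply: (represents_derivative mO hE (Phi := ext0 s)
  (Phi' := fun y l => - (2 / y) * ext1 s y l) (f := f) (M := 4 / y * ext1_bound s)).
- exact: Lf.
- exact: y0.
- by move=> x; exact: ext0_measurable.
- by move=> x _; exact: dom_ext0.
- by move=> x l x0 l0; exact: is_derive_ext0.
- move=> x l xy l0; have x0 : 0 < x by apply: lt_trans xy; exact: divr_gt0.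
  rewrite normrM normrN; apply: ler_pM => //; last exact: ext1_le.
  rewrite gtr0_norm ?divr_gt0// ler_pdivrMr// mulrAC ler_pdivlMr//.
  by move: xy; rewrite ltr_pdivrMr// => xy; lra.
- exact: repr_ext_u.
- exact: repr_ext_uy.
Qed.

Lemma weak_derivative_ext_uy y : 0 < y -> weak_derivative eta Omega ext_uy y (ext_uyy y).
Proof.
move=> y0; have B0 : 0 <= ext1_bound s by apply: le_trans (ext1_le s0 s1 0 (lexx 0)).
apply: (represents_derivative mO hE (Phi := fun y l => - (2 / y) * ext1 s y l)
  (Phi' := fun y l => (2 - 4 * s) / y ^+ 2 * ext1 s y l + ext2 s y l) (f := f)
  (M := `|2 - 4 * s| / (y / 2) ^+ 2 * ext1_bound s +
        4 / (y / 2) ^+ 2 * Gamma (s + 1) / Gamma s)).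
- exact: Lf.
- exact: y0.
- by move=> x; apply: measurable_funM => //; exact: ext1_measurable.
- move=> x x0; apply: (bounded_dom mO hE (M := (2 / x) * ext1_bound s)) => //.
    by apply: measurable_funM => //; exact: ext1_measurable.
  move=> l l0; have x2 : 0 < 2 / x by exact: divr_gt0.
  by rewrite normrM normrN (gtr0_norm x2) (ler_wpM2l (ltW x2))// ext1_le.
- by move=> x l x0 l0; exact: is_derive_ext1.
- move=> x l xy l0; have x0 : 0 < x by apply: lt_trans xy; exact: divr_gt0.
  have y2 : 0 < y / 2 by exact: divr_gt0.
  have xy2 : (x ^+ 2)^-1 <= ((y / 2) ^+ 2)^-1.
    by rewrite lef_pV2 ?posrE ?exprn_gt0// lerXn2r ?nnegrE ?ltW.
  apply: le_trans (ler_normD _ _) _; apply: lerD.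
    rewrite normrM normrM (ger0_norm (x := (x ^+ 2)^-1)) ?invr_ge0 ?sqr_ge0//.
    by apply: ler_pM => //; [rewrite mulr_ge0// invr_ge0 sqr_ge0|rewrite ler_wpM2l|exact: ext1_le].
  apply: le_trans (ext2_le s0 x0 l0) _.
  by rewrite ler_wpM2r ?invr_ge0 ?(ltW G0)// ler_wpM2r ?Gamma_ge0// ler_wpM2l.
- exact: repr_ext_uy.
- exact: repr_ext_uyy.
Qed.

Let Lsf := fracpow eta Omega E s f.

Lemma graph_fracpow : graph (fun l => l `^ s) f Lsf.
Proof. by apply: calculusP => // l _; exact: powR_ge0. Qed.

Lemma repr_fracpow (c : R) : repr f (fun l => c * l `^ s) (fun x => c%:C * Lsf x).
Proof. by apply: represents_Z => //; apply: graph_represents => //; exact: graph_fracpow. Qed.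

Lemma dom_scale_pow (c : R) : dom (fun l => c * l `^ s) f.
Proof.
have [mf mfE] := spectral_measure_ex mO hE Lf.
have /(calculus_domE _ mfE)[_ i] := df.
apply/(calculus_domE _ mfE); split; first exact: Lf.
rewrite (_ : (\int[mf]_(x in Rp) _)%E =
    ((c ^+ 2)%:E * \int[mf]_(x in Rp) ((x `^ s) ^+ 2)%:E)%E).
  by rewrite lte_mul_pinfty// lee_fin sqr_ge0.
rewrite -ge0_integralZl//.
- by apply: eq_integral => x _; rewrite exprMn EFinM.
- by apply/measurable_EFinP; exact: measurable_funX.
- by move=> x _; rewrite lee_fin sqr_ge0.
- by rewrite lee_fin sqr_ge0.
Qed.

Lemma mscale_pow (c : R) : measurable_fun Rp (fun l => c * l `^ s).
Proof. exact: measurable_funM. Qed.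

Lemma cvg_ext_u_quotient : weak_limit0 eta Omega
  (fun y x => (ext_u y x - ext_u 0 x) / (y `^ (2 * s))%:C)
  (fun x => (ext_const s)%:C * Lsf x).
Proof.
apply: (represents_limit0 mO hE (Phi := fun y l => (ext0 s y l - 1) / y `^ (2 * s))
  (phi := fun l => ext_const s * l `^ s)
  (psi := fun l => Gamma (1 - s) / s / (4 `^ s * Gamma s) * l `^ s) (f := f)).
- move=> y _; apply: measurable_funM => //; apply: measurable_funB => //.
  exact: ext0_measurable.
- exact: mscale_pow.
- exact: dom_scale_pow.
- by move=> l l0; exact: cvg_ext0_quotient.
- by move=> y l y0 l0; exact: ext0_quotient_le.
(* As [ext0 s 0] is 1, the kernel of the quotient is a linear combination of two kernels of u;
   inverses being total, this covers every y. *)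
- move=> y; pose t := (y `^ (2 * s))^-1.
  rewrite (_ : (fun x => _) = fun x => t%:C * ext_u y x + (- t)%:C * ext_u 0 x); last first.
    by apply/funext => x; rewrite /t -fmorphV /= rmorphN mulNr -mulrBr mulrC.
  apply: (@eq_represents _ _ _ _ _ _ (fun l => t * ext0 s y l + (- t) * ext0 s 0 l)).
    by move=> l _; rewrite ext0_0// /t; ring.
  apply: represents_lin => //.
  + exact: ext0_measurable.
  + exact: dom_ext0.
  + by apply: measurable_funM => //; exact: ext0_measurable.
  + apply: (bounded_dom mO hE (M := `|t|)) => //.
      by apply: measurable_funM => //; exact: ext0_measurable.
    by move=> x _; rewrite ext0_0// mulr1 normrN.
  + exact: repr_ext_u.
  + apply: represents_Z => //; [exact: ext0_measurable|exact: dom_ext0|exact: repr_ext_u].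
- exact: repr_fracpow.
Qed.

Lemma cvg_ext_uy_flux : weak_limit0 eta Omega
  (fun y x => (y `^ (1 - 2 * s))%:C * ext_uy y x)
  (fun x => (2 * s * ext_const s)%:C * Lsf x).
Proof.
apply: (represents_limit0 mO hE
  (Phi := fun y l => y `^ (1 - 2 * s) * (- (2 / y) * ext1 s y l))
  (phi := fun l => 2 * s * ext_const s * l `^ s)
  (psi := fun l => 2 / (4 `^ s * Gamma s) * Gamma (1 - s) * l `^ s) (f := f)).
- by move=> y _; do 2 apply: measurable_funM => //; exact: ext1_measurable.
- exact: mscale_pow.
- exact: dom_scale_pow.
- by move=> l l0; exact: cvg_ext1_flux.
- by move=> y l y0 l0; exact: ext1_flux_le.
- move=> y; apply: represents_Z => //; last exact: repr_ext_uy.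
    by apply: measurable_funM => //; exact: ext1_measurable.
  apply: (bounded_dom mO hE (M := `|2 / y| * ext1_bound s)) => //.
    by apply: measurable_funM => //; exact: ext1_measurable.
  by move=> l l0; rewrite normrM normrN ler_wpM2l// ext1_le.
- exact: repr_fracpow.
Qed.

Let mexp t : measurable_fun Rp (fun l => expR (- (t * l))).
Proof.
apply: measurableT_comp; first exact: measurable_expR.
by apply: measurable_funN; exact: measurable_funM.
Qed.

Let exp_le1 t l : 0 <= t -> 0 <= l -> `|expR (- (t * l))| <= 1.
Proof. by move=> t0 l0; rewrite gtr0_norm ?expR_gt0// expR_le1 oppr_le0 mulr_ge0. Qed.

Lemma repr_heat t : 0 <= t -> repr f (fun l => expR (- (t * l)) * 1) (heat eta Omega E t f).
Proof.
move=> t0; apply: (@eq_represents _ _ _ _ _ _ (fun l => expR (- (t * l)))).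
  by move=> l _; rewrite mulr1.
apply: graph_represents => //; apply: calculusP => //.
by apply: (bounded_dom mO hE (M := 1)) => // l l0; exact: exp_le1.
Qed.

(** Composition yields Lsf as input of e^(-tL), but [heat] picks its own representative; uniqueness
    of the graph up to null sets identifies the two. *)
Lemma repr_heat_fracpow t : 0 <= t ->
  repr f (fun l => expR (- (t * l)) * l `^ s) (heat eta Omega E t Lsf).
Proof.
move=> t0; have mp : measurable_fun Rp (fun l => expR (- (t * l)) * l `^ s).
  exact: measurable_funM.
have p0 l : 0 <= l -> 0 <= expR (- (t * l)) * l `^ s.
  by move=> _; rewrite mulr_ge0 ?expR_ge0 ?powR_ge0.
have dp : dom (fun l => expR (- (t * l)) * l `^ s) f.
  apply: (le_dom mO hE df mpow mp) => l l0; rewrite normrM.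
  by rewrite ler_piMl// exp_le1.
have gk := calculusP mO hE hE0 mp p0 dp.
have e0 l : 0 <= l -> 0 <= expR (- (t * l)) by move=> _; exact: expR_ge0.
have pow0 l : 0 <= l -> 0 <= l `^ s by move=> _; exact: powR_ge0.
have gh := calculus_comp mO hE hE0 mpow (mexp t) pow0 e0 graph_fracpow gk.
have gh' : graph (fun l => expR (- (t * l))) Lsf (heat eta Omega E t Lsf).
  by apply: (@xgetPex _ (fun=> 0) [set h | graph _ Lsf h]); eexists; exact: gh.
have [_ Lh _] := gh'.
apply: (represents_ae mO Lh (calculus_graph_uniq mO gh gh')).
exact: graph_represents.
Qed.

Let kern_measurable (a p : R) :
  measurable_fun hl (fun t => expR (- (a / (4 * t))) / t `^ p).
Proof.
apply: continuous_halfline_measurable => x x0; apply: cvgM.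
  apply: continuous_comp; last exact: continuous_expR.
  apply: cvgN; apply: cvgM; first exact: cvg_cst.
  apply: cvgV; first by rewrite mulf_neq0// gt_eqF.
  by apply: cvgM; [exact: cvg_cst|exact: cvg_id].
by apply: cvgV; [rewrite gt_eqF// powR_gt0|exact: powR_continuous].
Qed.

Let kern_ge0 (a p t : R) : 0 <= expR (- (a / (4 * t))) / t `^ p.
Proof. by rewrite divr_ge0 ?expR_ge0 ?powR_ge0. Qed.

Let dom1 : dom (cst 1) f.
Proof. by apply: (bounded_dom mO hE (M := 1)) => // x _; rewrite normr1. Qed.

Let dom_bess y (c : R) : dom (fun l => c * bess s (y ^+ 2 / 4 * l)) f.
Proof.
apply: (bounded_dom mO hE (M := `|c| * Gamma s)) => //.
  by apply: measurable_funM => //; exact: bess_arg_measurable.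
by move=> l l0; rewrite normrM ler_wpM2l// ger0_norm ?bess_ge0 ?bess_le_Gamma.
Qed.

Let mbess y (c : R) : measurable_fun Rp (fun l => c * bess s (y ^+ 2 / 4 * l)).
Proof. by apply: measurable_funM => //; exact: bess_arg_measurable. Qed.

Let argE y t : y ^+ 2 / (4 * t) = y ^+ 2 / 4 / t.
Proof. by rewrite invfM mulrA. Qed.

Lemma ext_u_poisson y : 0 < y -> weak_integral eta Omega
  (y `^ (2 * s) / (4 `^ s * Gamma s))
  (fun t => expR (- (y ^+ 2 / (4 * t))) / t `^ (1 + s))
  (fun t => heat eta Omega E t f) (ext_u y).
Proof.
move=> y0; have c0 : 0 < y ^+ 2 / 4 by rewrite divr_gt0// exprn_gt0.
apply: (represents_weak_integral mO hE (a := id) (b := cst 1) (f := f)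
  (H := fun l => (y ^+ 2 / 4) `^ (- s) * bess s (y ^+ 2 / 4 * l))) => //.
- by move=> t /ltW.
- move=> l l0; rewrite -(integral_bess_poisson s0 c0 l0); apply: eq_integral => t _.
  by rewrite mulr1 argE.
- by move=> t /ltW t0; exact: repr_heat.
- apply: (@eq_represents _ _ _ _ _ _ (ext0 s y)); last exact: repr_ext_u.
  (* [powR_arg] at l = 1 turns (y^2 / 4)^s into y^(2 s) / 4^s, which cancels the constant of the
     Poisson formula up to 1 / Gamma(s). *)
  move=> l _; rewrite /ext0 powRN -[y ^+ 2 / 4]mulr1 powR_arg// powR1 !mulr1.
  by field; rewrite !gt_eqF ?powR_gt0.
Qed.

Lemma ext_u_subordination y : 0 < y -> weak_integral eta Omega (Gamma s)^-1
  (fun r => expR (- r) / r `^ (1 - s))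
  (fun r => heat eta Omega E (y ^+ 2 / (4 * r)) f) (ext_u y).
Proof.
move=> y0; have c0 : 0 <= y ^+ 2 / 4 by rewrite divr_ge0// sqr_ge0.
apply: (represents_weak_integral mO hE (a := fun r => y ^+ 2 / (4 * r)) (b := cst 1) (f := f)
  (* The factor 1 gives H the shape to which [dom_bess] and [mbess] apply. *)
  (H := fun l => 1 * bess s (y ^+ 2 / 4 * l))) => //.
- apply: continuous_halfline_measurable => x x0.
  apply: cvgM; first exact: cvg_cst.
  apply: cvgV; first by rewrite mulf_neq0// gt_eqF.
  by apply: cvgM; [exact: cvg_cst|exact: cvg_id].
- by move=> t t0; rewrite divr_ge0 ?sqr_ge0// mulr_ge0// ltW.
- apply: continuous_halfline_measurable => x x0; apply: cvgM.
    apply: continuous_comp; last exact: continuous_expR.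
    by apply: cvgN; exact: cvg_id.
  by apply: cvgV; [rewrite gt_eqF// powR_gt0|exact: powR_continuous].
- by move=> t _; rewrite divr_ge0 ?expR_ge0 ?powR_ge0.
- move=> l l0; rewrite mul1r -integral_bess_subordination//; apply: eq_integral => t _.
  by rewrite mulr1 argE.
- by move=> t t0; apply: repr_heat; rewrite divr_ge0 ?sqr_ge0// mulr_ge0// ltW.
- apply: (@eq_represents _ _ _ _ _ _ (ext0 s y)); last exact: repr_ext_u.
  by move=> l _; rewrite /ext0 mul1r mulrC.
Qed.

Lemma ext_u_heat_fracpow y : rin f (E [set 0] f) = 0 ->
  weak_integral eta Omega (Gamma s)^-1
    (fun t => expR (- (y ^+ 2 / (4 * t))) / t `^ (1 - s))
    (fun t => heat eta Omega E t Lsf) (ext_u y).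
Proof.
move=> f0; have c0 : 0 <= y ^+ 2 / 4 by rewrite divr_ge0// sqr_ge0.
(* The t-integral equals K(y^2 l / 4) for l > 0 but 0 at l = 0, and H records that value. It may be
   exchanged for the kernel of u because f has no spectral mass at 0. *)
pose H l := \1_(~` [set 0]) l * bess s (y ^+ 2 / 4 * l).
have mH : measurable_fun Rp H.
  apply: measurable_funM; last exact: bess_arg_measurable.
  by apply: measurable_indic; apply: measurableC; exact: measurable_set1.
have HE l : 0 < l -> H l = bess s (y ^+ 2 / 4 * l).
  move=> l0; rewrite /H indicE mem_set ?mul1r//=.
  by apply/eqP; rewrite gt_eqF.
have H0 : H 0 = 0 by rewrite /H indicE memNset ?mul0r//= => /(_ erefl).
apply: (represents_weak_integral mO hE (a := id) (b := fun l => l `^ s) (f := f) (H := H)) => //.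
- by move=> t /ltW.
- by move=> l _; exact: powR_ge0.
- apply: (bounded_dom mO hE (M := Gamma s)) => //.
  move=> l; rewrite le_eqVlt => /predU1P[<-|l0]; first by rewrite H0 normr0 ltW.
  by rewrite HE// ger0_norm ?bess_ge0 ?bess_le_Gamma.
- move=> l; rewrite le_eqVlt => /predU1P[<-|l0].
    by rewrite H0; apply: integral0_eq => t _; rewrite powR0 ?gt_eqF// mulr0 mul0r.
  rewrite (HE l l0) -(integral_bess_heat s0 c0 l0); apply: eq_integral => t _.
  by rewrite argE.
- by move=> t /ltW t0; exact: repr_heat_fracpow.
- apply: (eq_represents_off0 (phi := ext0 s y)) => //.
  + exact: ext0_measurable.
  + exact: measurable_funM.
  + by move=> l l0; rewrite HE// /ext0 mulrC.
  + exact: repr_ext_u.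
Qed.

End extension_problem.

Theorem theorem1p1 (R : realType) (n : nat) (hn : (0 < n)%N)
    (Omega : set (borelRn R n)) (hOmega : @open 'rV[R]_n Omega)
    (eta : {measure set (borelRn R n) -> \bar R})
    (L : unbounded_operator (borelRn R n -> R[i]))
    (hL : is_operator eta Omega L)
    (hLpdo : second_order_pdo eta Omega L)
    (hLnneg : nonnegative_operator eta Omega L)
    (hLdense : densely_defined eta Omega L)
    (hLsa : self_adjoint eta Omega L)
    (E : set R -> (borelRn R n -> R[i]) -> (borelRn R n -> R[i]))
    (hE : spectral_resolution eta Omega L E)
    (sigma : R) (hsigma0 : 0 < sigma) (hsigma1 : sigma < 1)
    (f : borelRn R n -> R[i])
    (hf : calculus_dom eta Omega E (fun l => l `^ sigma) f) :
  exists u uy uyy : R -> borelRn R n -> R[i],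
    let Lsf := fracpow eta Omega E sigma f in
    let c := Gamma_opp sigma / (4 `^ sigma * Gamma sigma) in
    [/\ orthogonal_to_kernel eta Omega L f ->
          forall y : R, 0 <= y ->
          weak_integral eta Omega (Gamma sigma)^-1
            (fun t => expR (- (y ^+ 2 / (4 * t))) / t `^ (1 - sigma))
            (fun t => heat eta Omega E t Lsf) (u y),
        extension_solution eta Omega L sigma f u uy uyy,
        weak_limit0 eta Omega
          (fun y x => (u y x - u 0 x) / (y `^ (2 * sigma))%:C)
          (fun x => c%:C * Lsf x) /\
        (exists2 l, weak_limit0 eta Omega
            (fun y x => (y `^ (1 - 2 * sigma))%:C * uy y x) l &
          (fun x => c%:C * Lsf x) = (fun x => ((2 * sigma)^-1)%:C * l x)
            %[ae eta in Omega]) &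
        forall y : R, 0 < y ->
          weak_integral eta Omega
            (y `^ (2 * sigma) / (4 `^ sigma * Gamma sigma))
            (fun t => expR (- (y ^+ 2 / (4 * t))) / t `^ (1 + sigma))
            (fun t => heat eta Omega E t f) (u y) /\
          weak_integral eta Omega (Gamma sigma)^-1
            (fun r => expR (- r) / r `^ (1 - sigma))
            (fun r => heat eta Omega E (y ^+ 2 / (4 * r)) f) (u y)].
Proof.
have mO : measurable Omega by exact: sub_sigma_algebra.
have [hR hE0 _ hEL] := hE; have [Lf _] := hf.
exists (ext_u eta Omega E sigma f), (ext_uy eta Omega E sigma f),
  (ext_uyy eta Omega E sigma f).
move=> Lsf c; split.
- move=> orth y _; apply: ext_u_heat_fracpow => //.
  (* Orthogonality is tested on E{0} f, an element of the kernel of L; it gives E_{f,f}{0} = 0. *)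
  have /hEL[dh _ h0] := graph_id_kernel mO hR hE0 Lf.
  by have := orth _ dh h0; rewrite innerE => -[].
- split; [exact: ext_u0|exact: cvg_ext_u|move=> y y0].
  have /hEL[du LK hK] := graph_id_ext_u mO hR hE0 hsigma0 hf y0.
  split; [exact: du|exact: weak_derivative_ext_u|exact: weak_derivative_ext_uy|].
  apply: filterS hK => x /[apply] ->; rewrite /ext_uyy /ext_uy mulrA -rmorphM.
  (* The terms in L u cancel at once, and this identity of coefficients cancels those in [ext_p]. *)
  rewrite (_ : (1 - 2 * sigma) / y * - (2 / y) = - ((2 - 4 * sigma) / y ^+ 2)).
    by rewrite rmorphN; ring.
  by field; rewrite gt_eqF.
- split; first exact: cvg_ext_u_quotient.
  exists (fun x => (2 * sigma * c)%:C * Lsf x); first exact: cvg_ext_uy_flux.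
  apply: aeW => x _; rewrite mulrA -rmorphM mulKf//.
  by rewrite mulf_neq0// gt_eqF.
- by move=> y y0; split; [exact: ext_u_poisson|exact: ext_u_subordination].
Qed.
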